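(* Let $(X,J)$ be a spectrally negative MAP with matrix exponent $F$ and scale matrix $W$, and let $Z(\alpha,x)=e^{\alpha x}\big(I-\int_0^x e^{-\alpha y}W(y)\,\mathrm dy\,F(\alpha)\big)$ for $\alpha,x\ge 0$. Let $Y(t)=X(t)+R(t)$ with $R(t)=-\big(0\wedge \inf_{s\le t}X(s)\big)$ be $X$ reflected at its infimum at $0$, and $T_a=\inf\{t\ge 0: Y(t)>a\}$. Then for all $\alpha\ge 0$ and $a>0$ the matrix $Z(\alpha,a)$ is invertible, and for all $x\in[0,a]$, \[\mathbb E_x[e^{-\alpha R(T_a)};J(T_a)]=Z(\alpha,x)Z(\alpha,a)^{-1}.\]
   Context: Setting: $(X,J)$ is a Markov additive process (MAP): $X$ real-valued càdlàg, $J$ right-continuous with finite state space $E=\{1,\dots,N\}$, such that given $J(t)=i$, $(X(t+s)-X(t),J(t+s))_{s\ge0}$ is independent of $\mathcal F_t$ and distributed as $(X(s)-X(0),J(s))_{s\ge 0}$ given $J(0)=i$. Killing is allowed (absorbing state $\partial$, $X=\infty$ when $J=\partial$). Equivalently $J$ is an irreducible Markov chain with transition rate matrix $Q$ (row sums $\le 0$); while $J=i$, $X$ evolves as a Lévy process $X_i$; a transition $i\to j\ne i$ of $J$ causes an independent jump $U_{ij}\le 0$ of $X$. Each $X_i$ is spectrally negative (no positive jumps) and not with non-increasing paths; paths of $X$ are not a.s. monotone. With $\mathbb E e^{\alpha X_i(t)}=e^{\psi_i(\alpha)t}$ and $G(\alpha)_{ij}=\mathbb E e^{\alpha U_{ij}}$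 ($G_{ii}=1$), the matrix exponent is $F(\alpha)=\mathrm{diag}(\psi_i(\alpha))+Q\circ G(\alpha)$ ($\circ$ entrywise product), so $\mathbb E_i[e^{\alpha X(t)};J(t)=j]=(e^{F(\alpha)t})_{ij}$. The scale matrix $W:[0,\infty)\to\mathbb R^{N\times N}$ is the unique continuous function with $\int_0^\infty e^{-\alpha x}W(x)\,\mathrm dx=F(\alpha)^{-1}$ for all $\alpha>\eta=\max\{\Re z:\det F(z)=0\}$. Notation: $\mathbb P_{x,i}$ is the law given $X(0)=x,J(0)=i$; $\mathbb E_x[V;J(\tau)]$ denotes the $N\times N$ matrix with $(i,j)$ entry $\mathbb E_{x,i}[V\mathbf 1\{J(\tau)=j\}]$. $I$ is the identity matrix. *)

(* Defs.v *)
From HB Require Import structures.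
From mathcomp Require Import all_boot all_order all_algebra.
From mathcomp Require Import all_classical all_reals all_analysis.
Set Implicit Arguments. Unset Strict Implicit. Unset Printing Implicit Defensive.
Import Order.TTheory GRing.Theory Num.Theory.
Import numFieldNormedType.Exports.
Local Open Scope classical_set_scope.
Local Open Scope ring_scope.

Section MAP.
Variable R : realType.

Definition mxpow (n : nat) (A : 'M[R]_n) (k : nat) : 'M[R]_n :=
  iter k (mulmx A) 1%:M.
Definition expmx (n : nat) (A : 'M[R]_n) : 'M[R]_n :=
  \matrix_(i, j) limn (series (fun k : nat => (mxpow A k) i j / (k`!)%:R)).

Variables (d : measure_display) (Om : measurableType d) (n : nat).
(* States E = 'I_n ; the cemetery state \partial is encoded by None. *)
Variables (P : R -> 'I_n -> probability Om R)
          (X : R -> Om -> R) (J : R -> Om -> option 'I_n).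

Definition nat_gen (t : R) : set (set Om) :=
  [set A | exists u, 0 <= u <= t /\
     ((exists B : set R, measurable B /\ A = X u @^-1` B) \/
      (exists j, A = [set w | J u w = j]))].
Definition natF (t : R) : set (set Om) := <<s nat_gen t >>.

Definition good_path (w : Om) : Prop :=
  [/\ (forall s t, 0 <= s <= t -> J s w = None -> J t w = None),
      (forall t, 0 <= t -> \forall s \near t^'+, J s w = J t w),
      (forall t, 0 <= t -> J t w <> None -> X s w @[s --> t^'+] --> X t w),
      (forall t, 0 < t -> J t w <> None -> cvg (X s w @[s --> t^'-])) &
      (forall t, 0 < t -> J t w <> None -> X t w <= lim (X s w @[s --> t^'-]))].

Definition monotone_path (w : Om) : Prop :=
  (forall s t, 0 <= s <= t -> J t w <> None -> X s w <= X t w) \/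
  (forall s t, 0 <= s <= t -> J t w <> None -> X t w <= X s w).

(** X is non-increasing during the initial sojourn of J in state i
    (i.e. the Levy process X_i has non-increasing path there). *)
Definition nonincr_in_state (i : 'I_n) (w : Om) : Prop :=
  forall s t, 0 <= s <= t -> (forall u, 0 <= u <= t -> J u w = Some i) ->
    X t w <= X s w.

Definition MAP_measurable : Prop :=
  (forall t, measurable_fun setT (X t)) /\
  (forall t j, measurable [set w | J t w = j]).

Definition MAP_start_paths : Prop :=
  (forall x i, {ae P x i, forall w, X 0 w = x /\ J 0 w = Some i}) /\
  (forall x i, {ae P x i, forall w, good_path w}).

Definition markov_additive : Prop :=
  forall x i t s (k j : 'I_n) (A : set Om) (B : set R),
    0 <= t -> 0 <= s -> natF t A -> measurable B ->
    P x i (A `&` [set w | J t w = Some k] `&`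
           [set w | B (X (t + s) w - X t w) /\ J (t + s) w = Some j]) =
    mule (P x i (A `&` [set w | J t w = Some k]))
         (P 0 k [set w | B (X s w - X 0 w) /\ J s w = Some j]).

Definition J_irreducible : Prop :=
  forall i j : 'I_n, exists t : R, 0 <= t /\ (0 < P 0 i [set w | J t w = Some j])%E.

Definition is_spec_neg_MAP : Prop :=
  [/\ MAP_measurable, MAP_start_paths, markov_additive, J_irreducible &
      (forall i, ~ {ae P 0 i, forall w, nonincr_in_state i w}) /\
      ~ (forall i, {ae P 0 i, forall w, monotone_path w})].

Definition is_matrix_exponent (F : R -> 'M[R]_n) : Prop :=
  forall (alpha t : R) (i j : 'I_n), 0 <= alpha -> 0 <= t ->
    (\int[P 0 i]_w (if J t w == Some j then expR (alpha * X t w) else 0)%:E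
     = ((expmx (t *: F alpha)) i j)%:E)%E.

Definition is_scale_matrix (F : R -> 'M[R]_n) (W : R -> 'M[R]_n) : Prop :=
  (forall i j, {within `[0, +oo[, continuous (fun x => W x i j)}) /\
  exists alpha0 : R, forall alpha, alpha0 < alpha ->
    F alpha \in unitmx /\
    forall i j,
      (lebesgue_measure).-integrable `[0, +oo[
          (fun y => (expR (- alpha * y) * W y i j)%:E) /\
      Rintegral lebesgue_measure `[0, +oo[ (fun y => expR (- alpha * y) * W y i j)
        = invmx (F alpha) i j.

Definition Zmat (F W : R -> 'M[R]_n) (alpha x : R) : 'M[R]_n :=
  expR (alpha * x) *:
    (1%:M - (\matrix_(i, j) Rintegral lebesgue_measure `[0, x]
                (fun y => expR (- alpha * y) * W y i j)) *m F alpha).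

Definition Rreg (t : R) (w : Om) : R :=
  - Order.min 0 (inf [set X s w | s in [set s | 0 <= s <= t]]).
Definition Yrefl (t : R) (w : Om) : R := X t w + Rreg t w.

Definition Ta (a : R) (w : Om) : \bar R :=
  ereal_inf [set t%:E | t in [set t | 0 <= t /\ a < Yrefl t w]].

Definition exit_integrand (alpha a : R) (j : 'I_n) (w : Om) : \bar R :=
  match Ta a w with
  | EFin t => if J t w == Some j then (expR (- alpha * Rreg t w))%:E else 0%E
  | _ => 0%E
  end.

End MAP.

(* Main.v *)
(**
On the grid of mesh [h = 2^-m] the Markov additive property gives, one step at a
time, an exact identity for the reflected skeleton stopped above [a].  As the
mesh vanishes it becomes, with [f j = E_(x,i)[exp (- alpha R(T_a)); J(T_a) = j]],
<<
  exp (b x) 1(i = j) + sum_l L_l(exp (b .)) F(b)_lj + A(b)_j = exp (b a) f j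
>>
for all [b >= 0], where [L] is an occupation functional on [[0, a]] and the
boundary term [A] satisfies [A(alpha) = 0] and [0 <= A(b) = O(b)] for
[b >= alpha].  The limit of the occupation functionals is taken along an
ultrafilter on the meshes, which avoids proving that they converge.

The scale matrix yields another functional [w] solving the same system without
the boundary term, up to an error that vanishes as [b] grows.  The difference
[N = L - w] has exponential moments bounded by [C (1 + b)] although it is carried
by [[0, a]]; testing it against powers of [1 - exp (k (y - a))] shows that these
moments are constant in [b], equal to some [u >= 0].  For large [b] the system
forces [u F(b) <= 0] up to a small error; the diagonal of [F] tends to infinity
(no [X_i] is non-increasing) and its off-diagonal entries are bounded, so [u = 0].
The system at [b = alpha] then reads [Z(alpha, x) = E_x Z(alpha, a)], and
[Z(alpha, 0) = I] makes [Z(alpha, a)] invertible.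
*)
Require Import Defs.
From HB Require Import structures.
From mathcomp Require Import all_boot all_order all_algebra.
From mathcomp Require Import all_classical all_reals all_analysis.
From mathcomp Require Import measurable_realfun ring lra.
Import Order.TTheory GRing.Theory Num.Theory.
Import numFieldNormedType.Exports.
Set Implicit Arguments. Unset Strict Implicit. Unset Printing Implicit Defensive.
Local Open Scope classical_set_scope.
Local Open Scope ring_scope.

(** The data are the laws of [(X, J)] at fixed times and its paths: neither the exponents of the
    [X_i] nor the laws of the jumps [U_ij] are given, and the Markov property is stated at
    deterministic times only. This is why the argument runs on grids, and why every property of [F]
    has to be extracted from the process. In particular the bound on the off-diagonal entries is
    itself a consequence of the limiting exit identity, used once with [alpha = 0] and start at
    level 0: it shows that these entries grow more slowly than [exp (b a)] for each [a > 0], which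
    forces [F b i j <= F 0 i j]. The scale matrix is known through its transform for large exponents
    only, whereas the formula is wanted at every [alpha >= 0], where [F alpha] may be singular. So
    the system cannot be inverted at [alpha]; it is inverted at large [b], and the constancy of the
    moments of [N] carries the result down to [alpha]. Two further obstacles are the overshoot of
    the skeleton, which is unbounded and calls for uniform integrability, and the integrand at
    [T_a], whose measurability is not part of the data. *)

(** * First-order expansion of the matrix exponential *)

Section MatrixExponential.
Context {R : realType} {n : nat}.
Implicit Type A : 'M[R]_n.

Let absum A : R := \sum_i \sum_j `|A i j|.

Let absum_ge0 A : 0 <= absum A.
Proof. by rewrite sumr_ge0 // => i _; rewrite sumr_ge0. Qed.

Lemma mxpowZ (h : R) A k : mxpow (h *: A) k = h ^+ k *: mxpow A k.
Proof.
elim: k => [|k IH]; first by rewrite expr0 scale1r.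
by rewrite /mxpow !iterS -/(mxpow _ k) -/(mxpow A k) IH -scalemxAr -scalemxAl
  scalerA -exprSr.
Qed.

Let norm_mxpow_le A k i j : `|mxpow A k i j| <= absum A ^+ k.
Proof.
elim: k i j => [|k IH] i j.
  rewrite /mxpow /= mxE expr0; case: eqP => _; by rewrite ?normr1 ?normr0.
rewrite /mxpow iterS -/(mxpow _ k) mxE exprS.
apply: (le_trans (ler_norm_sum _ _ _)).
apply: (@le_trans _ _ (\sum_l `|A i l| * absum A ^+ k)).
  by apply: ler_sum => l _; rewrite normrM ler_wpM2l.
rewrite -mulr_suml ler_wpM2r ?exprn_ge0 //.
rewrite /absum [leRHS](bigD1 i) //= lerDl sumr_ge0 // => l _; exact: sumr_ge0.
Qed.

(** For [h <= 1] the term of degree [l + 2] of the series is at most [h ^+ 2 * c ^+ 2] times the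
    term of degree [l] of [expR c], where [c] is the sum of the absolute values of the entries. *)
Lemma expmx_first_order A : exists C : R, 0 <= C /\
  forall h, 0 <= h <= 1 -> forall i j,
    `|expmx (h *: A) i j - ((i == j)%:R + h * A i j)| <= C * h ^+ 2.
Proof.
set c := absum A; have c0 : 0 <= c by exact: absum_ge0.
exists (c ^+ 2 * expR c); split; first by rewrite mulr_ge0 ?sqr_ge0 ?expR_ge0.
move=> h /andP[h0 h1] i j; rewrite mxE.
set u := (fun k => _).
have uE k : u k = h ^+ k * mxpow A k i j / k`!%:R by rewrite /u mxpowZ mxE.
have ub k : `|u k| <= h ^+ k * exp_coeff c k.
  rewrite uE normrM normfV normr_nat normrM normrX (ger0_norm h0) /exp_coeff /=.
  by rewrite -mulrA ler_wpM2l ?exprn_ge0 // ler_wpM2r ?invr_ge0.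
have ub1 k : `|u k| <= exp_coeff c k.
  apply: (le_trans (ub k)); rewrite ler_piMl ?exp_coeff_ge0 //.
  by rewrite exprn_ile1.
have cu : cvgn (series u).
  apply: normed_cvg; apply: (series_le_cvg _ _ ub1) => //.
    by move=> k; exact: exp_coeff_ge0.
  exact: is_cvg_series_exp_coeff.
have u01 : (i == j)%:R + h * A i j = series u 2.
  rewrite /series /= !big_nat_recr //= big_geq // add0r !uE expr0 mul1r /mxpow /=.
  by rewrite mulmx1 !mxE divr1 expr1 divr1.
rewrite u01.
have tail k : `|series u (k + 2) - series u 2| <= c ^+ 2 * expR c * h ^+ 2.
  have -> : series u (k + 2) - series u 2 = \sum_(2 <= l < k + 2) u l.
    by rewrite sub_series_geq // leq_addl.
  apply: (le_trans (ler_norm_sum _ _ _)).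
  rewrite -{1}[2%N]add0n big_addn addnK.
  apply: (@le_trans _ _ (\sum_(0 <= l < k) h ^+ 2 * c ^+ 2 * exp_coeff c l)).
    apply: ler_sum => l _; apply: (le_trans (ub _)); rewrite -mulrA ler_pM ?exprn_ge0 ?exp_coeff_ge0 //.
      by rewrite exprD ler_piMl ?sqr_ge0 // exprn_ile1.
    rewrite /exp_coeff /= exprD [c ^+ l * _]mulrC -mulrA ler_wpM2l ?sqr_ge0 //.
    rewrite ler_wpM2l ?exprn_ge0 // lef_pV2 ?posrE ?ltr0n ?fact_gt0 // ler_nat.
    by rewrite leq_fact // leq_addr.
  rewrite -mulr_sumr [leRHS]mulrC -[leLHS]mulrA ler_wpM2l ?sqr_ge0 // ler_wpM2l ?mulr_ge0 ?sqr_ge0 //.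
  rewrite /expR; apply: nondecreasing_cvgn_le; last exact: is_cvg_series_exp_coeff.
  by apply: nondecreasing_series => ? _ _; exact: exp_coeff_ge0.
have cvgt : (fun k => `|series u (k + 2) - series u 2|) @ \oo -->
    `|limn (series u) - series u 2|.
  apply: cvg_norm; apply: cvgB; last exact: cvg_cst.
  by rewrite (cvg_shiftn 2 (series u)).
by apply: (cvgr_to_le cvgt); apply: nearW.
Qed.

End MatrixExponential.

(** * Functionals on [[0, a]] with slowly growing exponential moments *)

(** With [m = min (1, c / 2)] one has [m (1 + k) <= 1 + k c / 2 <= exp (k c / 2)]. Squaring bounds
    the sequence by [m ^- 2 / (1 + k)]. *)
Lemma cvg_mul_expRN (R : realType) (c : R) : 0 < c ->
  (fun k : nat => (1 + k%:R) * expR (- (k%:R * c))) @ \oo --> 0.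
Proof.
move=> c0; set m := Num.min 1 (c / 2).
have m0 : 0 < m by rewrite lt_min ltr01 divr_gt0.
have m1 : m <= 1 by rewrite ge_min lexx.
have mc : m <= c / 2 by rewrite ge_min lexx orbT.
have inv0 : (fun k : nat => m ^- 2 * harmonic k) @ \oo --> 0.
  by rewrite -(mulr0 (m ^- 2)); apply: cvgMr; exact: cvg_harmonic.
apply: (squeeze_cvgr _ (cvg_cst 0) inv0); apply: nearW => k.
rewrite mulr_ge0 ?expR_ge0 ?addr_ge0 //=.
have k1 : 0 < 1 + k%:R :> R by rewrite ltr_pwDl.
have lb : m * (1 + k%:R) <= expR (k%:R * c / 2).
  apply: le_trans (expR_ge1Dx _).
  by rewrite mulrDr mulr1 lerD // mulrC -mulrA ler_wpM2l.
have lb2 : m ^+ 2 * (1 + k%:R) ^+ 2 <= expR (k%:R * c).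
  rewrite [k%:R * c]splitr expRD -exprMn expr2.
  by rewrite ler_pM // mulr_ge0 ?ltW.
rewrite /harmonic /= expRN -natr1 [k%:R + 1]addrC -invfM ler_pdivrMr ?expR_gt0 //.
rewrite mulrC ler_pdivlMr ?mulr_gt0 ?exprn_gt0 //.
by apply: le_trans lb2; rewrite mulrC -mulrA expr2.
Qed.

Section ExponentialMoments.
Context {R : realType} (a C : R) (N : (R -> R) -> R).
Hypotheses (a_gt0 : 0 < a) (C_ge0 : 0 <= C).
Hypothesis N_lin : forall (c : R) (f g : R -> R), continuous f -> continuous g ->
  N (fun y : R => c * f y + g y) = c * N f + N g.
Hypothesis N_growth : forall b : R, 0 <= b ->
  `|N (fun y : R => expR (b * y))| <= C * (1 + b).

(** A power of [cutoff k] is a polynomial in [exp (k y)]; multiplied by [exp (b y)] it is a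
    combination of exponentials with nonnegative exponents, on which [N] is controlled by
    [N_growth]. *)
Let cutoff (k : nat) (y : R) : R := 1 - expR (k%:R * (y - a)).

Lemma continuous_expRM (b : R) : continuous (fun y : R => expR (b * y)).
Proof.
move=> y; apply: (@continuous_comp _ _ _ ( *%R b)); last exact: continuous_expR.
exact: mulrl_continuous.
Qed.

Lemma continuous_cutoffX k M : continuous (fun y : R => cutoff k y ^+ M).
Proof.
move=> y; apply: (@continuous_comp _ _ _ (cutoff k) (fun z => z ^+ M));
  last exact: exprn_continuous.
apply: cvgB; first exact: cvg_cst.
apply: (@continuous_comp _ _ _ (fun y => k%:R * (y - a)));
  last exact: continuous_expR.
by apply: cvgMr; apply: cvgB; [exact: cvg_id|exact: cvg_cst].
Qed.

Let cont_expX b k M : continuous (fun y : R => expR (b * y) * cutoff k y ^+ M).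
Proof.
by move=> y; apply: cvgM; [exact: continuous_expRM|exact: continuous_cutoffX].
Qed.

(** The cost in [N] of one cutoff factor: the new term has coefficient [exp (- k a)] and exponent
    [b + k], and [1 + b + k <= (1 + b) (1 + k)]. *)
Let x k : R := 1 + (1 + k%:R) * expR (- (k%:R * a)).

Let x_ge1 k : 1 <= x k.
Proof. by rewrite lerDl mulr_ge0 ?expR_ge0 ?addr_ge0. Qed.

Let N_cutoffS b k M :
  N (fun y : R => expR (b * y) * cutoff k y ^+ M.+1) =
  N (fun y : R => expR (b * y) * cutoff k y ^+ M) -
  expR (- (k%:R * a)) * N (fun y : R => expR ((b + k%:R) * y) * cutoff k y ^+ M).
Proof.
rewrite -mulNr addrC -N_lin //; congr N; apply/funext => y.
rewrite exprS /cutoff [(b + _) * y]mulrDl mulrBr !expRD; ring.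
Qed.

Let N_cutoff_le k M b : 0 <= b ->
  `|N (fun y : R => expR (b * y) * cutoff k y ^+ M)| <= C * (1 + b) * x k ^+ M /\
  `|N (fun y : R => expR (b * y) * cutoff k y ^+ M) - N (fun y : R => expR (b * y))|
    <= C * (1 + b) * (x k ^+ M - 1).
Proof.
elim: M b => [|M IH] b b0.
  have -> : (fun y => expR (b * y) * cutoff k y ^+ 0) = (fun y => expR (b * y)).
    by apply/funext => y; rewrite expr0 mulr1.
  by rewrite subrr normr0 expr0 subrr mulr0 mulr1 N_growth.
have [h1 h2] := IH b b0; have [h3 _] := IH (b + k%:R) (addr_ge0 b0 (ler0n _ _)).
rewrite N_cutoffS.
set u := N _ in h1 h2 *; set v := N _ in h3 *; set N0 := N _ in h2 *.
have ev : `|expR (- (k%:R * a)) * v| <= C * (1 + b) * ((x k - 1) * x k ^+ M).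
  rewrite normrM ger0_norm ?expR_ge0 // /x [1 + _ - 1]addrC addKr.
  apply: (@le_trans _ _ (expR (- (k%:R * a)) * (C * (1 + (b + k%:R)) * x k ^+ M))).
    by rewrite ler_wpM2l ?expR_ge0.
  rewrite -/(x k); set e := expR _; set X := x k ^+ M.
  have -> : C * (1 + b) * ((1 + k%:R) * e * X) =
            e * (C * ((1 + b) * (1 + k%:R)) * X) by ring.
  rewrite ler_wpM2l ?expR_ge0 // ler_wpM2r ?exprn_ge0 ?(le_trans ler01) //.
  rewrite ler_wpM2l // -subr_ge0 (_ : _ - _ = b * k%:R) ?mulr_ge0 //; ring.
split.
  apply: (le_trans (ler_normB _ _)); apply: (le_trans (lerD h1 ev)).
  rewrite exprS le_eqVlt; apply/orP; left; apply/eqP; ring.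
rewrite addrAC; apply: (le_trans (ler_normB _ _)); apply: (le_trans (lerD h2 ev)).
rewrite -mulrDr exprS; rewrite le_eqVlt; apply/orP; left; apply/eqP; ring.
Qed.

(* The exponent [M k c] turns [cutoff k y ^+ M] into an approximation of
   [exp (- exp (k (y - c)))], hence of the indicator of [y < c]. *)
Let M (k : nat) (c : R) : nat := (Num.truncn (expR (k%:R * (a - c)))).+1.

(** Controls two errors at once: [M (x k - 1)], the accumulated cost of the cutoff in [N], and the
    size of the cutoff on [[2 c, a]]. The factor 2 absorbs the rounding in [M]. *)
Let r (k : nat) (c : R) : R := 2 * ((1 + k%:R) * expR (- (k%:R * c))).

Lemma cvg_cutoff_rate c : 0 < c -> r ^~ c @ \oo --> 0.
Proof.
by move=> c0; rewrite -(mulr0 2); apply: cvgMr; exact: cvg_mul_expRN.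
Qed.

Let N_cutoff_cvg k c b : 0 <= b -> c <= a ->
  `|N (fun y : R => expR (b * y) * cutoff k y ^+ M k c) - N (fun y : R => expR (b * y))|
    <= C * (1 + b) * (expR (r k c) - 1).
Proof.
move=> b0 ca; apply: (le_trans (N_cutoff_le _ _ b0).2).
rewrite ler_wpM2l ?mulr_ge0 ?addr_ge0 // lerD2r.
apply: (@le_trans _ _ (expR (x k - 1) ^+ M k c)).
  rewrite lerXn2r ?nnegrE ?expR_ge0 ?(le_trans ler01) //.
  by apply: le_trans (expR_ge1Dx _); rewrite addrC subrK.
rewrite -expRM_natl ler_expR /x [1 + _ - 1]addrC addKr /r.
rewrite mulrCA [2 * _]mulrCA ler_wpM2l ?addr_ge0 //.
have Mle : (M k c)%:R <= 2 * expR (k%:R * (a - c)).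
  rewrite /M -natr1 mulr2n mulrDl mul1r lerD //.
    by rewrite truncn_le // expR_ge0.
  by rewrite -expR0 ler_expR mulr_ge0 // subr_ge0.
apply: (le_trans (ler_wpM2r (expR_ge0 _) Mle)).
rewrite -mulrA -expRD (_ : _ + _ = - (k%:R * c)) //; ring.
Qed.

Let cutoff_bounds k c y : y <= a -> 0 <= cutoff k y ^+ M k c <= 1.
Proof.
move=> ya; rewrite /cutoff.
have h0 : 0 <= 1 - expR (k%:R * (y - a)).
  by rewrite subr_ge0 -expR0 ler_expR mulr_ge0_le0 // subr_le0.
by rewrite exprn_ge0 //= exprn_ile1 // gerBl expR_ge0.
Qed.

(** Since [1 - z <= exp (- z)] and [M >= exp (k (a - c))], the power is at most [exp (- exp (k c))]
    for [y >= 2 c], which is far below [exp (- k c)]. *)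
Let cutoff_small k c y : 2 * c <= y -> y <= a -> cutoff k y ^+ M k c <= r k c.
Proof.
move=> cy ya; rewrite /cutoff.
apply: (@le_trans _ _ (expR (- expR (k%:R * (y - a))) ^+ M k c)).
  rewrite lerXn2r ?nnegrE ?expR_ge0 //.
    by rewrite subr_ge0 -expR0 ler_expR mulr_ge0_le0 // subr_le0.
  exact: expR_ge1Dx.
rewrite -expRM_natl.
apply: (@le_trans _ _ (expR (- expR (k%:R * c)))).
  rewrite ler_expR mulrN lerN2.
  apply: (@le_trans _ _ (expR (k%:R * (a - c)) * expR (k%:R * (y - a)))).
    rewrite -expRD ler_expR -mulrDr ler_wpM2l //; lra.
  by rewrite ler_wpM2r ?expR_ge0 // ltW // /M truncnS_gt.
rewrite /r expRN [X in _ <= 2 * (_ * X)]expRN.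
have e0 := expR_gt0 (k%:R * c).
have e1 := expR_ge1Dx (expR (k%:R * c)).
apply: (@le_trans _ _ (expR (k%:R * c))^-1).
  by rewrite lef_pV2 ?posrE ?expR_gt0 //; apply: le_trans e1; rewrite lerDr.
rewrite mulrA ler_peMl ?invr_ge0 ?(ltW e0) //.
by rewrite mulrDr mulr1 -addrA ler_wpDr // addr_ge0.
Qed.

Variables (B1 B2 : R) (L w : (R -> R) -> R).
Hypothesis B1_ge0 : 0 <= B1.
Hypothesis B2_ge0 : 0 <= B2.
Hypothesis NE : forall f : R -> R, continuous f -> N f = L f - w f.
Hypothesis L_le : forall (f : R -> R) s, continuous f ->
  (forall y, 0 <= y <= a -> `|f y| <= s) -> `|L f| <= B1 * s.
Hypothesis L_ge0 : forall f : R -> R, continuous f ->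
  (forall y, 0 <= y <= a -> 0 <= f y) -> 0 <= L f.
(** The term [c * s] expresses that the measure behind [w] has a bounded density, so that it gives
    little mass to a short interval at the origin. *)
Hypothesis w_le : forall (f : R -> R) c s s', continuous f -> 0 <= c <= a ->
  (forall y, 0 <= y <= c -> `|f y| <= s) ->
  (forall y, c <= y <= a -> `|f y| <= s') -> `|w f| <= B2 * (c * s + s').

(* The growth hypothesis is what excludes mass of the signed measure behind [N]
   away from the origin. *)
Lemma exponential_moment_constant b : 0 <= b ->
  N (fun y : R => expR (b * y)) = N (fun=> 1).
Proof.
move=> b0; apply/eqP; rewrite -subr_eq0 -normr_le0.
set K := B1 + B2 * (a + 1).
have K0 : 0 <= K by rewrite addr_ge0 ?mulr_ge0 ?addr_ge0 // ltW.
set e0 := (fun y : R => expR (0 * y)).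
have -> : (fun=> 1) = e0 by apply/funext => y; rewrite /e0 mul0r expR0.
(* After the cutoff only [y <= 2 c] matters, and there [exp (b y)] differs from 1 by at most
   [exp (2 b c) - 1]. Letting [k] grow removes the error [r]; letting [c] tend to 0 removes the
   rest. *)
have key c : 0 < c <= a / 2 ->
    `|N (fun y : R => expR (b * y)) - N e0| <= K * (expR (b * (2 * c)) - 1).
  move=> /andP[c0 ca]; have ca' : c <= a by lra.
  have fin k : `|N (fun y : R => expR (b * y)) - N e0| <=
      C * (1 + b) * (expR (r k c) - 1) + C * (1 + 0) * (expR (r k c) - 1) +
      K * (expR (b * (2 * c)) - 1 + expR (b * a) * r k c).
    have h1 := N_cutoff_cvg k b0 ca'; have h2 := N_cutoff_cvg k (lexx 0) ca'.
    rewrite -/e0 in h2.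
    set s := expR (b * (2 * c)) - 1 + expR (b * a) * r k c.
    pose g y := -1 * (expR (0 * y) * cutoff k y ^+ M k c) +
                expR (b * y) * cutoff k y ^+ M k c.
    have cg : continuous g.
      move=> y; apply: cvgD; last exact: cont_expX.
      by apply: cvgMr; exact: cont_expX.
    have r0 : 0 <= r k c by rewrite /r !mulr_ge0 ?expR_ge0 ?addr_ge0.
    have gs y : 0 <= y <= a -> `|g y| <= s.
      move=> /andP[y0 ya]; rewrite /g mul0r expR0 mul1r mulN1r.
      have /andP[q0 q1] := cutoff_bounds k c ya.
      have eb : 1 <= expR (b * y) by rewrite -expR0 ler_expR mulr_ge0.
      rewrite -[- _ + _]/(- _ + _) addrC -[X in _ - X]mul1r -mulrBl normrM.
      rewrite !ger0_norm ?subr_ge0 //.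
      have [yc|yc] := leP y (2 * c).
        apply: (@le_trans _ _ (expR (b * y) - 1)).
          by rewrite ler_piMr // subr_ge0.
        rewrite /s -[leLHS]addr0 lerD ?mulr_ge0 ?expR_ge0 //.
        by rewrite lerD2r ler_expR ler_wpM2l.
      have q2 := cutoff_small k (ltW yc) ya.
      rewrite /s -[leLHS]add0r lerD //.
        by rewrite subr_ge0 -expR0 ler_expR !mulr_ge0 // ltW.
      rewrite ler_pM ?subr_ge0 //.
      by rewrite lerBlDr ler_wpDr // ler_expR ler_wpM2l.
    have Ng : `|N g| <= K * s.
      rewrite NE // /K; apply: (le_trans (ler_normB _ _)).
      rewrite mulrDl lerD ?L_le // -mulrA mulrDl mul1r; apply: w_le => //.
      by rewrite (ltW a_gt0) lexx.
      by move=> y /andP[y1 y2]; apply: gs; rewrite y2 (le_trans _ y1) // ltW.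
    have NgE : N g = N (fun y : R => expR (b * y) * cutoff k y ^+ M k c) -
                     N (fun y : R => expR (0 * y) * cutoff k y ^+ M k c).
      by rewrite /g N_lin // addrC mulN1r.
    move: h1 h2 Ng; rewrite NgE.
    set u := N _; set v := N _; set u0 := N _; set v0 := N _.
    move=> h1 h2 Ng.
    have -> : v - v0 = - (u - v) + (u0 - v0) + (u - u0) by ring.
    apply: (le_trans (ler_normD _ _)); apply: lerD => //.
    by apply: (le_trans (ler_normD _ _)); rewrite normrN; apply: lerD.
  have rc := cvg_cutoff_rate c0.
  have er : (fun k => expR (r k c) - 1) @ \oo --> 0.
    rewrite -(subrr 1) -[X in X - 1]expR0; apply: cvgB; last exact: cvg_cst.
    by apply: continuous_cvg => //; exact: continuous_expR.
  suff lm : (fun k : nat => C * (1 + b) * (expR (r k c) - 1) +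
      C * (1 + 0) * (expR (r k c) - 1) +
      K * (expR (b * (2 * c)) - 1 + expR (b * a) * r k c)) @ \oo -->
      K * (expR (b * (2 * c)) - 1).
    by apply: (cvgr_to_ge lm); apply: nearW.
  rewrite -[X in _ --> X]add0r -[X in _ --> X + _]addr0.
  apply: cvgD; first apply: cvgD.
  - by rewrite -[X in _ --> X](mulr0 (C * (1 + b))); apply: cvgMr.
  - by rewrite -[X in _ --> X](mulr0 (C * (1 + 0))); apply: cvgMr.
  apply: cvgMr; rewrite -[X in _ --> X]addr0; apply: cvgD; first exact: cvg_cst.
  by rewrite -(mulr0 (expR (b * a))); apply: cvgMr.
have lim0 : (fun c => K * (expR (b * (2 * c)) - 1)) @ 0^'+ --> 0.
  apply: cvg_at_right_filter.
  rewrite -[X in _ --> X](_ : K * (expR (b * (2 * 0)) - 1) = 0); last first.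
    by rewrite !mulr0 expR0 subrr mulr0.
  apply: cvgMr; apply: cvgB; last exact: cvg_cst.
  apply: continuous_cvg; first exact: continuous_expR.
  by apply: cvgMr; apply: cvgMr; exact: cvg_id.
apply: (ler_cvg_to (cvg_cst _) lim0); near=> c; apply: key.
apply/andP; split; near: c; first exact: nbhs_right_gt.
by apply: nbhs_right_le; rewrite divr_gt0.
Unshelve. all: by end_near.
Qed.

(** The cutoffs isolate the mass of [N] at the origin. There [w] contributes at most [B2 (2 c)] in
    the limit, so what remains comes from the nonnegative functional [L]. *)
Lemma exponential_moment_ge0 : 0 <= N (fun=> 1).
Proof.
set e0 := (fun y : R => expR (0 * y)).
have -> : (fun=> 1) = e0 by apply/funext => y; rewrite /e0 mul0r expR0.
have key c : 0 < c <= a / 2 -> - (B2 * (2 * c)) <= N e0.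
  move=> /andP[c0 ca]; have ca' : c <= a by lra.
  have fin k : - (B2 * (2 * c + r k c)) - C * (1 + 0) * (expR (r k c) - 1) <= N e0.
    have h2 := N_cutoff_cvg k (lexx 0) ca'; rewrite -/e0 in h2.
    set g := (fun y => _) in h2.
    have cg : continuous g by exact: cont_expX.
    have gb y : 0 <= y <= a -> 0 <= g y <= 1.
      by move=> /andP[y0 ya]; rewrite /g mul0r expR0 mul1r; exact: cutoff_bounds.
    have Lg : 0 <= L g by apply: L_ge0 => // y /gb /andP[].
    have wg : `|w g| <= B2 * (2 * c * 1 + r k c).
      apply: w_le => //; first by apply/andP; split; lra.
        move=> y /andP[y0 yc]; have /andP[g0 g1] : 0 <= g y <= 1.
          by apply: gb; rewrite y0 (le_trans yc) //; lra.
        by rewrite ger0_norm.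
      move=> y /andP[yc ya]; have /andP[g0 g1] : 0 <= g y <= 1.
        by apply: gb; rewrite ya andbT (le_trans _ yc) //; lra.
      by rewrite ger0_norm // /g mul0r expR0 mul1r; exact: cutoff_small.
    have := NE cg; move: h2; rewrite ler_norml => /andP[_ h2] Eg.
    have wg' : w g <= B2 * (2 * c + r k c).
      by rewrite -[2 * c]mulr1 (le_trans _ wg) // ler_norm.
    lra.
  have rc := cvg_cutoff_rate c0.
  have er : (fun k => expR (r k c) - 1) @ \oo --> 0.
    rewrite -(subrr 1) -[X in X - 1]expR0; apply: cvgB; last exact: cvg_cst.
    by apply: continuous_cvg => //; exact: continuous_expR.
  suff lm : (fun k : nat => - (B2 * (2 * c + r k c)) -
      C * (1 + 0) * (expR (r k c) - 1)) @ \oo --> - (B2 * (2 * c)).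
    by apply: (cvgr_to_le lm); apply: nearW.
  rewrite -[X in _ --> X]subr0; apply: cvgB.
    apply: cvgN; apply: cvgMr; rewrite -[X in _ --> X]addr0.
    by apply: cvgD => //; exact: cvg_cst.
  by rewrite -[X in _ --> X](mulr0 (C * (1 + 0))); apply: cvgMr.
have lim0 : (fun c => - (B2 * (2 * c))) @ 0^'+ --> 0.
  apply: cvg_at_right_filter.
  rewrite -[X in _ --> X](_ : - (B2 * (2 * 0)) = 0); last by rewrite !mulr0 oppr0.
  by apply: cvgN; apply: cvgMr; apply: cvgMr; exact: cvg_id.
apply: (ler_cvg_to lim0 (cvg_cst _)); near=> c; apply: key.
apply/andP; split; near: c; first exact: nbhs_right_gt.
by apply: nbhs_right_le; rewrite divr_gt0.
Unshelve. all: by end_near.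
Qed.

End ExponentialMoments.

(** * Convolutions on an interval and tails of Laplace transforms *)

Lemma cvg_sumr (R : realType) (T I : Type) (Fl : set_system T) (r : seq I)
    (f : I -> T -> R) (l : I -> R) : Filter Fl ->
  (forall i, f i @ Fl --> l i) ->
  (fun t => \sum_(i <- r) f i t) @ Fl --> \sum_(i <- r) l i.
Proof.
move=> FF fl; elim: r => [|i r IH].
  rewrite big_nil; under eq_fun do rewrite big_nil; exact: cvg_cst.
by rewrite big_cons; under eq_fun do rewrite big_cons; exact: cvgD.
Qed.

Lemma norm_Rintegral_le (d : measure_display) (T : measurableType d) (R : realType)
    (mu : {measure set T -> \bar R}) (D : set T) (h : T -> R) (M : R) :
  measurable D -> (mu D < +oo)%E -> mu.-integrable D (EFin \o h) ->
  (forall y, D y -> `|h y| <= M) ->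
  `|\int[mu]_(y in D) h y| <= M * fine (mu D).
Proof.
move=> mD finD ih hM; apply: (le_trans (le_normr_Rintegral mD ih)).
rewrite -Rintegral_cst //; apply: le_Rintegral => //.
  exact: (integrable_norm ih).
apply/integrableP; split; first exact: measurable_cst.
by rewrite integral_cst // lte_mul_pinfty.
Qed.

Lemma norm_Rintegral_itv_le (R : realType) (p q : bool) (u v M : R) (h : R -> R) :
  u <= v -> 0 <= M ->
  let D := [set` Interval (BSide p u) (BSide q v)] in
  (@lebesgue_measure R).-integrable D (EFin \o h) ->
  (forall y, u <= y <= v -> `|h y| <= M) ->
  `|\int[@lebesgue_measure R]_(y in D) h y| <= M * (v - u).
Proof.
move=> uv M0 D ih hM; have mD : measurable D by exact: measurable_itv.
have DE : lebesgue_measure D = (if u < v then v - u else 0)%:E.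
  by rewrite /D lebesgue_measure_itv /= lte_fin; case: ifP.
apply: (@le_trans _ _ (M * fine (lebesgue_measure D))).
  apply: norm_Rintegral_le => //; first by apply: le_lt_trans (ltry (if u < v then v - u else 0)); rewrite -DE.
  move=> y; rewrite /D /= in_itv /= => /andP[h1 h2]; apply: hM.
  by rewrite (lteifW h1) (lteifW h2).
by rewrite ler_wpM2l // DE /=; case: ifP => // _; rewrite subr_ge0.
Qed.

Lemma integrable_mull (d : measure_display) (T : measurableType d) (R : realType)
    (mu : {measure set T -> \bar R}) (D : set T) (c : R) (h : T -> R) :
  measurable D -> mu.-integrable D (EFin \o h) ->
  mu.-integrable D (EFin \o (fun y => c * h y)).
Proof.
by move=> mD ih; apply: eq_integrable (integrableZl mD c ih).
Qed.

Section Convolution.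
Context {R : realType} (g : R -> R).
Hypothesis g_cont : {within `[0, +oo[, continuous g}.
Notation mu := (@lebesgue_measure R).

Definition conv_itv (x : R) (phi : R -> R) : R :=
  \int[mu]_(y in `[0, x]) (phi (x - y) * g y).

Lemma integrable_conv_itv x (phi : R -> R) : continuous phi ->
  mu.-integrable `[0, x] (EFin \o (fun y => phi (x - y) * g y)).
Proof.
move=> cphi; apply: continuous_compact_integrable; first exact: segment_compact.
move=> y; apply: cvgM; last first.
  apply: (@continuous_subspaceW _ _ `[0, x] `[0, +oo[) => //.
  by move=> z /=; rewrite !in_itv /= andbT => /andP[].
apply: continuous_subspaceT => z.
apply: (@continuous_comp _ _ _ (fun y => x - y) phi); last exact: cphi.
by apply: cvgB; [exact: cvg_cst|exact: cvg_id].
Qed.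

Lemma conv_itv_lin x (c : R) (phi psi : R -> R) :
  continuous phi -> continuous psi ->
  conv_itv x (fun y => c * phi y + psi y) = c * conv_itv x phi + conv_itv x psi.
Proof.
move=> cphi cpsi; rewrite /conv_itv -RintegralZl //; last exact: integrable_conv_itv.
rewrite -RintegralD //; last exact: integrable_conv_itv.
  by apply: eq_Rintegral => y _; ring.
by apply: integrable_mull => //; exact: integrable_conv_itv.
Qed.

Lemma bounded_on_itv (a : R) : 0 <= a ->
  exists2 G : R, 0 <= G & forall y, 0 <= y <= a -> `|g y| <= G.
Proof.
move=> a0; have cg : {within `[0, a], continuous g}.
  apply: (@continuous_subspaceW _ _ `[0, a] `[0, +oo[) => //.
  by move=> z /=; rewrite !in_itv /= andbT => /andP[].
have /compact_bounded [M [Mr HM]] :=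
  continuous_compact cg (@segment_compact R 0 a).
exists (`|M| + 1); first by rewrite addr_ge0.
move=> y ya; apply: HM; last by exists y => //=; rewrite in_itv.
by rewrite (le_lt_trans (ler_norm _)) // ltrDl.
Qed.

(** This is the bounded-density estimate required of [w]: [g] is bounded on [[0, a]], and
    [x - y <= c] holds only on an interval of length at most [c]. *)
Lemma conv_itv_le (a : R) : 0 <= a -> exists2 B, 0 <= B &
  forall (x : R) (phi : R -> R) (c s s' : R), 0 <= x <= a -> continuous phi -> 0 <= c <= a ->
    (forall y, 0 <= y <= c -> `|phi y| <= s) ->
    (forall y, c <= y <= a -> `|phi y| <= s') ->
    `|conv_itv x phi| <= B * (c * s + s').
Proof.
move=> a0; have [G G0 HG] := bounded_on_itv a0.
exists (G * (1 + a)); first by rewrite mulr_ge0 ?addr_ge0.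
move=> x phi c s s' /andP[x0 xa] cphi /andP[c0 ca] Hs Hs'.
have s0 : 0 <= s by apply: le_trans (Hs 0 _); rewrite // lexx.
have s'0 : 0 <= s' by apply: le_trans (Hs' a _); rewrite // lexx andbT.
have ih := integrable_conv_itv x cphi.
have gen : c * s * G + x * (s' * G) <= G * (1 + a) * (c * s + s').
  have p1 : 0 <= G * (a * (c * s)) by rewrite !mulr_ge0.
  have p2 : 0 <= G * s' by rewrite mulr_ge0.
  have p3 : x * (s' * G) <= a * (s' * G) by rewrite ler_wpM2r // mulr_ge0.
  lra.
apply: le_trans gen.
have [xc|cx] := leP x c.
  apply: (@le_trans _ _ (s * G * (x - 0))).
    apply: norm_Rintegral_itv_le => //; first by rewrite mulr_ge0.
    move=> y /andP[y0 yx]; rewrite normrM ler_pM // ?HG ?y0 ?(le_trans yx) //.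
    by rewrite Hs //; apply/andP; split; lra.
  rewrite subr0 -[leLHS]addr0 lerD ?mulr_ge0 // mulrC mulrA.
  by rewrite ler_wpM2r // ler_wpM2r.
have ih1 : mu.-integrable `[0, x - c] (EFin \o (fun y => phi (x - y) * g y)).
  apply: integrableS ih => // y /=; rewrite !in_itv /= => /andP[-> yx]; lra.
have ih2 : mu.-integrable `]x - c, x] (EFin \o (fun y => phi (x - y) * g y)).
  apply: integrableS ih => // y /=; rewrite !in_itv /= => /andP[yc ->].
  by rewrite andbT; lra.
have xc0 : 0 <= x - c by lra.
have xcx : x - c <= x by lra.
have := Rintegral_itvB ih (x := x - c).
rewrite !bnd_simp => /(_ xc0 xcx)/eqP; rewrite subr_eq => /eqP.
rewrite /conv_itv => ->.
apply: (le_trans (ler_normD _ _)); apply: lerD.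
  have -> : c * s * G = s * G * (x - (x - c)) by ring.
  apply: norm_Rintegral_itv_le => //; first by rewrite mulr_ge0.
  move=> y /andP[y0 yx]; rewrite normrM ler_pM //.
    by rewrite Hs //; apply/andP; split; lra.
  by rewrite HG //; apply/andP; split; lra.
apply: (@le_trans _ _ (s' * G * (x - c - 0))).
  apply: norm_Rintegral_itv_le => //; first by rewrite mulr_ge0.
  move=> y /andP[y0 yx]; rewrite normrM ler_pM //.
    by rewrite Hs' //; apply/andP; split; lra.
  by rewrite HG //; apply/andP; split; lra.
by rewrite mulrC ler_wpM2r ?mulr_ge0 //; lra.
Qed.

Lemma conv_itv_exp x b :
  conv_itv x (fun y => expR (b * y)) =
  expR (b * x) * \int[mu]_(y in `[0, x]) (expR (- b * y) * g y).
Proof.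
rewrite /conv_itv -RintegralZl //.
  by apply: eq_Rintegral => y _; rewrite mulrA -expRD mulrBr mulNr.
apply: eq_integrable (integrable_mull (expR (- (b * x))) _
  (integrable_conv_itv x (@continuous_expRM R b))) => // y _ /=.
by congr EFin; rewrite mulrA -expRD; congr (expR _ * _); ring.
Qed.

Variable b1 : R.
Hypothesis g_int : mu.-integrable `[0, +oo[ (EFin \o (fun y => expR (- b1 * y) * g y)).

(** Equal to the integral of [exp (- b (y - x)) g y] over [y > x], with a decaying exponential;
    hence bounded in [b] and vanishing as [b] grows. *)
Definition laplace_tail (x b : R) : R :=
  expR (b * x) * \int[mu]_(y in `]x, +oo[) (expR (- b * y) * g y).

Let g_meas : measurable_fun (`[0, +oo[%classic : set R) (g : R -> R).
Proof. exact: subspace_continuous_measurable_fun. Qed.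

Lemma integrable_laplace b : b1 <= b ->
  mu.-integrable `[0, +oo[ (EFin \o (fun y => expR (- b * y) * g y)).
Proof.
move=> b1b; apply: (le_integrable _ _ _ g_int) => //.
  apply/measurable_EFinP; apply: measurable_funM => //.
  apply: measurable_funTS; apply: continuous_measurable_fun.
  exact: continuous_expRM.
move=> y /=; rewrite in_itv /= andbT => y0.
rewrite lee_fin !normrM ler_wpM2r // !ger0_norm ?expR_ge0 // ler_expR.
by rewrite ler_wpM2r // lerN2.
Qed.

Lemma laplace_split x b : 0 <= x -> b1 <= b ->
  expR (b * x) * \int[mu]_(y in `[0, +oo[) (expR (- b * y) * g y) =
  conv_itv x (fun y => expR (b * y)) + laplace_tail x b.
Proof.
move=> x0 b1b; rewrite conv_itv_exp /laplace_tail -mulrDr; congr (_ * _).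
have := Rintegral_itvB (integrable_laplace b1b) (x := x).
rewrite !bnd_simp => /(_ x0 isT)/eqP; rewrite subr_eq addrC => /eqP; exact.
Qed.

Let int_tail x b : 0 <= x -> b1 <= b ->
  mu.-integrable `]x, +oo[ (EFin \o (fun y => expR (- b * y) * g y)).
Proof.
move=> x0 b1b; apply: integrableS (integrable_laplace b1b) => //.
by move=> y /=; rewrite !in_itv /= !andbT => xy; lra.
Qed.

Let int_tail' x b : 0 <= x -> b1 <= b ->
  mu.-integrable `]x, +oo[ (EFin \o (fun y => expR (- b * (y - x)) * g y)).
Proof.
move=> x0 b1b.
apply: eq_integrable (integrable_mull (expR (b * x)) _ (int_tail x0 b1b)) => // y _ /=.
by congr EFin; rewrite mulrA -expRD; congr (expR _ * _); ring.
Qed.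

Let laplace_tailE x b : 0 <= x -> b1 <= b -> laplace_tail x b =
  \int[mu]_(y in `]x, +oo[) (expR (- b * (y - x)) * g y).
Proof.
move=> x0 b1b; rewrite /laplace_tail -RintegralZl //; last exact: int_tail.
apply: eq_Rintegral => y _; rewrite mulrA -expRD.
by congr (expR _ * _); ring.
Qed.

Lemma laplace_tail_bounded x : 0 <= x -> exists2 M, 0 <= M &
  forall b, b1 <= b -> `|laplace_tail x b| <= M.
Proof.
move=> x0.
exists (\int[mu]_(y in `]x, +oo[) `|expR (- b1 * (y - x)) * g y|).
  exact: Rintegral_ge0.
move=> b b1b; rewrite laplace_tailE //.
apply: (le_trans (le_normr_Rintegral _ (int_tail' x0 b1b))) => //.
apply: le_Rintegral => //; first exact: (integrable_norm (int_tail' x0 b1b)).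
  exact: (integrable_norm (int_tail' x0 (lexx _))).
move=> y /=; rewrite in_itv /= andbT => xy.
rewrite !normrM ler_wpM2r // !ger0_norm ?expR_ge0 // ler_expR.
by rewrite ler_wpM2r ?lerN2 // subr_ge0 ltW.
Qed.

Lemma laplace_tail_cvg0 x : 0 <= x ->
  (fun k : nat => laplace_tail x (b1 + k%:R)) @ \oo --> 0.
Proof.
move=> x0.
have b1k k : b1 <= b1 + k%:R by rewrite lerDl.
have E : (fun k : nat => laplace_tail x (b1 + k%:R)) =
    (fun k : nat => fine (\int[mu]_(y in `]x, +oo[)
        (expR (- (b1 + k%:R) * (y - x)) * g y)%:E)).
  by apply/funext => k; rewrite laplace_tailE.
rewrite E; apply: fine_cvg.
have [|||||_ _] := @dominated_convergence _ _ R mu `]x, +oo[ (measurable_itv _)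
  (fun k y => (expR (- (b1 + k%:R) * (y - x)) * g y)%:E) (cst 0%E)
  (EFin \o (fun y => `|expR (- b1 * (y - x)) * g y|)); last by rewrite integral0.
- by move=> k; case/integrableP: (int_tail' x0 (b1k k)).
- exact: measurable_cst.
- apply: aeW => y /=; rewrite in_itv /= andbT => xy.
  apply: cvg_EFin; first exact: nearW.
  rewrite /comp /=.
  (* The interval is open at [x], so the exponential tends to 0 at every point. The spare factor
     [1 + k] serves to reuse [cvg_mul_expRN]. *)
  have yx : 0 < y - x by rewrite subr_gt0.
  have z : (fun k : nat => expR (- b1 * (y - x)) * g y *
      ((1 + k%:R) * expR (- (k%:R * (y - x))))) @ \oo --> 0.
    rewrite -[X in _ --> X](mulr0 (expR (- b1 * (y - x)) * g y)).
    by apply: cvgMr; exact: cvg_mul_expRN.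
  apply/cvgr0Pnorm_lt => e e0; move/cvgr0Pnorm_lt: z => /(_ e e0).
  apply: filterS => k; apply: le_lt_trans; rewrite opprD mulrDl expRD.
  rewrite !normrM -!mulrA ler_wpM2l // mulrC ler_wpM2l //.
  rewrite [leRHS]mulrC mulNr ler_peMr // ger0_norm ?addr_ge0 // lerDl //.
- exact: (integrable_norm (int_tail' x0 (lexx _))).
- apply: aeW => y k /=; rewrite in_itv /= andbT => xy.
  rewrite lee_fin !normrM ler_wpM2r // !ger0_norm ?expR_ge0 // ler_expR.
  by rewrite ler_wpM2r ?lerN2 // subr_ge0 ltW.
Qed.

End Convolution.

(** * The exit system and its solution by the scale matrix *)

Section ExitIdentity.
Context {R : realType} {n : nat} (F W : R -> 'M[R]_n).
Hypothesis W_scale : is_scale_matrix F W.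
Hypothesis F_offdiag_ge0 : forall (b : R) i j, 0 <= b -> i != j -> 0 <= F b i j.
Hypothesis F_offdiag_bounded : exists C : R,
  forall (b : R) i j, 0 <= b -> i != j -> F b i j <= C.
Hypothesis F_diag_growth : forall j, exists c0 c1 : R, 0 < c1 /\
  forall b : R, 0 <= b -> c0 + c1 * b <= F b j j.

Variables (alpha a x : R) (i0 : 'I_n).
Hypotheses (alpha_ge0 : 0 <= alpha) (a_gt0 : 0 < a) (x_itv : 0 <= x <= a).
Variables (f : 'I_n -> R) (L : 'I_n -> (R -> R) -> R) (A : R -> 'I_n -> R).
Hypothesis L_lin : forall j (c : R) (phi psi : R -> R),
  continuous phi -> continuous psi ->
  L j (fun y => c * phi y + psi y) = c * L j phi + L j psi.
Hypothesis L_ge0 : forall j (phi : R -> R), continuous phi ->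
  (forall y, 0 <= y <= a -> 0 <= phi y) -> 0 <= L j phi.
Hypothesis exit_identity : forall b : R, 0 <= b -> forall j,
  expR (b * x) * (i0 == j)%:R + \sum_l L l (fun y => expR (b * y)) * F b l j + A b j
  = expR (b * a) * f j.
Hypothesis A_alpha : forall j, A alpha j = 0.
Hypothesis A_ge0 : forall (b : R) j, alpha <= b -> 0 <= A b j.
Hypothesis A_growth : forall (b0 b : R) j, alpha < b0 -> b0 <= b ->
  A b j <= (b - alpha) / (b0 - alpha) * A b0 j.

Let Wf i j : R -> R := fun y => W y i j.

(** The value that fluctuation theory predicts for [L]: the resolvent of the reflected process
    killed on passing [a], in terms of [W] at [a] weighted by [f] and [W] at [x]. *)
Let w j (phi : R -> R) : R :=
  \sum_l f l * conv_itv (Wf l j) a phi - conv_itv (Wf i0 j) x phi.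
Let N j (phi : R -> R) : R := L j phi - w j phi.
(** The error made by cutting the Laplace transforms of [W] at [a] and at [x]. *)
Let rho j (b : R) : R :=
  \sum_l f l * laplace_tail (Wf l j) a b - laplace_tail (Wf i0 j) x b.
Let e_ (b : R) : R -> R := fun y => expR (b * y).

Let W_cont i j : {within `[0, +oo[, continuous (Wf i j)}.
Proof. exact: W_scale.1. Qed.

Let w_lin j (c : R) (phi psi : R -> R) : continuous phi -> continuous psi ->
  w j (fun y => c * phi y + psi y) = c * w j phi + w j psi.
Proof.
move=> cphi cpsi; rewrite /w conv_itv_lin //.
have -> : \sum_l f l * conv_itv (Wf l j) a (fun y => c * phi y + psi y) =
    c * (\sum_l f l * conv_itv (Wf l j) a phi) + \sum_l f l * conv_itv (Wf l j) a psi.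
  rewrite mulr_sumr -big_split /=; apply: eq_bigr => l _.
  by rewrite conv_itv_lin //; ring.
ring.
Qed.

Let N_lin j (c : R) (phi psi : R -> R) : continuous phi -> continuous psi ->
  N j (fun y => c * phi y + psi y) = c * N j phi + N j psi.
Proof. by move=> cphi cpsi; rewrite /N w_lin // L_lin //; ring. Qed.

Let w_le j : exists2 B, 0 <= B & forall (phi : R -> R) (c s s' : R),
  continuous phi -> 0 <= c <= a ->
  (forall y, 0 <= y <= c -> `|phi y| <= s) ->
  (forall y, c <= y <= a -> `|phi y| <= s') -> `|w j phi| <= B * (c * s + s').
Proof.
have /choice[B HB] : forall l, exists B, 0 <= B /\
    forall (x : R) (phi : R -> R) (c s s' : R), 0 <= x <= a -> continuous phi ->
    0 <= c <= a -> (forall y, 0 <= y <= c -> `|phi y| <= s) ->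
    (forall y, c <= y <= a -> `|phi y| <= s') ->
    `|conv_itv (Wf l j) x phi| <= B * (c * s + s').
  move=> l; have [B B0 H] := conv_itv_le (@W_cont l j) (ltW a_gt0).
  by exists B; split => // ? ? ? ? ?; exact: H.
exists (\sum_l `|f l| * B l + B i0).
  rewrite addr_ge0 ?(HB i0).1 // sumr_ge0 // => l _.
  by rewrite mulr_ge0 // (HB l).1.
move=> phi c s s' cphi ca Hs Hs'; rewrite /w mulrDl.
apply: (le_trans (ler_normB _ _)); apply: lerD; last exact: (HB i0).2.
apply: (le_trans (ler_norm_sum _ _ _)); rewrite mulr_suml; apply: ler_sum => l _.
rewrite normrM -mulrA ler_wpM2l //; apply: (HB l).2 => //.
by rewrite lexx ltW.
Qed.

Let L1_ge0 j : 0 <= L j (fun=> 1).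
Proof. by apply: L_ge0 => //; exact: cst_continuous. Qed.

(** Positivity of [L] applied to [s - phi] and to [s + phi]. *)
Let L_le j (phi : R -> R) (s : R) : continuous phi ->
  (forall y, 0 <= y <= a -> `|phi y| <= s) -> `|L j phi| <= L j (fun=> 1) * s.
Proof.
move=> cphi Hs.
have c1 : continuous (fun _ : R => 1 : R) by move=> ?; exact: cvg_cst.
have c0 : continuous (fun _ : R => 0 : R) by move=> ?; exact: cvg_cst.
have L0 : L j (fun _ : R => 0) = 0.
  have := @L_lin j 1 (fun _ : R => 0) (fun _ : R => 0) c0 c0.
  rewrite (_ : (fun=> _) = fun=> 0); last by apply/funext => y; rewrite mulr0 addr0.
  by rewrite mul1r => /eqP; rewrite -subr_eq subrr eq_sym => /eqP.
have cphi' : continuous (fun y : R => -1 * phi y + 0).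
  by move=> y; apply: cvgD; [apply: cvgMr; exact: cphi|exact: cvg_cst].
have h1 : 0 <= s * L j (fun=> 1) - L j phi.
  have -> : s * L j (fun=> 1) - L j phi =
      L j (fun y => s * 1 + (-1 * phi y + 0)).
    by rewrite L_lin // L_lin // L0; ring.
  apply: L_ge0.
    move=> y; apply: cvgD; last exact: cphi'.
    by apply: cvgMr; exact: c1.
  by move=> y /Hs; rewrite ler_norml => /andP[]; lra.
have h2 : 0 <= s * L j (fun=> 1) + L j phi.
  have -> : s * L j (fun=> 1) + L j phi = L j (fun y => s * 1 + phi y).
    by rewrite L_lin.
  apply: L_ge0.
    by move=> y; apply: cvgD; [apply: cvgMr; exact: c1|exact: cphi].
  by move=> y /Hs; rewrite ler_norml => /andP[]; lra.
by rewrite mulrC ler_norml; lra.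
Qed.

Section LargeExponent.
Variable b1 : R.
Hypotheses (b1_ge1 : 1 <= b1) (b1_alpha : alpha + 1 <= b1).
Hypothesis W_laplace : forall b : R, b1 <= b -> F b \in unitmx /\ forall i j,
      (@lebesgue_measure R).-integrable `[0, +oo[
          (EFin \o (fun y => expR (- b * y) * Wf i j y)) /\
      \int[@lebesgue_measure R]_(y in `[0, +oo[) (expR (- b * y) * Wf i j y)
        = invmx (F b) i j.

Let W_int i j : (@lebesgue_measure R).-integrable `[0, +oo[
          (EFin \o (fun y => expR (- b1 * y) * Wf i j y)).
Proof. by have [_ /(_ i j)[]] := W_laplace (lexx b1). Qed.

Let W_split i j y b : 0 <= y -> b1 <= b ->
  expR (b * y) * invmx (F b) i j =
  conv_itv (Wf i j) y (e_ b) + laplace_tail (Wf i j) y b.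
Proof.
move=> y0 b1b; have [_ /(_ i j)[_ <-]] := W_laplace b1b.
exact: (laplace_split (@W_cont i j) (W_int i j)).
Qed.

Let b_ge0 (b : R) : b1 <= b -> 0 <= b.
Proof. by move=> h; have h1 := b1_ge1; lra. Qed.

(** Multiply the exit identity on the right by the inverse of [F b]; by [W_split] the factors
    [exp (b a)] and [exp (b x)] times this inverse become a convolution plus a tail. *)
Let NE j (b : R) : b1 <= b ->
  N j (e_ b) = rho j b - \sum_l A b l * invmx (F b) l j.
Proof.
move=> b1b; have [Fu _] := W_laplace b1b.
have a0 := ltW a_gt0; have /andP[x0 xa] := x_itv.
pose v : 'rV[R]_n := \row_l L l (e_ b).
pose u : 'rV[R]_n := \row_l (expR (b * a) * f l - expR (b * x) * (i0 == l)%:R - A b l).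
have vF : v *m F b = u.
  apply/rowP => l; rewrite !mxE -(exit_identity (b_ge0 b1b)).
  under eq_bigr do rewrite mxE; rewrite /e_; ring.
have vE : v = u *m invmx (F b) by rewrite -vF mulmxK.
have : v 0 j = L j (e_ b) by rewrite mxE.
rewrite /N => <-; rewrite vE mxE.
under eq_bigr do rewrite mxE !mulrBl.
rewrite !sumrB /rho /w.
have -> : \sum_l expR (b * x) * (i0 == l)%:R * invmx (F b) l j =
    expR (b * x) * invmx (F b) i0 j.
  rewrite (bigD1 i0) //= eqxx mulr1 big1 ?addr0 // => l /negPf li.
  by rewrite eq_sym li mulr0 mul0r.
rewrite W_split //.
have -> : \sum_l expR (b * a) * f l * invmx (F b) l j =
    \sum_l f l * conv_itv (Wf l j) a (e_ b) + \sum_l f l * laplace_tail (Wf l j) a b.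
  rewrite -big_split /=; apply: eq_bigr => l _.
  by rewrite -mulrDr -W_split // mulrCA mulrA.
ring.
Qed.

Let rho_bounded j : exists2 M, 0 <= M & forall b : R, b1 <= b -> `|rho j b| <= M.
Proof.
have /andP[x0 xa] := x_itv.
have [M1 M10 HM1] := laplace_tail_bounded (@W_cont i0 j) (W_int i0 j) x0.
have /choice[M HM] : forall l, exists M, 0 <= M /\
    forall b : R, b1 <= b -> `|laplace_tail (Wf l j) a b| <= M.
  move=> l; have [M M0 H] :=
    laplace_tail_bounded (@W_cont l j) (W_int l j) (ltW a_gt0).
  by exists M.
exists (\sum_l `|f l| * M l + M1).
  by rewrite addr_ge0 // sumr_ge0 // => l _; rewrite mulr_ge0 // (HM l).1.
move=> b b1b; apply: (le_trans (ler_normB _ _)); apply: lerD; last exact: HM1.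
apply: (le_trans (ler_norm_sum _ _ _)); apply: ler_sum => l _.
by rewrite normrM ler_wpM2l // (HM l).2.
Qed.

Let rho_cvg0 j : (fun k : nat => rho j (b1 + k%:R)) @ \oo --> 0.
Proof.
have /andP[x0 xa] := x_itv.
rewrite -[X in _ --> X](subr0 0); apply: cvgB; last first.
  exact: (laplace_tail_cvg0 (@W_cont i0 j) (W_int i0 j) x0).
rewrite -[X in _ --> X](_ : \sum_(l : 'I_n) f l * 0 = 0); last first.
  by rewrite big1 // => l _; rewrite mulr0.
apply: cvg_sumr => l; apply: cvgMr.
exact: (laplace_tail_cvg0 (@W_cont l j) (W_int l j) (ltW a_gt0)).
Qed.

(** At [x = 0] the convolution runs over a single point, so the inverse of [F b] is itself a Laplace
    tail. *)
Let invF_bounded i j : exists2 M, 0 <= M &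
  forall b : R, b1 <= b -> `|invmx (F b) i j| <= M.
Proof.
have [M M0 HM] := laplace_tail_bounded (@W_cont i j) (W_int i j) (lexx 0).
exists M => // b b1b; apply: le_trans (HM _ b1b).
have := W_split i j (lexx 0) b1b; rewrite mulr0 expR0 mul1r => ->.
rewrite (_ : conv_itv _ _ _ = 0) ?add0r //.
rewrite /conv_itv set_itv1; exact: Rintegral_set1.
Qed.

(** Below [b1] crude bounds on [L] and [w] suffice. Above it [NE] leaves [A b] as the only term that
    may grow, and [A b <= b * A b1] entrywise because [b1 - alpha >= 1]. *)
Let N_growth j : exists2 C, 0 <= C & forall b : R, 0 <= b ->
  `|N j (e_ b)| <= C * (1 + b).
Proof.
have [M M0 HM] := rho_bounded j.
have /choice[G HG] : forall l, exists M, 0 <= M /\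
    forall b : R, b1 <= b -> `|invmx (F b) l j| <= M.
  by move=> l; have [G G0 H] := invF_bounded l j; exists G.
have [B B0 HB] := w_le j.
have b10 : 0 <= b1 by exact: b_ge0.
have b1al := b1_alpha; have al0 := alpha_ge0.
have al1 : alpha <= b1 by lra.
pose S := \sum_l A b1 l * G l.
have S0 : 0 <= S.
  by rewrite sumr_ge0 // => l _; rewrite mulr_ge0 ?(HG l).1 ?A_ge0.
pose E := expR (b1 * a).
have E0 : 0 <= E by exact: expR_ge0.
pose T := L j (fun=> 1) * E + B * (a * E + E).
have aE : 0 <= a * E + E by rewrite addr_ge0 ?mulr_ge0 // ltW.
have T0 : 0 <= T by apply: addr_ge0; apply: mulr_ge0 => //; exact: L1_ge0.
have MST0 : 0 <= M + S + T := addr_ge0 (addr_ge0 M0 S0) T0.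
exists (M + S + T) => //.
move=> b b0.
have [bb1|b1b] := ltP b b1.
  have eb y : 0 <= y <= a -> `|e_ b y| <= E.
    move=> /andP[y0 ya]; rewrite ger0_norm ?expR_ge0 // ler_expR.
    by rewrite ler_pM // ltW.
  apply: (@le_trans _ _ T).
    rewrite /N; apply: (le_trans (ler_normB _ _)); apply: lerD.
      by apply: L_le => //; exact: continuous_expRM.
    apply: HB; first exact: continuous_expRM.
    + by rewrite lexx ltW.
    + exact: eb.
    + by move=> y /andP[y1 y2]; apply: eb; rewrite y2 (le_trans _ y1) // ltW.
  have : 0 <= (M + S + T) * b by rewrite mulr_ge0.
  lra.
rewrite NE //; apply: (@le_trans _ _ (M + S * b)).
  apply: (le_trans (ler_normB _ _)); apply: lerD; first exact: HM.
  apply: (le_trans (ler_norm_sum _ _ _)); rewrite mulr_suml; apply: ler_sum => l _.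
  have alb : alpha <= b by lra.
  rewrite normrM ger0_norm ?A_ge0 // mulrAC ler_pM ?A_ge0 ?(HG l).2 //.
  apply: (le_trans (A_growth l _ b1b)); first by lra.
  rewrite mulrC ler_wpM2l ?A_ge0 // ler_pdivrMr; last by lra.
  have : b * 1 <= b * (b1 - alpha) by rewrite ler_wpM2l //; lra.
  lra.
have p1 : 0 <= (M + T) * b := mulr_ge0 (addr_ge0 M0 T0) b0.
have p2 : 0 <= S + T := addr_ge0 S0 T0.
lra.
Qed.

Let u j := N j (fun=> 1).

Let N_const j (b : R) : 0 <= b -> N j (e_ b) = u j.
Proof.
move=> b0; have [C C0 HC] := N_growth j; have [B B0 HB] := w_le j.
have := @exponential_moment_constant R a C (N j) a_gt0 C0 (@N_lin j) HC
  (L j (fun=> 1)) B (L j) (w j) (L1_ge0 j) B0 (fun _ _ => erefl).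
by apply => //; exact: L_le.
Qed.

Let u_ge0 j : 0 <= u j.
Proof.
have [C C0 HC] := N_growth j; have [B B0 HB] := w_le j.
have := @exponential_moment_ge0 R a C (N j) a_gt0 C0 (@N_lin j) HC
  B (L j) (w j) (fun _ _ => erefl).
by apply => //; exact: L_ge0.
Qed.

(** By [NE] the row [u - rho] is minus [A b] times the inverse of [F b]; multiplying back by [F b]
    leaves [- A b], whose sign is known. *)
Let u_col j (b : R) : b1 <= b -> \sum_l (u l - rho l b) * F b l j <= 0.
Proof.
move=> b1b; have [Fu _] := W_laplace b1b.
pose Ar : 'rV[R]_n := \row_l A b l.
have -> : \sum_l (u l - rho l b) * F b l j = - (Ar *m invmx (F b) *m F b) 0 j.
  rewrite mxE -sumrN; apply: eq_bigr => l _.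
  rewrite -(N_const l (b_ge0 b1b)) NE // mxE addrAC subrr add0r mulNr.
  by under [in RHS]eq_bigr do rewrite mxE.
by rewrite mulmxKV // mxE oppr_le0 A_ge0 //; have := b1_alpha; lra.
Qed.

Let u_eq0 j : u j = 0.
Proof.
apply/eqP; case: (ltrP 0 (u j)) => [u0|]; last first.
  by move=> h; rewrite eq_le h u_ge0.
have [C0 HC0] := F_offdiag_bounded.
pose C := Num.max C0 0.
have C_ge0 : 0 <= C by rewrite le_max lexx orbT.
have HC b l : 0 <= b -> l != j -> F b l j <= C.
  by move=> b0 lj; rewrite le_max HC0.
have [c0 [c1 [c1_gt0 Hc]]] := F_diag_growth j.
have /choice[M HM] : forall l, exists M, 0 <= M /\
    forall b : R, b1 <= b -> `|rho l b| <= M.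
  by move=> l; have [M M0 H] := rho_bounded l; exists M.
pose S := \sum_l M l * C.
(* In column [j] the off-diagonal terms are bounded below independently of [b], which bounds the
   diagonal term from above. *)
have key b : b1 <= b -> (u j - rho j b) * F b j j <= S.
  move=> b1b; have b0 := b_ge0 b1b.
  have := u_col j b1b; rewrite (bigD1 j) //= => h.
  have h2 : - \sum_(l | l != j) (u l - rho l b) * F b l j <= S.
    rewrite -sumrN /S [leRHS](bigD1 j) //= -[leLHS]add0r lerD //.
      by rewrite mulr_ge0 // (HM j).1.
    apply: ler_sum => l lj; have f0 := F_offdiag_ge0 b0 lj.
    have h1 : rho l b <= M l by apply: le_trans ((HM l).2 _ b1b); exact: ler_norm.
    have h2 : rho l b * F b l j <= M l * F b l j by rewrite ler_wpM2r.
    have h3 : M l * F b l j <= M l * C by rewrite ler_wpM2l ?HC ?(HM l).1.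
    have h4 : 0 <= u l * F b l j by rewrite mulr_ge0.
    lra.
  lra.
have : \forall k \near \oo, rho j (b1 + k%:R) < u j / 2.
  by apply: (cvgr_lt (0 : R) (rho_cvg0 j)); rewrite divr_gt0.
move=> [K _ HK].
have S0 : 0 <= S by rewrite sumr_ge0 // => l _; rewrite mulr_ge0 // (HM l).1.
(* Chosen so that [F b j j >= 2 S / u j + 1] at [b = b1 + k] for [k >= q]. Once [rho j b < u j / 2],
   the diagonal term is then at least [S + u j / 2], against [key]. *)
pose q := (2 * S / u j + 1 - c0) / c1.
pose k := maxn K (Num.truncn `|q|).+1.
have k1 : rho j (b1 + k%:R) < u j / 2 by apply: HK; rewrite /= leq_maxl.
have kq : q <= k%:R.
  apply: (le_trans (ler_norm q)); apply: ltW.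
  apply: (lt_le_trans (truncnS_gt _)); rewrite ler_nat; exact: leq_maxr.
have kb : b1 <= b1 + k%:R by rewrite lerDl.
have := key _ kb; have := Hc _ (b_ge0 kb).
set Fv := F _ j j => h1 h2.
have h3 : 2 * S / u j + 1 <= Fv.
  apply: le_trans h1; rewrite -lerBlDl.
  have : (2 * S / u j + 1 - c0) <= k%:R * c1 by rewrite -ler_pdivrMr.
  have : 0 <= c1 * b1 by rewrite mulr_ge0 ?(ltW c1_gt0) // b_ge0.
  by rewrite mulrDr; lra.
have p : 0 <= 2 * S / u j by rewrite !mulr_ge0 // invr_ge0 ltW.
have h4 : u j / 2 * (2 * S / u j + 1) <= (u j - rho j (b1 + k%:R)) * Fv.
  by rewrite ler_pM ?addr_ge0 //; lra.
have h5 : u j / 2 * (2 * S / u j + 1) = S + u j / 2 by field; rewrite gt_eqF.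
lra.
Qed.

(** Valid for all [b >= 0], also where [F b] is singular: [N] has the same value at every exponent
    and that value is 0. *)
Lemma L_exp_conv j b : 0 <= b -> L j (e_ b) = w j (e_ b).
Proof. by move=> b0; apply/eqP; rewrite -subr_eq0; apply/eqP; rewrite -(u_eq0 j) -(N_const j b0). Qed.

End LargeExponent.

Lemma exit_Zmat j : Zmat F W alpha x i0 j = \sum_r f r * Zmat F W alpha a r j.
Proof.
have [_ [alpha0 Hl]] := W_scale.
pose b1 := Num.max 1 (Num.max (alpha + 1) (alpha0 + 1)).
have b11 : 1 <= b1 by rewrite le_max lexx.
have b1a : alpha + 1 <= b1 by rewrite !le_max lexx orbT.
have b1l : alpha0 + 1 <= b1 by rewrite !le_max lexx !orbT.
have LE l : L l (e_ alpha) = w l (e_ alpha).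
  by apply: (L_exp_conv b11 b1a) => // b hb; apply: Hl; lra.
have := exit_identity alpha_ge0 j; rewrite A_alpha addr0.
have wE l : w l (e_ alpha) =
    \sum_r f r * (expR (alpha * a) * \int[@lebesgue_measure R]_(y in `[0, a])
      (expR (- alpha * y) * W y r l)) -
    expR (alpha * x) * \int[@lebesgue_measure R]_(y in `[0, x])
      (expR (- alpha * y) * W y i0 l).
  rewrite /w conv_itv_exp //; congr (_ - _).
  by apply: eq_bigr => r _; rewrite conv_itv_exp.
have -> : \sum_l L l (e_ alpha) * F alpha l j = \sum_l w l (e_ alpha) * F alpha l j.
  by apply: eq_bigr => l _; rewrite LE.
move=> E; rewrite /Zmat !mxE.
have -> : \sum_r f r * (expR (alpha * a) *: (1%:M - \matrix_(i, j0)
    \int[@lebesgue_measure R]_(y in `[0, a]) (expR (- alpha * y) * W y i j0) *m F alpha)) r j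
  = expR (alpha * a) * f j - \sum_l (\sum_r f r * (expR (alpha * a) *
      \int[@lebesgue_measure R]_(y in `[0, a]) (expR (- alpha * y) * W y r l))) * F alpha l j.
  under eq_bigr do rewrite !mxE mulrBr mulrBr.
  rewrite sumrB; congr (_ - _).
    rewrite (bigD1 j) //= eqxx mulr1 big1 ?addr0 1?mulrC // => r /negPf rj.
    by rewrite rj mulr0 mulr0.
  under [RHS]eq_bigr do rewrite mulr_suml.
  rewrite exchange_big /=; apply: eq_bigr => r _.
  rewrite !mulr_sumr; apply: eq_bigr => l _; rewrite mxE; ring.
rewrite -E mulrBr.
have -> : expR (alpha * x) * \sum_j0 (\matrix_(i, j1)
    \int[@lebesgue_measure R]_(y in `[0, x]) (expR (- alpha * y) * W y i j1)) i0 j0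
    * F alpha j0 j = \sum_l (expR (alpha * x) * \int[@lebesgue_measure R]_(y in `[0, x])
      (expR (- alpha * y) * W y i0 l)) * F alpha l j.
  by rewrite mulr_sumr; apply: eq_bigr => l _; rewrite mxE mulrA.
have -> : \sum_l w l (e_ alpha) * F alpha l j =
   \sum_l (\sum_r f r * (expR (alpha * a) *
      \int[@lebesgue_measure R]_(y in `[0, a]) (expR (- alpha * y) * W y r l))) * F alpha l j
   - \sum_l (expR (alpha * x) * \int[@lebesgue_measure R]_(y in `[0, x])
      (expR (- alpha * y) * W y i0 l)) * F alpha l j.
  by rewrite -sumrB; apply: eq_bigr => l _; rewrite wE mulrBl.
ring.
Qed.

End ExitIdentity.

(** * Image measures, factorised laws and real expectations *)

Lemma ge0_integral_mrestr (d : measure_display) (T : measurableType d) (R : realType)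
    (mu : {measure set T -> \bar R}) (D : set T) (mD : measurable D)
    (f : T -> \bar R) :
  measurable_fun setT f -> (forall x, (0 <= f x)%E) ->
  (\int[mrestr mu mD]_x f x = \int[mu]_(x in D) f x)%E.
Proof.
move=> mf f0; have mDc : measurable (~` D) by exact: measurableC.
rewrite -(setUv D) ge0_integral_setU //.
- rewrite [X in (_ + X)%E]null_set_integral ?adde0 //.
  + apply: eq_measure_integral => A mA AD.
    by rewrite /= /mrestr; congr (mu _); apply/setIidl.
  + exact: measurable_funTS.
  + by rewrite /= /mrestr setICl measure0.
- exact: measurable_funTS.
- by apply/disj_setPS => x [].
Qed.

Section ImageMeasure.
Context d1 d2 (T1 : measurableType d1) (T2 : measurableType d2) (R : realType)
  (m : {finite_measure set T1 -> \bar R}) (f : T1 -> T2).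
Hypothesis mf : measurable_fun setT f.

(** The redex keeps the proof [mf] inside the term, so that the measure structures below, which rest
    on the measurability of [f], can be attached to it. *)
Definition image_measure : set T2 -> \bar R := (fun=> pushforward m f) mf.

Let image0 : image_measure set0 = 0%E.
Proof. by rewrite /image_measure /pushforward preimage_set0 measure0. Qed.

Let image_ge0 A : (0 <= image_measure A)%E.
Proof. exact: measure_ge0. Qed.

Let image_sigma_additive : semi_sigma_additive image_measure.
Proof. exact: measure_semi_sigma_additive. Qed.

HB.instance Definition _ := isMeasure.Build _ _ _ image_measure
  image0 image_ge0 image_sigma_additive.

Let image_finite : fin_num_fun image_measure.
Proof.
move=> A mA; rewrite /image_measure /pushforward fin_num_measure //.
by rewrite -[X in measurable X]setTI; exact: mf.
Qed.

HB.instance Definition _ := Measure_isFinite.Build _ _ _ image_measure image_finite.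

End ImageMeasure.

(** On rectangles the law of [(f, g)] on [D] is a product of two image measures, hence it is the
    product measure, and Tonelli separates the integrals. In the application [D], [D1] and [E] are
    events on the state of [J]. *)
Lemma ge0_integral_prod_law (d1 d2 d3 : measure_display) (T : measurableType d1)
    (T' : measurableType d2) (S : measurableType d3) (R : realType)
    (mu : {finite_measure set T -> \bar R}) (nu : {finite_measure set T' -> \bar R})
    (D D1 : set T) (E : set T') (f : T -> R) (g : T -> S) (g' : T' -> S)
    (psi : S -> R) :
  measurable D -> measurable D1 -> measurable E ->
  measurable_fun setT f -> measurable_fun setT g -> measurable_fun setT g' ->
  measurable_fun setT psi -> (forall x, 0 <= f x) -> (forall y, 0 <= psi y) ->
  (forall A B, measurable A -> measurable B ->
    mu (f @^-1` A `&` g @^-1` B `&` D) =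
    (mu (f @^-1` A `&` D1) * nu (g' @^-1` B `&` E))%E) ->
  (\int[mu]_(x in D) (f x * psi (g x))%:E =
   \int[mu]_(x in D1) (f x)%:E * \int[nu]_(y in E) (psi (g' y))%:E)%E.
Proof.
move=> mD mD1 mE mf mg mg' mpsi f0 psi0 law.
have mfg : measurable_fun setT (fun x => (f x, g x)) by exact/measurable_fun_pairP.
pose m1 := image_measure (mrestr mu mD1) mf.
pose m2 := image_measure (mrestr nu mE) mg'.
pose m' := image_measure (mrestr mu mD) mfg.
have m'E := @product_measure_unique _ _ _ _ R m1 m2 m'.
pose h (z : R * S) : \bar R := (z.1 * psi z.2)%:E.
(* The positive part makes the integrand nonnegative on the whole product space and not only on the
   range of [f]. *)
pose h0 (z : R * S) : \bar R := (Num.max z.1 0 * psi z.2)%:E.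
have mh0 : measurable_fun setT h0.
  apply/measurable_EFinP; apply: measurable_funM; last exact: measurableT_comp.
  by apply: measurable_maxr => //; exact: measurable_fst.
have h0_ge0 z : (0 <= h0 z)%E.
  by rewrite lee_fin mulr_ge0 // le_max lexx orbT.
have fmax x : Num.max (f x) 0 = f x by apply/max_idPl.
have mpf : measurable_fun setT (fun r : R => (Num.max r 0)%:E).
  by apply/measurable_EFinP; apply: measurable_maxr => //; exact: measurable_id.
have E1 : (\int[m']_z h0 z = \int[mu]_(x in D) (f x * psi (g x))%:E)%E.
  rewrite ge0_integral_pushforward // preimage_setT.
  rewrite ge0_integral_mrestr //=; last exact: measurableT_comp mh0 mfg.
  by apply: eq_integral => x _; rewrite /h0 /= fmax.
have E2 : (\int[m1 \x m2]_z h0 z = \int[m']_z h0 z)%E.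
  by apply: eq_measure_integral => A mA _; apply: m'E => // A1 B1 *; apply: law.
have E3 : (\int[m1]_r (Num.max r 0)%:E = \int[mu]_(x in D1) (f x)%:E)%E.
  rewrite ge0_integral_pushforward // ?preimage_setT.
    rewrite ge0_integral_mrestr //=; last 2 first.
    - exact: measurableT_comp mpf mf.
    - by move=> x; rewrite lee_fin fmax.
    by apply: eq_integral => x _; rewrite fmax.
  by move=> r _; rewrite lee_fin le_max lexx orbT.
have E4 : (\int[m2]_s (psi s)%:E = \int[nu]_(y in E) (psi (g' y))%:E)%E.
  rewrite ge0_integral_pushforward // ?preimage_setT.
  - apply: ge0_integral_mrestr => [|y]; last by rewrite lee_fin.
    by apply/measurable_EFinP; exact: measurableT_comp.
  - exact/measurable_EFinP.
  - by move=> s _; rewrite lee_fin.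
rewrite -E1 -E2 fubini_tonelli1 //.
rewrite -E3 -ge0_integralZr //; last 2 first.
- by move=> r _; rewrite lee_fin le_max lexx orbT.
- by rewrite -E4; apply: integral_ge0 => s _; rewrite lee_fin.
apply: eq_integral => r _; rewrite /fubini_F -E4 -ge0_integralZl_EFin //.
- by move=> s _; rewrite lee_fin.
- exact/measurable_EFinP.
- by rewrite le_max lexx orbT.
Qed.

Section RealExpectation.
Context {d : measure_display} {T : measurableType d} {R : realType}.
Variable Pr : probability T R.
Implicit Types f g : T -> R.

Lemma integrable_bounded f (M : R) : measurable_fun setT f ->
  (forall w, `|f w| <= M) -> Pr.-integrable setT (EFin \o f).
Proof.
move=> mf fM; apply: (le_integrable measurableT _ _
    (finite_measure_integrable_cst Pr M measurableT)).
- exact/measurable_EFinP.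
- by move=> w _ /=; rewrite lee_fin (le_trans (fM w)) // ler_norm.
Qed.

Lemma integrable_ge0_fin f (r : R) : measurable_fun setT f ->
  (forall w, 0 <= f w) -> (\int[Pr]_w (f w)%:E = r%:E)%E ->
  Pr.-integrable setT (EFin \o f) /\ \int[Pr]_w f w = r.
Proof.
move=> mf f0 fr; split; last by rewrite /Rintegral fr.
apply/integrableP; split; first exact/measurable_EFinP.
rewrite (_ : (\int[_]_(_ in _) _ = r%:E)%E) ?ltry // -fr.
by apply: eq_integral => w _ /=; rewrite ger0_norm.
Qed.

Lemma EFin_Rintegral f : Pr.-integrable setT (EFin \o f) ->
  (\int[Pr]_w (f w)%:E = (\int[Pr]_w f w)%:E)%E.
Proof. by move=> intf; rewrite /Rintegral fineK //; exact: integrable_fin_num. Qed.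

Lemma integrable_add f g : Pr.-integrable setT (EFin \o f) ->
  Pr.-integrable setT (EFin \o g) -> Pr.-integrable setT (EFin \o (fun w => f w + g w)).
Proof.
by move=> intf intg; apply: eq_integrable (integrableD measurableT intf intg).
Qed.

Lemma integrable_sum_EFin (I : Type) (s : seq I) (F : I -> T -> R) :
  (forall i, Pr.-integrable setT (EFin \o F i)) ->
  Pr.-integrable setT (EFin \o (fun w => \sum_(i <- s) F i w)).
Proof.
move=> iF; elim: s => [|i s IH].
  rewrite (_ : _ \o _ = cst 0%E); first exact: integrable0.
  by apply/funext => w; rewrite /= big_nil.
apply: eq_integrable (integrable_add (iF i) IH) => // w _ /=.
by rewrite big_cons.
Qed.

Lemma Rintegral_sum (I : Type) (s : seq I) (F : I -> T -> R) :
  (forall i, Pr.-integrable setT (EFin \o F i)) ->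
  \int[Pr]_w (\sum_(i <- s) F i w) = \sum_(i <- s) \int[Pr]_w F i w.
Proof.
move=> iF; elim: s => [|i s IH].
  rewrite big_nil -[RHS](mul0r (fine (Pr setT))) -Rintegral_cst //.
  by apply: eq_Rintegral => w _; rewrite big_nil.
rewrite big_cons -IH -RintegralD //; last exact: integrable_sum_EFin.
by apply: eq_Rintegral => w _; rewrite big_cons.
Qed.

Lemma ae_eq_Rintegral f g : measurable_fun setT f -> measurable_fun setT g ->
  {ae Pr, forall w, f w = g w} -> \int[Pr]_w f w = \int[Pr]_w g w.
Proof.
move=> mf mg fg; rewrite /Rintegral; congr fine; apply: ae_eq_integral => //.
- exact/measurable_EFinP.
- exact/measurable_EFinP.
- by apply: filterS fg => w -> _.
Qed.

Lemma ae_eq_integrable f g : measurable_fun setT f ->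
  {ae Pr, forall w, f w = g w} -> Pr.-integrable setT (EFin \o g) ->
  Pr.-integrable setT (EFin \o f).
Proof.
move=> mf fg intg; have /integrableP[mg fing] := intg.
apply/integrableP; split; first exact/measurable_EFinP.
apply: le_lt_trans fing; rewrite le_eqVlt; apply/orP; left; apply/eqP.
apply: ae_eq_integral => //; [|exact: measurableT_comp|].
  by apply: measurableT_comp => //; exact/measurable_EFinP.
by apply: filterS fg => w E _; rewrite /= E.
Qed.

Lemma ae_le_Rintegral f g : Pr.-integrable setT (EFin \o f) ->
  Pr.-integrable setT (EFin \o g) ->
  {ae Pr, forall w, f w <= g w} -> \int[Pr]_w f w <= \int[Pr]_w g w.
Proof.
move=> intf intg fg.
have mf : measurable_fun setT f by apply/measurable_EFinP; case/integrableP: intf.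
have mg : measurable_fun setT g by apply/measurable_EFinP; case/integrableP: intg.
have mm : measurable_fun setT (fun w => Num.max (f w) (g w)).
  exact: measurable_maxr.
(* Replacing [g] by the maximum makes the inequality hold everywhere without changing the
   integral. *)
have -> : \int[Pr]_w g w = \int[Pr]_w Num.max (f w) (g w).
  by apply: ae_eq_Rintegral => //; apply: filterS fg => w /max_idPr.
apply: le_Rintegral => //; last by move=> w _; rewrite le_max lexx.
apply: (le_integrable measurableT _ _
  (integrable_add (integrable_norm intf) (integrable_norm intg))).
- exact/measurable_EFinP.
- move=> w _ /=; rewrite lee_fin; apply: le_trans (ler_norm _).
  by case: (leP (f w) (g w)) => _; rewrite ?lerDl ?lerDr.
Qed.

Lemma Rintegral_prob_cst (c : R) : \int[Pr]_w c = c.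
Proof.
rewrite Rintegral_cst // (_ : fine _ = 1) ?mulr1 //.
exact: (congr1 fine (probability_setT Pr)).
Qed.

End RealExpectation.

(** * The Markov additive property for integrands *)

Section MarkovAdditive.
Context {R : realType} {d : measure_display} {Om : measurableType d} {n : nat}.
Variables (P : R -> 'I_n -> probability Om R)
          (X : R -> Om -> R) (J : R -> Om -> option 'I_n).
Hypothesis XJ_meas : MAP_measurable X J.
Hypothesis XJ_start : MAP_start_paths P X J.
Hypothesis XJ_markov : markov_additive P X J.

Definition adapted (t : R) (f : Om -> R) : Prop :=
  measurable_fun (setT : set (g_sigma_algebraType (nat_gen X J t))) f.

Definition inJ (t : R) (j : 'I_n) (w : Om) : R := (J t w == Some j)%:R.

Lemma adapted_sub (t t' : R) f : t <= t' -> adapted t f -> adapted t' f.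
Proof.
move=> tt' af _ B mB; have := af measurableT B mB.
apply: sub_sigma_algebra2 => A [u [/andP[u0 ut] HA]].
by exists u; split => //; rewrite u0 (le_trans ut).
Qed.

Lemma natF_measurable t A : natF X J t A -> measurable A.
Proof.
apply: smallest_sub; first exact: sigma_algebra_measurable.
move=> B [u [_ [[C [mC ->]]|[j ->]]]]; last exact: XJ_meas.2.
by rewrite -[X in measurable X]setTI; exact: XJ_meas.1.
Qed.

Lemma adapted_measurable t f : adapted t f -> measurable_fun setT f.
Proof.
move=> af _ B mB; apply: (@natF_measurable t); exact: (af measurableT B mB).
Qed.

Lemma adapted_X (t u : R) : 0 <= u <= t -> adapted t (X u).
Proof.
move=> ut _ B mB; rewrite setTI; apply: sub_sigma_algebra; exists u; split => //.
by left; exists B.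
Qed.

Lemma adapted_inJ (t u : R) j : 0 <= u <= t -> adapted t (inJ u j).
Proof.
move=> ut; rewrite (_ : inJ u j = \1_[set w | J u w = Some j]).
  apply: measurable_indic; apply: sub_sigma_algebra; exists u; split => //.
  by right; exists (Some j).
apply/funext => w; rewrite indicE /inJ; congr ((nat_of_bool _)%:R);
  apply/idP/idP => [/eqP h|/set_mem h]; [exact: mem_set|exact/eqP].
Qed.

Lemma measurable_inJ t j : measurable_fun setT (inJ t j).
Proof.
rewrite (_ : inJ t j = \1_[set w | J t w = Some j]).
  by apply: measurable_indic; exact: XJ_meas.2.
apply/funext => w; rewrite indicE /inJ; congr ((nat_of_bool _)%:R);
  apply/idP/idP => [/eqP h|/set_mem h]; [exact: mem_set|exact/eqP].
Qed.

Lemma inJ_ge0 t j w : 0 <= inJ t j w.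
Proof. exact: ler0n. Qed.

Lemma inJ_le1 t j w : inJ t j w <= 1.
Proof. by rewrite /inJ; case: eqP. Qed.

Let integral_inJ (Pr : probability Om R) t j (f : Om -> R) :
  (\int[Pr]_(w in [set w | J t w = Some j]) (f w)%:E =
   \int[Pr]_w (f w * inJ t j w)%:E)%E.
Proof.
rewrite integral_mkcond; apply: eq_integral => w _.
rewrite patchE /inJ; case: ifPn => [|/negP]; rewrite inE /= => h.
  by rewrite h eqxx mulr1.
by move/eqP/negbTE: h => ->; rewrite mulr0.
Qed.

(** The product law applies with the past [f] on one side and the increment of [X] on the other;
    both are restricted to the prescribed states of [J]. *)
Lemma markov_ge0 x i (t s : R) (k j : 'I_n) (f : Om -> R) (psi : R -> R) :
  0 <= t -> 0 <= s -> adapted t f -> (forall w, 0 <= f w) ->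
  measurable_fun setT psi -> (forall y, 0 <= psi y) ->
  (\int[P x i]_w (f w * inJ t k w * (psi (X (t + s) w - X t w) * inJ (t + s) j w))%:E =
   \int[P x i]_w (f w * inJ t k w)%:E *
   \int[P 0 k]_w (psi (X s w - X 0 w) * inJ s j w)%:E)%E.
Proof.
move=> t0 s0 af f0 mpsi psi0.
have mJ u l : measurable [set w | J u w = Some l] by exact: XJ_meas.2.
have mXB u v : measurable_fun setT (fun w => X u w - X v w).
  by apply: measurable_funB; exact: XJ_meas.1.
have := @ge0_integral_prod_law _ _ _ Om Om R R (P x i) (P 0 k)
  ([set w | J t w = Some k] `&` [set w | J (t + s) w = Some j])
  [set w | J t w = Some k] [set w | J s w = Some j]
  f (fun w => X (t + s) w - X t w) (fun w => X s w - X 0 w) psi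
  (measurableI _ _ (mJ _ _) (mJ _ _)) (mJ _ _) (mJ _ _)
  (adapted_measurable af) (mXB _ _) (mXB _ _) mpsi f0 psi0.
rewrite !integral_inJ => <-.
  rewrite [RHS]integral_mkcond.
  apply: eq_integral => w _; rewrite patchE /inJ.
  case: ifPn => [|/negP]; rewrite inE /= => h.
    by case: h => -> ->; rewrite !eqxx !mulr1.
  case: eqP => [h1|_]; last by rewrite mulr0 mul0r.
  case: eqP => [h2|_]; last by rewrite !mulr0.
  by exfalso; apply: h.
move=> A B mA mB.
have FA : natF X J t (f @^-1` A).
  by have := af measurableT A mA; rewrite setTI.
have := XJ_markov x i k j t0 s0 FA mB.
by move=> E; rewrite -E; congr (P x i _); apply/seteqP; split => w /=; tauto.
Qed.

Lemma X0_ae x i : {ae P x i, forall w, X 0 w = x /\ J 0 w = Some i}.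
Proof. exact: XJ_start.1. Qed.

Lemma good_ae x i : {ae P x i, forall w, good_path X J w}.
Proof. exact: XJ_start.2. Qed.

Variable F : R -> 'M[R]_n.
Hypothesis F_exponent : is_matrix_exponent P X J F.

Lemma expX_inJ (b s : R) k j : 0 <= b -> 0 <= s ->
  (\int[P 0 k]_w (expR (b * (X s w - X 0 w)) * inJ s j w)%:E =
   (expmx (s *: F b) k j)%:E)%E.
Proof.
move=> b0 s0; rewrite -(F_exponent k j b0 s0); apply: ae_eq_integral => //.
- apply/measurable_EFinP; apply: measurable_funM; last exact: measurable_inJ.
  apply: measurableT_comp => //; apply: measurable_funM => //.
  by apply: measurable_funB; exact: XJ_meas.1.
- apply/measurable_EFinP.
  rewrite (_ : (fun _ => _) = fun w => expR (b * X s w) * inJ s j w).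
    apply: measurable_funM; last exact: measurable_inJ.
    by apply: measurableT_comp => //; apply: measurable_funM => //; exact: XJ_meas.1.
  by apply/funext => w; rewrite /inJ; case: eqP; rewrite ?mulr1 ?mulr0.
- apply: filterS (X0_ae 0 k) => w [-> _] _; rewrite subr0 /inJ.
  by case: eqP => _; rewrite ?mulr1 ?mulr0.
Qed.

Lemma expmx_ge0 (b s : R) k j : 0 <= b -> 0 <= s -> 0 <= expmx (s *: F b) k j.
Proof.
move=> b0 s0; rewrite -lee_fin -expX_inJ //; apply: integral_ge0 => w _.
by rewrite lee_fin mulr_ge0 ?expR_ge0 ?inJ_ge0.
Qed.

Lemma markov_exp x i (t s b M : R) (k j : 'I_n) (f : Om -> R) :
  0 <= t -> 0 <= s -> 0 <= b -> adapted t f -> (forall w, 0 <= f w <= M) ->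
  (P x i).-integrable setT (EFin \o (fun w => f w * inJ t k w *
     (expR (b * (X (t + s) w - X t w)) * inJ (t + s) j w))) /\
  \int[P x i]_w (f w * inJ t k w *
     (expR (b * (X (t + s) w - X t w)) * inJ (t + s) j w)) =
  \int[P x i]_w (f w * inJ t k w) * expmx (s *: F b) k j.
Proof.
move=> t0 s0 b0 af fM.
have mf := adapted_measurable af.
have mfJ : measurable_fun setT (fun w => f w * inJ t k w).
  by apply: measurable_funM => //; exact: measurable_inJ.
apply: integrable_ge0_fin.
- apply: measurable_funM => //; apply: measurable_funM; last exact: measurable_inJ.
  apply: measurableT_comp => //; apply: measurable_funM => //.
  by apply: measurable_funB; exact: XJ_meas.1.
- move=> w; have /andP[f0 _] := fM w.
  by rewrite !mulr_ge0 ?expR_ge0 ?inJ_ge0.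
rewrite (@markov_ge0 x i t s k j f (fun y => expR (b * y))) //; last 2 first.
- by move=> w; have /andP[] := fM w.
- by apply: measurableT_comp => //; exact: measurable_funM.
rewrite expX_inJ // EFinM EFin_Rintegral //.
apply: (@integrable_bounded _ _ _ _ _ M) => // w; have /andP[f0 f1] := fM w.
rewrite ger0_norm ?mulr_ge0 ?inJ_ge0 // -[leRHS]mulr1.
by rewrite ler_pM ?inJ_ge0 ?inJ_le1.
Qed.

Lemma alive_before (s t : R) w : good_path X J w -> 0 <= s <= t ->
  J t w <> None -> exists l, J s w = Some l.
Proof.
move=> [h _ _ _ _] st; case E : (J s w) => [l|] Jt; first by exists l.
by case: Jt; exact: (h s t).
Qed.

Lemma inJ_sum (s t : R) w j : good_path X J w -> 0 <= s <= t ->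
  \sum_l inJ s l w * inJ t j w = inJ t j w.
Proof.
move=> gw st; rewrite /inJ; case: (J t w =P Some j) => [E|_]; last first.
  by rewrite big1 // => l _; rewrite mulr0.
have [l Jl] : exists l, J s w = Some l.
  by apply: (alive_before gw st); rewrite E.
rewrite (bigD1 l) //= Jl eqxx mulr1 big1 ?addr0 // => l' /negPf ll'.
by rewrite (_ : (Some l == Some l') = false) ?mul0r // eqE /= eq_sym.
Qed.

(** Summing [markov_exp] over the state at time [t] loses nothing: the cemetery is absorbing on good
    paths, so a path alive at [t + s] was in some state at [t]. *)
Lemma markov_exp_sum x i (t s b M : R) (j : 'I_n) (f : Om -> R) :
  0 <= t -> 0 <= s -> 0 <= b -> adapted t f -> (forall w, 0 <= f w <= M) ->
  (P x i).-integrable setT (EFin \o (fun w => f w *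
     (expR (b * (X (t + s) w - X t w)) * inJ (t + s) j w))) /\
  \int[P x i]_w (f w * (expR (b * (X (t + s) w - X t w)) * inJ (t + s) j w)) =
  \sum_k \int[P x i]_w (f w * inJ t k w) * expmx (s *: F b) k j.
Proof.
move=> t0 s0 b0 af fM.
have mf := adapted_measurable af.
pose g k w := f w * inJ t k w * (expR (b * (X (t + s) w - X t w)) * inJ (t + s) j w).
have ig k : (P x i).-integrable setT (EFin \o g k).
  exact: (markov_exp x i k j t0 s0 b0 af fM).1.
have mh : measurable_fun setT (fun w => f w *
     (expR (b * (X (t + s) w - X t w)) * inJ (t + s) j w)).
  apply: measurable_funM => //; apply: measurable_funM; last exact: measurable_inJ.
  apply: measurableT_comp => //; apply: measurable_funM => //.
  by apply: measurable_funB; exact: XJ_meas.1.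
have E : {ae P x i, forall w, f w * (expR (b * (X (t + s) w - X t w)) *
    inJ (t + s) j w) = \sum_(k : 'I_n) g k w}.
  apply: filterS (good_ae x i) => w gw.
  rewrite -[in LHS](inJ_sum j gw (s := t)); last by rewrite t0 lerDl.
  by rewrite !mulr_sumr; apply: eq_bigr => k _; rewrite /g; ring.
have ints := integrable_sum_EFin (index_enum 'I_n) ig.
split.
  exact: ae_eq_integrable mh E ints.
rewrite (ae_eq_Rintegral mh _ E); last first.
  by apply/measurable_EFinP; case/integrableP: ints.
rewrite Rintegral_sum //; apply: eq_bigr => k _.
exact: (markov_exp x i k j t0 s0 b0 af fM).2.
Qed.

End MarkovAdditive.

(** * The reflected process on a grid *)

Section Skeleton.
Context {R : realType} {Om : Type} (X : R -> Om -> R) (h a : R).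

Definition grid (k : nat) : R := k%:R * h.

Fixpoint Rsk (k : nat) (w : Om) : R :=
  if k is k'.+1 then Num.max (Rsk k' w) (- X (grid k) w)
  else Num.max 0 (- X (grid 0) w).

Definition Ysk (k : nat) (w : Om) : R := X (grid k) w + Rsk k w.

Fixpoint insk (k : nat) (w : Om) : bool :=
  (Ysk k w <= a) && (if k is k'.+1 then insk k' w else true).

Lemma gridS k : grid k.+1 = grid k + h.
Proof. by rewrite /grid -natr1 mulrDl mul1r. Qed.

Lemma gridD k q : grid (k + q) = grid k + grid q.
Proof. by rewrite /grid natrD mulrDl. Qed.

Lemma grid0 : grid 0 = 0.
Proof. by rewrite /grid mul0r. Qed.

Lemma Rsk_ge0 k w : 0 <= Rsk k w.
Proof. by elim: k => [|k IH] /=; rewrite le_max ?lexx ?IH. Qed.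

Lemma Rsk_geN k w : - X (grid k) w <= Rsk k w.
Proof. by case: k => [|k] /=; rewrite le_max lexx orbT. Qed.

Lemma Ysk_ge0 k w : 0 <= Ysk k w.
Proof. by have := Rsk_geN k w; rewrite /Ysk; lra. Qed.

Lemma Rsk_le k q w : Rsk k w <= Rsk (k + q) w.
Proof.
elim: q => [|q IH]; first by rewrite addn0.
by rewrite addnS /= le_max IH.
Qed.

Lemma insk_le k q w : insk (k + q) w -> insk k w.
Proof.
elim: q => [|q IH]; first by rewrite addn0.
by rewrite addnS /= => /andP[_ /IH].
Qed.

Lemma insk_Ysk k w : insk k w -> Ysk k w <= a.
Proof. by case: k => [|k] /andP[]. Qed.

(** The regulator never decreases and [Ysk k] is nonnegative. So a rise of [X] by more than [a] over
    a block of steps forces an exit by the end of the block. *)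
Lemma Ysk_increment k q w : X (grid (k + q)) w - X (grid k) w <= Ysk (k + q) w.
Proof.
by have := Rsk_le k q w; have := Ysk_ge0 k w; rewrite /Ysk; lra.
Qed.

Lemma RskS k w : Rsk k.+1 w = Rsk k w +
  Num.max (- (Ysk k w + (X (grid k.+1) w - X (grid k) w))) 0.
Proof. by rewrite /= /Ysk; case: leP => ?; case: leP => ?; lra. Qed.

(** Lindley's recursion. *)
Lemma YskS k w : Ysk k.+1 w =
  Num.max (Ysk k w + (X (grid k.+1) w - X (grid k) w)) 0.
Proof. by rewrite /Ysk RskS /Ysk; case: leP => ?; case: leP => ?; lra. Qed.

Definition exitk (k : nat) (w : Om) : bool := insk k w && (a < Ysk k.+1 w).

Lemma inskS k w : insk k.+1 w = insk k w && (Ysk k.+1 w <= a).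
Proof. by rewrite /= andbC. Qed.

Lemma exitk_uniq k l w : exitk k w -> exitk l w -> k = l.
Proof.
wlog kl : k l / (k <= l)%N.
  by move=> H ek el; case: (leqP k l) => [/H|/ltnW/H]; [exact|move/(_ el ek)].
move=> /andP[ik Yk] /andP[il _]; move: kl; rewrite leq_eqVlt => /orP[/eqP //|kl].
have := insk_le (k := k.+1) (q := l - k.+1) (w := w).
rewrite subnKC // => /(_ il); rewrite inskS => /andP[_].
by rewrite leNgt Yk.
Qed.

Lemma sum_exitk_le1 K w : \sum_(k < K) (exitk k w)%:R <= 1 :> R.
Proof.
have [/existsP[k ek]|/existsPn nek] := boolP [exists k : 'I_K, exitk k w].
  rewrite (bigD1 k) //= ek big1 ?addr0 // => l lk.
  case: (boolP (exitk l w)) => // el; case/eqP: lk.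
  by apply: val_inj; exact: exitk_uniq el ek.
by rewrite big1 ?ler01 // => k _; rewrite (negbTE (nek k)).
Qed.

End Skeleton.

(* The correction at the reflecting boundary: a step from level [u >= 0] to
   [y < 0] contributes [exp (alpha y)] instead of [exp (b y)]. *)
Definition bdry {R : realType} (alpha b y : R) : R :=
  if y < 0 then expR (alpha * y) - expR (b * y) else 0.

(** * The boundary correction as a function of the exponent *)

Section Bdry.
Context {R : realType}.
Implicit Types alpha b y : R.

Lemma bdry_same alpha y : bdry alpha alpha y = 0.
Proof. by rewrite /bdry subrr; case: ifP. Qed.

Lemma bdry_ge0 alpha b y : alpha <= b -> 0 <= bdry alpha b y.
Proof.
move=> ab; rewrite /bdry; case: ifP => // y0.
by rewrite subr_ge0 ler_expR ler_wnM2r // ltW.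
Qed.

Lemma norm_bdry_le1 alpha b y : 0 <= alpha -> 0 <= b -> `|bdry alpha b y| <= 1.
Proof.
move=> a0 b0; rewrite /bdry; case: ifP => y0; last by rewrite normr0.
have e c : 0 <= c -> 0 <= expR (c * y) <= 1.
  by move=> c0; rewrite expR_ge0 -expR0 ler_expR mulr_ge0_le0 // ltW.
have /andP[e1 e2] := e _ a0; have /andP[e3 e4] := e _ b0.
by rewrite ler_norml; lra.
Qed.

(** Convexity of the exponential, from [1 + z <= exp z] alone: after multiplication by
    [exp (theta v)] the two tangent bounds add up to 1. *)
Lemma expR_convex_le1 (v theta : R) : 0 <= theta <= 1 ->
  expR (- (theta * v)) <= 1 - theta + theta * expR (- v).
Proof.
move=> /andP[t0 t1].
have h1 := expR_ge1Dx (theta * v); have h2 := expR_ge1Dx (- ((1 - theta) * v)).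
rewrite expRN -div1r ler_pdivrMr ?expR_gt0 //.
rewrite mulrDl -mulrA -expRD (_ : - v + theta * v = - ((1 - theta) * v)); last by ring.
have h3 : (1 - theta) * (1 + theta * v) <= (1 - theta) * expR (theta * v).
  by rewrite ler_wpM2l // subr_ge0.
have h4 : theta * (1 - (1 - theta) * v) <= theta * expR (- ((1 - theta) * v)).
  by rewrite ler_wpM2l.
have h5 : (1 - theta) * (1 + theta * v) + theta * (1 - (1 - theta) * v) = 1 by ring.
lra.
Qed.

(** For [y < 0] the map sending [b] to [exp (alpha y) - exp (b y)] is concave and vanishes at
    [alpha], so its quotient by [b - alpha] does not increase. *)
Lemma bdry_growth alpha b0 b y : alpha < b0 -> b0 <= b ->
  bdry alpha b y <= (b - alpha) / (b0 - alpha) * bdry alpha b0 y.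
Proof.
move=> ab b0b; rewrite /bdry; case: ifP => y0; last by rewrite mulr0.
have c0 : 0 < b0 - alpha by rewrite subr_gt0.
have c1 : 0 < b - alpha by lra.
pose th := (b0 - alpha) / (b - alpha).
have th01 : 0 <= th <= 1.
  by rewrite divr_ge0 ?(ltW c0) ?(ltW c1) //= ler_pdivrMr // mul1r; lra.
have := expR_convex_le1 ((b - alpha) * - y) th01.
have -> : - (th * ((b - alpha) * - y)) = (b0 - alpha) * y.
  by rewrite /th; field; rewrite gt_eqF.
have -> : - ((b - alpha) * - y) = (b - alpha) * y by ring.
move=> H.
have E c : expR (c * y) = expR (alpha * y) * expR ((c - alpha) * y).
  by rewrite -expRD; congr expR; ring.
rewrite (E b) (E b0); set ea := expR (alpha * y).
set p := expR ((b - alpha) * y) in H *; set q := expR ((b0 - alpha) * y) in H *.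
have ea0 : 0 <= ea by exact: expR_ge0.
have -> : ea - ea * p = ea * (1 - p) by ring.
have -> : (b - alpha) / (b0 - alpha) * (ea - ea * q) =
   ea * ((b - alpha) / (b0 - alpha) * (1 - q)) by ring.
rewrite ler_wpM2l //.
have -> : 1 - p = (b - alpha) / (b0 - alpha) * (th * (1 - p)).
  by rewrite /th; field; rewrite !gt_eqF.
by rewrite ler_wpM2l ?(divr_ge0 (ltW c1) (ltW c0)) // mulrBr mulr1; move: (th) H => t H; lra.
Qed.

Lemma measurable_bdry alpha b : measurable_fun setT (bdry alpha b).
Proof.
apply: measurable_fun_ifT.
- exact: measurable_fun_ltr.
- apply: measurable_funB; apply: continuous_measurable_fun;
    exact: continuous_expRM.
- exact: measurable_cst.
Qed.

End Bdry.

(** * Adaptedness of the skeleton *)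

Section AdaptedClosure.
Context {R : realType} {d : measure_display} {Om : measurableType d} {n : nat}.
Variables (X : R -> Om -> R) (J : R -> Om -> option 'I_n).

Lemma adaptedM (t : R) (f g : Om -> R) :
  adapted X J t f -> adapted X J t g -> adapted X J t (fun w => f w * g w).
Proof. by move=> af ag; exact: measurable_funM. Qed.

Lemma adapted_comp (t : R) (phi : R -> R) (f : Om -> R) :
  measurable_fun setT phi -> adapted X J t f -> adapted X J t (fun w => phi (f w)).
Proof. by move=> mphi af; exact: (measurableT_comp mphi af). Qed.

Lemma measurable_le_natr (a : R) : measurable_fun setT (fun y : R => (y <= a)%R%:R : R).
Proof.
rewrite (_ : (fun _ => _) = \1_`]-oo, a]); first exact: measurable_indic.
apply/funext => y; rewrite indicE; congr ((nat_of_bool _)%:R).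
by apply/idP/idP => [h|/set_mem]; first apply/mem_set; rewrite /= in_itv.
Qed.

Lemma measurable_gt_natr (a : R) : measurable_fun setT (fun y : R => (a < y)%R%:R : R).
Proof.
rewrite (_ : (fun _ => _) = \1_`]a, +oo[); first exact: measurable_indic.
apply/funext => y; rewrite indicE; congr ((nat_of_bool _)%:R).
by apply/idP/idP => [h|/set_mem]; first apply/mem_set; rewrite /= in_itv /= andbT.
Qed.

Variables (h a : R).
Hypothesis h_ge0 : 0 <= h.

Lemma grid_ge0 k : 0 <= grid h k.
Proof. by rewrite mulr_ge0. Qed.

Lemma grid_le k l : (k <= l)%N -> grid h k <= grid h l.
Proof. by move=> kl; rewrite ler_wpM2r // ler_nat. Qed.

Lemma adapted_Rsk k : adapted X J (grid h k) (Rsk X h k).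
Proof.
elim: k => [|k IH].
  apply: measurable_maxr; first exact: measurable_cst.
  apply: measurableT_comp => //.
  by apply: adapted_X; rewrite grid0 lexx.
apply: measurable_maxr.
  exact: (adapted_sub (grid_le (leqnSn k)) IH).
apply: measurableT_comp => //.
by apply: adapted_X; rewrite grid_ge0 lexx.
Qed.

Lemma adapted_Ysk k : adapted X J (grid h k) (Ysk X h k).
Proof.
apply: measurable_funD; last exact: adapted_Rsk.
by apply: adapted_X; rewrite grid_ge0 lexx.
Qed.

Lemma adapted_insk k : adapted X J (grid h k) (fun w => (insk X h a k w)%:R).
Proof.
elim: k => [|k IH].
  rewrite (_ : (fun _ => _) = fun w => (Ysk X h 0 w <= a)%R%:R); last first.
    by apply/funext => w; rewrite /= andbT.
  exact: (adapted_comp (phi := fun y => (y <= a)%R%:R) (measurable_le_natr a) (@adapted_Ysk 0)).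
rewrite (_ : (fun _ => _) =
    fun w => (Ysk X h k.+1 w <= a)%R%:R * (insk X h a k w)%:R); last first.
  by apply/funext => w; rewrite /= -natrM mulnb.
apply: adaptedM; last exact: (adapted_sub (grid_le (leqnSn k)) IH).
exact: (adapted_comp (phi := fun y => (y <= a)%R%:R) (measurable_le_natr a) (@adapted_Ysk k.+1)).
Qed.

End AdaptedClosure.

(** * The one-step identity and its sum over the grid *)

Section SkeletonLaw.
Context {R : realType} {d : measure_display} {Om : measurableType d} {n : nat}.
Variables (P : R -> 'I_n -> probability Om R)
          (X : R -> Om -> R) (J : R -> Om -> option 'I_n).
Hypothesis XJ_meas : MAP_measurable X J.
Hypothesis XJ_start : MAP_start_paths P X J.
Hypothesis XJ_markov : markov_additive P X J.
Variable F : R -> 'M[R]_n.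
Hypothesis F_exponent : is_matrix_exponent P X J F.
Variables (x : R) (i : 'I_n) (h a alpha : R).
Hypotheses (h_ge0 : 0 <= h) (a_ge0 : 0 <= a) (alpha_ge0 : 0 <= alpha).
Hypothesis x_itv : 0 <= x <= a.

Let t := grid h.
Let Yk := Ysk X h.
Let ik k w : R := (insk X h a k w)%:R.
Let jk k j : Om -> R := inJ J (t k) j.
Let dX k w : R := X (t k + h) w - X (t k) w.

Definition damp k w : R := expR (- alpha * Rsk X h k w).

Let damp_ge0 k w : 0 <= damp k w. Proof. exact: expR_ge0. Qed.

Let damp_le1 k w : damp k w <= 1.
Proof. by rewrite -expR0 ler_expR mulNr oppr_le0 mulr_ge0 // Rsk_ge0. Qed.

Let ik_ge0 k w : 0 <= ik k w. Proof. exact: ler0n. Qed.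

Let ik_le1 k w : ik k w <= 1. Proof. by rewrite /ik; case: (insk _ _ _ _ _). Qed.

Let t_ge0 k : 0 <= t k. Proof. exact: grid_ge0. Qed.

Let adapted_damp k : adapted X J (t k) (damp k).
Proof.
apply: (adapted_comp (phi := fun y => expR (- alpha * y))); last exact: adapted_Rsk.
apply: continuous_measurable_fun; exact: continuous_expRM.
Qed.

Let ad_meas k f : adapted X J (t k) f -> measurable_fun setT f.
Proof. exact: adapted_measurable. Qed.

Let m_jk k j : measurable_fun setT (jk k j).
Proof. exact: (measurable_inJ XJ_meas). Qed.

Let jk_ge0 k j w : 0 <= jk k j w. Proof. exact: inJ_ge0. Qed.
Let jk_le1 k j w : jk k j w <= 1. Proof. exact: inJ_le1. Qed.

Definition sk_state (phi : R -> R) k j w : R :=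
  ik k w * damp k w * phi (Yk k w) * jk k j w.

Definition sk_V (phi : R -> R) k j : R := \int[P x i]_w sk_state phi k j w.

Let m_state (phi : R -> R) k j : measurable_fun setT phi -> measurable_fun setT (sk_state phi k j).
Proof.
move=> mphi; apply: measurable_funM => //.
apply: (@ad_meas k); apply: adaptedM.
  by apply: adaptedM => //; exact: adapted_insk.
by apply: adapted_comp => //; exact: adapted_Ysk.
Qed.

Let state_le (phi : R -> R) (M : R) k j w : 0 <= M -> (forall y, 0 <= y <= a -> `|phi y| <= M) ->
  `|sk_state phi k j w| <= M.
Proof.
move=> M0 HM; rewrite /sk_state /ik.
case: (boolP (insk X h a k w)) => [ins|_]; last by rewrite !mul0r normr0.
rewrite mul1r !normrM (ger0_norm (damp_ge0 _ _)) (ger0_norm (jk_ge0 _ _ _)).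
rewrite -[leRHS]mulr1 ler_pM ?mulr_ge0 //.
by rewrite -[leRHS]mul1r ler_pM // HM // Ysk_ge0 insk_Ysk.
Qed.

Lemma integrable_state (phi : R -> R) (M : R) k j : measurable_fun setT phi -> 0 <= M ->
  (forall y, 0 <= y <= a -> `|phi y| <= M) ->
  (P x i).-integrable setT (EFin \o sk_state phi k j).
Proof.
move=> mphi M0 HM; apply: (@integrable_bounded _ _ _ _ _ M).
  exact: m_state.
by move=> w; exact: state_le.
Qed.

Let e_ (b : R) : R -> R := fun y => expR (b * y).

Let m_e b : measurable_fun setT (e_ b).
Proof. by apply: continuous_measurable_fun; exact: continuous_expRM. Qed.

Let e_le b : 0 <= b -> forall y, 0 <= y <= a -> `|e_ b y| <= expR (b * a).
Proof.
move=> b0 y /andP[y0 ya]; rewrite ger0_norm ?expR_ge0 // ler_expR.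
by rewrite ler_wpM2l.
Qed.

Let int_state_e b k j : 0 <= b ->
  (P x i).-integrable setT (EFin \o sk_state (e_ b) k j).
Proof.
by move=> b0; apply: (@integrable_state _ (expR (b * a))); rewrite ?expR_ge0 //; exact: e_le.
Qed.

Definition sk_bdry b k j w : R :=
  ik k w * damp k w * bdry alpha b (Yk k w + dX k w) * jk k.+1 j w.

Definition sk_exit b k j w : R :=
  (exitk X h a k w)%:R * damp k.+1 w * e_ b (Yk k.+1 w) * jk k.+1 j w.

Definition sk_A b k j : R := \int[P x i]_w sk_bdry b k j w.
Definition sk_E b k j : R := \int[P x i]_w sk_exit b k j w.

Let m_dX k : measurable_fun setT (dX k).
Proof. by apply: measurable_funB; exact: XJ_meas.1. Qed.

Let m_bdry b k j : measurable_fun setT (sk_bdry b k j).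
Proof.
apply: measurable_funM => //; apply: measurable_funM.
  by apply: (@ad_meas k); apply: adaptedM => //; exact: adapted_insk.
apply: measurableT_comp; first exact: measurable_bdry.
apply: measurable_funD => //; apply: (@ad_meas k); exact: adapted_Ysk.
Qed.

Let int_bdry b k j : 0 <= b -> (P x i).-integrable setT (EFin \o sk_bdry b k j).
Proof.
move=> b0; apply: (@integrable_bounded _ _ _ _ _ 1) => // w.
rewrite !normrM (ger0_norm (damp_ge0 _ _)) (ger0_norm (jk_ge0 _ _ _)).
rewrite (ger0_norm (ik_ge0 _ _)) -[leRHS]mulr1 ler_pM ?mulr_ge0 //.
rewrite -[leRHS]mulr1 ler_pM ?mulr_ge0 ?norm_bdry_le1 //.
by rewrite -[leRHS]mulr1 ler_pM.
Qed.

Lemma m_sk_exit b k j : measurable_fun setT (sk_exit b k j).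
Proof.
rewrite (_ : sk_exit b k j = fun w => ik k w * (a < Yk k.+1 w)%R%:R * damp k.+1 w *
    e_ b (Yk k.+1 w) * jk k.+1 j w); last first.
  by apply/funext => w; rewrite /sk_exit /exitk /ik -natrM mulnb.
have aY : adapted X J (t k.+1) (Yk k.+1) by exact: adapted_Ysk.
apply: measurable_funM => //; apply: (@ad_meas k.+1).
apply: adaptedM; last exact: (adapted_comp (phi := e_ b) (m_e b) aY).
apply: adaptedM => //; apply: adaptedM.
  apply: (adapted_sub (grid_le h_ge0 (leqnSn k))); exact: adapted_insk.
exact: (adapted_comp (phi := fun y => (a < y)%R%:R) (measurable_gt_natr a) aY).
Qed.

(** Let [y] be the level reached before reflection. If [y >= 0] the barrier is not felt. If [y < 0]
    the regulator grows by [- y] and the new level is 0, so [exp (alpha y)] stands where free motion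
    gives [exp (b y)]; [bdry] is this difference. *)
Let step w b k j :
  ik k w * damp k w * e_ b (Yk k w) * (expR (b * dX k w) * jk k.+1 j w) +
  sk_bdry b k j w = sk_state (e_ b) k.+1 j w + sk_exit b k j w.
Proof.
rewrite /sk_bdry /sk_state /sk_exit /exitk /ik inskS.
case: (insk X h a k w); last by rewrite /= !mul0r !addr0.
rewrite !andTb !mul1r.
have -> : damp k w * e_ b (Yk k w) * (expR (b * dX k w) * jk k.+1 j w) +
   damp k w * bdry alpha b (Yk k w + dX k w) * jk k.+1 j w =
   damp k.+1 w * e_ b (Yk k.+1 w) * jk k.+1 j w.
  set u := jk _ _ _.
  rewrite /e_ /damp /Yk YskS RskS -/(t k) gridS -/(t k) -/(dX k w) -/(Yk k w).
  set y := Yk k w + dX k w; set r := Rsk X h k w.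
  have -> : expR (- alpha * r) * expR (b * Yk k w) * (expR (b * dX k w) * u) =
     expR (- alpha * r) * expR (b * y) * u.
    have -> : b * y = b * Yk k w + b * dX k w by rewrite /y; ring.
    by rewrite expRD; ring.
  rewrite /bdry; have [y0|y0] : y < 0 \/ 0 <= y by case: (ltP y 0); [left|right].
    rewrite y0.
    have -> : Num.max (- y) 0 = - y by apply/max_idPl; rewrite oppr_ge0 ltW.
    have -> : Num.max y 0 = 0 by apply/max_idPr; rewrite ltW.
    have -> : - alpha * (r - y) = - alpha * r + alpha * y by ring.
    by rewrite mulr0 expR0 expRD; ring.
  rewrite ltNge y0 /=; have -> : Num.max (- y) 0 = 0 by apply/max_idPr; rewrite oppr_le0.
  have -> : Num.max y 0 = y by apply/max_idPl.
  by rewrite addr0; ring.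
by rewrite -/(Yk k.+1 w); case: leP => _; rewrite ?mul1r ?mul0r ?addr0 ?add0r.
Qed.

Let kick_bounds b k w : 0 <= b ->
  0 <= ik k w * damp k w * e_ b (Yk k w) <= expR (b * a).
Proof.
move=> b0; rewrite !mulr_ge0 ?expR_ge0 //= /ik.
case: (boolP (insk X h a k w)) => [ins|_]; last by rewrite !mul0r expR_ge0.
rewrite mul1r -[leRHS]mul1r ler_pM ?expR_ge0 // ler_expR ler_wpM2l //.
exact: insk_Ysk.
Qed.

Let adapted_kick b k : adapted X J (t k) (fun w => ik k w * damp k w * e_ b (Yk k w)).
Proof.
apply: adaptedM; first by apply: adaptedM => //; exact: adapted_insk.
by apply: adapted_comp => //; exact: adapted_Ysk.
Qed.

Lemma sk_step b k j : 0 <= b ->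
  [/\ \sum_l sk_V (e_ b) k l * expmx (h *: F b) l j + sk_A b k j =
      sk_V (e_ b) k.+1 j + sk_E b k j &
      (P x i).-integrable setT (EFin \o sk_exit b k j)].
Proof.
move=> b0.
have [ik1 E1] := @markov_exp_sum _ _ _ _ P X J XJ_meas XJ_start XJ_markov F
  F_exponent x i (t k) h b _ j _ (t_ge0 k) h_ge0 b0 (@adapted_kick b k)
  (fun w => kick_bounds k w b0).
pose f1 w := ik k w * damp k w * e_ b (Yk k w) * (expR (b * dX k w) * jk k.+1 j w).
have f1E : f1 = fun w => ik k w * damp k w * e_ b (Yk k w) *
    (expR (b * (X (t k + h) w - X (t k) w)) * inJ J (t k + h) j w).
  by apply/funext => w; rewrite /f1 /jk /t gridS.
have if1 : (P x i).-integrable setT (EFin \o f1) by rewrite f1E.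
have if2 := int_bdry k j b0.
have i3 := int_state_e k.+1 j b0.
(* The level after an exit step is unbounded, so integrability is read off the pathwise identity,
   whose other terms are integrable. *)
have iE : (P x i).-integrable setT (EFin \o sk_exit b k j).
  have := integrable_add (integrable_add if1 if2) (integrable_mull (-1) measurableT i3).
  apply: eq_integrable => // w _ /=; congr EFin; rewrite /f1 step; ring.
split => //.
have -> : sk_V (e_ b) k.+1 j + sk_E b k j =
    \int[P x i]_w (f1 w + sk_bdry b k j w).
  rewrite /sk_V /sk_E -(RintegralD measurableT i3 iE).
  by apply: eq_Rintegral => w _; rewrite /f1 step.
by rewrite (RintegralD measurableT if1 if2) f1E E1.
Qed.

Lemma sk_V0 (phi : R -> R) j : measurable_fun setT phi ->
  sk_V phi 0 j = phi x * (i == j)%:R.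
Proof.
move=> mphi; rewrite -[RHS](Rintegral_prob_cst (P x i)).
apply: ae_eq_Rintegral; [exact: m_state|exact: measurable_cst|].
apply: filterS (X0_ae XJ_start x i) => w [X0 J0].
have /andP[x0 xa] := x_itv.
have R0 : Rsk X h 0 w = 0 by rewrite /= grid0 X0; apply/max_idPl; rewrite oppr_le0.
have Y0 : Yk 0 w = x by rewrite /Yk /Ysk R0 grid0 X0 addr0.
rewrite /sk_state /ik /damp R0 Y0 mulr0 expR0 mulr1 /= -/(Yk 0 w) Y0 xa mul1r.
by rewrite /jk /inJ /t grid0 J0; congr (_ * (nat_of_bool _)%:R).
Qed.

(** Subtracting the identity matrix from the one-step kernel makes [sk_step] telescope. *)
Lemma sk_identity b K j : 0 <= b ->
  expR (b * x) * (i == j)%:R +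
  \sum_(k < K) (\sum_l sk_V (e_ b) k l * (expmx (h *: F b) l j - (l == j)%:R) + sk_A b k j)
  = sk_V (e_ b) K j + \sum_(k < K) sk_E b k j.
Proof.
move=> b0; elim: K => [|K IH]; first by rewrite !big_ord0 !addr0 sk_V0.
rewrite !big_ord_recr /= addrA IH.
have [E _] := sk_step K j b0.
under eq_bigr do rewrite mulrBr; rewrite sumrB.
have -> : \sum_l sk_V (e_ b) K l * (l == j)%:R = sk_V (e_ b) K j.
  rewrite (bigD1 j) //= eqxx mulr1 big1 ?addr0 // => l /negPf ->.
  by rewrite mulr0.
have E' : \sum_l sk_V (e_ b) K l * expmx (h *: F b) l j =
    sk_V (e_ b) K.+1 j + sk_E b K j - sk_A b K j by rewrite -E addrK.
rewrite E'; ring.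
Qed.

Lemma sk_A_ge0 b k j : alpha <= b -> 0 <= sk_A b k j.
Proof.
by move=> ab; apply: Rintegral_ge0 => w _; rewrite !mulr_ge0 // bdry_ge0.
Qed.

Lemma sk_A_same k j : sk_A alpha k j = 0.
Proof.
rewrite -[RHS](Rintegral_prob_cst (P x i)); apply: eq_Rintegral => w _.
by rewrite /sk_bdry bdry_same mulr0 mul0r.
Qed.

Lemma sk_A_growth b0 b k j : alpha < b0 -> b0 <= b ->
  sk_A b k j <= (b - alpha) / (b0 - alpha) * sk_A b0 k j.
Proof.
move=> ab b0b.
have al0 := alpha_ge0; have b0_ge0 : 0 <= b0 by lra.
have b_ge0 : 0 <= b by lra.
rewrite /sk_A -RintegralZl //; last exact: int_bdry.
apply: le_Rintegral => //; [exact: int_bdry| |].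
  by apply: integrable_mull => //; exact: int_bdry.
move=> w _; rewrite /sk_bdry.
have := bdry_growth (Yk k w + dX k w) ab b0b.
set u := bdry _ b _; set v := bdry _ b0 _ => H.
have -> : (b - alpha) / (b0 - alpha) * (ik k w * damp k w * v * jk k.+1 j w) =
   ik k w * damp k w * ((b - alpha) / (b0 - alpha) * v) * jk k.+1 j w by ring.
by rewrite ler_wpM2r // ler_wpM2l // mulr_ge0.
Qed.

End SkeletonLaw.

(** * Dyadic meshes *)

Section Dyadic.
Context {R : realType}.

Definition dyad (m : nat) : R := (2 ^+ m)^-1.

Lemma dyad_gt0 m : 0 < dyad m.
Proof. by rewrite invr_gt0 exprn_gt0. Qed.

Lemma dyad_ge0 m : 0 <= dyad m.
Proof. exact/ltW/dyad_gt0. Qed.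

Lemma dyadD m q : dyad m = (2 ^ q)%:R * dyad (m + q).
Proof.
by rewrite /dyad exprD invfM mulrCA natrX divff ?mulr1 // expf_eq0 pnatr_eq0 andbF.
Qed.

Lemma grid_dyadD m q k : grid (dyad m) k = grid (dyad (m + q)) (k * 2 ^ q).
Proof. by rewrite /grid (dyadD m q) natrM mulrA. Qed.

Lemma grid_dyad_le m m' k : (m <= m')%N ->
  grid (dyad m) k = grid (dyad m') (k * 2 ^ (m' - m)).
Proof. by move=> mm'; rewrite (grid_dyadD m (m' - m)) subnKC. Qed.

Lemma dyad_le m m' : (m <= m')%N -> dyad m' <= dyad m.
Proof.
by move=> mm'; rewrite lef_pV2 ?posrE ?exprn_gt0 // ler_eXn2l // ltr1n.
Qed.

Lemma dyad_le1 m : dyad m <= 1.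
Proof. by rewrite -[leRHS](_ : dyad 0 = 1) ?dyad_le // /dyad expr0 invr1. Qed.

Lemma dyad_small (e : R) : 0 < e -> exists m, forall m', (m <= m')%N -> dyad m' < e.
Proof.
move=> e0; exists (Num.truncn e^-1).+1 => m' mm'.
rewrite -[e]invrK ltf_pV2 ?posrE ?exprn_gt0 ?invr_gt0 //.
apply: (lt_trans (truncnS_gt _)).
apply: (@le_lt_trans _ _ m'%:R); first by rewrite ler_nat.
by rewrite -natrX ltr_nat ltn_expl.
Qed.

Lemma dyad_cvg0 : dyad @ \oo --> 0.
Proof.
apply/cvgr0Pnorm_lt => e e0; have [m Hm] := dyad_small e0.
by exists m => // m' /= mm'; rewrite ger0_norm ?dyad_ge0 // Hm.
Qed.

Lemma dyad_between (u v : R) : 0 <= u -> u < v -> exists m, forall m', (m <= m')%N ->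
  exists k, u < grid (dyad m') k < v.
Proof.
move=> u0 uv; have uv0 : 0 < v - u by rewrite subr_gt0.
have [m Hm] := dyad_small uv0; exists m => m' mm'.
have d0 := dyad_gt0 m'; have d1 := Hm _ mm'.
exists (Num.truncn (u / dyad m')).+1; rewrite /grid.
rewrite -ltr_pdivrMr // truncnS_gt /=.
have : (Num.truncn (u / dyad m'))%:R * dyad m' <= u.
  by rewrite -ler_pdivlMr // truncn_le // divr_ge0 // ltW.
by rewrite -natr1 mulrDl mul1r; lra.
Qed.

End Dyadic.

(** * Upward movement within a state and growth of the diagonal of [F] *)

Section Rising.
Context {R : realType} {d : measure_display} {Om : measurableType d} {n : nat}.
Variables (P : R -> 'I_n -> probability Om R)
          (X : R -> Om -> R) (J : R -> Om -> option 'I_n).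
Hypothesis XJ_meas : MAP_measurable X J.
Hypothesis XJ_start : MAP_start_paths P X J.
Hypothesis XJ_markov : markov_additive P X J.
Hypothesis not_nonincr : forall i, ~ {ae P 0 i, forall w, nonincr_in_state X J i w}.

(** A countable, hence measurable, substitute for the failure of [nonincr_in_state]: [J] is
    inspected at dyadic times of all meshes. *)
Definition rise (i : 'I_n) (m k l : nat) (delta : R) : set Om :=
  (\bigcap_q \bigcap_(r in [set r | grid (dyad q : R) r <= grid (dyad m) l])
     [set w | J (grid (dyad q) r) w = Some i]) `&`
  [set w | delta < X (grid (dyad m) l) w - X (grid (dyad m) k) w].

Lemma measurable_rise i m k l delta : measurable (rise i m k l delta).
Proof.
apply: measurableI.
  apply: bigcap_measurable; first by exists 0%N.
  move=> q _; apply: bigcap_measurable.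
    by exists 0%N => /=; rewrite grid0 grid_ge0 // dyad_ge0.
  by move=> r _; exact: XJ_meas.2.
rewrite (_ : [set _ | _] = (fun w => X (grid (dyad m) l) w - X (grid (dyad m) k) w)
    @^-1` `]delta, +oo[); last first.
  by apply/seteqP; split => w /=; rewrite in_itv /= andbT.
rewrite -[X in measurable X]setTI.
by apply: measurable_funB => //; exact: XJ_meas.1.
Qed.

(** If [X s < X t] while [J] stays in [i], right-continuity moves both times to dyadic points
    slightly to the right and loses at most half of the gap, which is [4 eta]. *)
Lemma nonincr_of_not_rise i w : good_path X J w ->
  (forall m k l q, (k < l)%N -> ~ rise i m k l (q.+1%:R^-1) w) ->
  nonincr_in_state X J i w.
Proof.
move=> [_ Jright Xright _ _] nr s t /andP[s0 st] Ji.
rewrite leNgt; apply/negP => Xst.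
have t0 : 0 <= t := le_trans s0 st.
have slt : s < t.
  by rewrite lt_neqAle st andbT; apply/eqP => E; rewrite E ltxx in Xst.
pose eta := (X t w - X s w) / 4.
have eta0 : 0 < eta by rewrite divr_gt0 // subr_gt0.
have Js : J s w <> None by rewrite Ji // s0.
have Jt : J t w <> None by rewrite Ji // lexx t0.
have [e1 /= e10 H1] : \forall u \near t^'+, J u w = J t w by exact: Jright.
have [e2 /= e20 H2] : \forall u \near t^'+, X t w - eta < X u w.
  by apply: (cvgr_gt _ (Xright t t0 Jt)); rewrite gtrBl.
have [e3 /= e30 H3] : \forall u \near s^'+, X u w < X s w + eta.
  by apply: (cvgr_lt _ (Xright s s0 Js)); rewrite ltrDl.
have [m1 Hm1] : exists m, forall m', (m <= m')%N ->
    exists k, s < grid (dyad m') k < Num.min t (s + e3).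
  by apply: dyad_between => //; rewrite lt_min slt ltrDl.
have [m2 Hm2] : exists m, forall m', (m <= m')%N ->
    exists k, t < grid (dyad m') k < t + Num.min e1 e2.
  by apply: dyad_between => //; rewrite ltrDl lt_min e10.
pose m := maxn m1 m2.
have [k /andP[sk]] := Hm1 m (leq_maxl _ _); rewrite lt_min => /andP[kt ke3].
have [l /andP[tl le12]] := Hm2 m (leq_maxr _ _).
have le1 : grid (dyad m) l < t + e1.
  by apply: lt_le_trans le12 _; rewrite lerD2l ge_min lexx.
have le2 : grid (dyad m) l < t + e2.
  by apply: lt_le_trans le12 _; rewrite lerD2l ge_min lexx orbT.
have kl : (k < l)%N.
  rewrite ltnNge; apply/negP => lk; have := grid_le (dyad_ge0 m : 0 <= dyad m :> R) lk; lra.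
have in_ball (u v e : R) : u < v -> v < u + e -> ball u e v.
  by move=> uv ve; rewrite -ball_normE /= ltr0_norm ?subr_lt0 //; lra.
have Xl : X t w - eta < X (grid (dyad m) l) w.
  by apply: H2 => //; exact: in_ball.
have Xk : X (grid (dyad m) k) w < X s w + eta.
  by apply: H3 => //; exact: in_ball.
pose q := Num.truncn eta^-1.
have qeta : q.+1%:R^-1 < eta.
  by rewrite -[eta]invrK ltf_pV2 ?posrE ?invr_gt0 // truncnS_gt.
apply: (nr m k l q kl); split => [p _ r /= rl|/=].
  case: (leP (grid (dyad p) r) t) => rt.
    by apply: Ji; rewrite rt grid_ge0 // dyad_ge0.
  rewrite (H1 (grid (dyad p) r)) ?Ji ?lexx ?t0 //.
  by apply: in_ball => //; apply: le_lt_trans le1.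
have e4 : X t w - X s w = 4 * eta by rewrite /eta; field.
apply: (lt_trans qeta); move: (eta) eta0 Xl Xk e4 => eta'.
by set x1 := X (grid _ l) w; set x2 := X (grid _ k) w; lra.
Qed.

Lemma rise_gt0 i : exists m k l : nat, exists delta : R,
  [/\ (k < l)%N, 0 < delta & (0 < P 0 i (rise i m k l delta))%E].
Proof.
apply: contrapT => H; apply: (not_nonincr (i := i)).
have Z m k l q : (k < l)%N -> P 0 i (rise i m k l (q.+1%:R^-1)) = 0%E.
  move=> kl; apply/eqP; rewrite eq_le measure_ge0 andbT leNgt; apply/negP => p.
  by apply: H; exists m, k, l, (q.+1%:R^-1); split => //; rewrite invr_gt0.
have A : {ae P 0 i, forall w, forall m k l q, (k < l)%N ->
    ~ rise i m k l (q.+1%:R^-1) w}.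
  apply: ae_foralln => m; apply: ae_foralln => k; apply: ae_foralln => l.
  apply: ae_foralln => q; case: (boolP (k < l)%N) => kl; last first.
    by apply: aeW => w.
  exists (rise i m k l (q.+1%:R^-1)); split.
  - exact: measurable_rise.
  - exact: Z.
  - by move=> w /=; apply: contra_notP => nr _.
apply: filterS2 (good_ae XJ_start 0 i) A => w gw Aw.
exact: nonincr_of_not_rise.
Qed.

Variable F : R -> 'M[R]_n.
Hypothesis F_exponent : is_matrix_exponent P X J F.

(** Asking for state [i] at every grid time makes the expectation a power of the single entry
    [expmx (h *: F b) i i] rather than an entry of a matrix power. *)
Let chain (b h : R) (i : 'I_n) (K : nat) : nat -> Om -> R :=
  fix chain r w := if r is r'.+1 then
    chain r' w * (expR (b * (X (grid h (K + r') + h) w - X (grid h (K + r')) w)) *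
      inJ J (grid h (K + r') + h) i w)
  else inJ J (grid h K) i w.

Let chain_ge0 b h i K r w : 0 <= chain b h i K r w.
Proof.
elim: r => [|r IH] /=; first exact: inJ_ge0.
by rewrite !mulr_ge0 ?expR_ge0 ?inJ_ge0.
Qed.

Let chain_inJ b h i K r w :
  chain b h i K r w * inJ J (grid h (K + r)) i w = chain b h i K r w.
Proof.
have sq t : inJ J t i w * inJ J t i w = inJ J t i w.
  by rewrite /inJ; case: eqP; rewrite ?mulr1 ?mulr0.
case: r => [|r] /=; first by rewrite addn0 sq.
by rewrite addnS gridS -!mulrA sq.
Qed.

Let adapted_chain b h i K r : 0 <= h -> adapted X J (grid h (K + r)) (chain b h i K r).
Proof.
move=> h0; elim: r => [|r IH] /=.
  by apply: adapted_inJ; rewrite addn0 grid_ge0 // lexx.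
have le1 : grid h (K + r) <= grid h (K + r.+1) by rewrite grid_le // addnS.
apply: adaptedM; first exact: adapted_sub le1 IH.
have e1 : grid h (K + r) + h = grid h (K + r.+1) by rewrite addnS gridS.
rewrite e1; apply: adaptedM; last by apply: adapted_inJ; rewrite grid_ge0 // lexx.
apply: (adapted_comp (phi := fun y => expR (b * y))).
  by apply: continuous_measurable_fun; exact: continuous_expRM.
by apply: measurable_funB; apply: adapted_X; rewrite grid_ge0 //= lexx.
Qed.

Let integral_chain b h i K r : 0 <= b -> 0 <= h ->
  (\int[P 0 i]_w (chain b h i K r w)%:E =
   \int[P 0 i]_w (inJ J (grid h K) i w)%:E * ((expmx (h *: F b) i i) ^+ r)%:E)%E.
Proof.
move=> b0 h0; elim: r => [|r IH]; first by rewrite expr0 mule1.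
under eq_integral => w _ do rewrite /= -chain_inJ.
rewrite (@markov_ge0 _ _ _ _ P X J XJ_meas XJ_markov 0 i (grid h (K + r)) h i i
  (chain b h i K r) (fun y => expR (b * y))) //; last 3 first.
- exact: grid_ge0.
- exact: adapted_chain.
- by apply: continuous_measurable_fun; exact: continuous_expRM.
rewrite (expX_inJ XJ_meas XJ_start F_exponent) //.
under eq_integral => w _ do rewrite chain_inJ.
by rewrite IH -muleA -EFinM -exprSr.
Qed.

Let chain_rise b h i K r w : (forall q, (q <= K + r)%N -> J (grid h q) w = Some i) ->
  chain b h i K r w = expR (b * (X (grid h (K + r)) w - X (grid h K) w)).
Proof.
elim: r => [|r IH] H /=.
  by rewrite addn0 subrr mulr0 expR0 /inJ H ?leq_addr // eqxx.
rewrite IH; last by move=> q qr; apply: H; rewrite addnS ltnW.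
rewrite -gridS -addnS /inJ H // eqxx mulr1 -expRD; congr expR; ring.
Qed.

(** On [rise] the chain equals the exponential of the whole increment, at least [exp (b delta)];
    [integral_chain] bounds its expectation by the power on the right. *)
Let expmx_pow_ge i m k l delta p b m' : (k < l)%N -> 0 < delta ->
  (p%:E <= P 0 i (rise i m k l delta))%E -> 0 <= b -> (m <= m')%N ->
  p * expR (b * delta) <=
    (expmx (dyad m' *: F b) i i) ^+ ((l - k) * 2 ^ (m' - m)).
Proof.
move=> kl d0 pP b0 mm'; set h := dyad m'; have h0 : 0 <= h by exact: dyad_ge0.
set K := (k * 2 ^ (m' - m))%N; set r := ((l - k) * 2 ^ (m' - m))%N.
have KrE : (K + r = l * 2 ^ (m' - m))%N by rewrite /K /r -mulnDl subnKC // ltnW.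
rewrite -lee_fin; apply: (@le_trans _ _ (\int[P 0 i]_w (chain b h i K r w)%:E)%E).
  have mE := measurable_rise i m k l delta.
  apply: (@le_trans _ _ (\int[P 0 i]_(w in rise i m k l delta) (expR (b * delta))%:E)%E).
    by rewrite integral_cst //= EFinM muleC lee_wpmul2l // lee_fin expR_ge0.
  rewrite integral_mkcond; apply: ge0_le_integral => //.
  - by move=> w _; rewrite patchE; case: ifP => // _; rewrite lee_fin expR_ge0.
  - by apply/(measurable_restrict _ mE) => //; exact: measurable_cst.
  - apply/measurable_EFinP.
    apply: (adapted_measurable XJ_meas); exact: adapted_chain.
  - move=> w _; rewrite patchE; case: ifPn; last by rewrite lee_fin chain_ge0.
    rewrite inE lee_fin => -[Ew dw].
    have gl : grid (dyad m) l = grid h (K + r) by rewrite KrE (grid_dyad_le _ mm').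
    have gk : grid (dyad m) k = grid h K by rewrite (grid_dyad_le _ mm').
    rewrite chain_rise.
      by rewrite ler_expR ler_wpM2l // ltW // -gl -gk.
    move=> q qKr; apply: (Ew m' Logic.I q) => /=.
    by rewrite gl; exact: grid_le.
rewrite integral_chain // -[leRHS]mul1e lee_wpmul2r //.
  by rewrite lee_fin exprn_ge0 // (expmx_ge0 XJ_meas XJ_start F_exponent).
rewrite -(@probability_setT _ _ _ (P 0 i)) -[leRHS]mul1e -integral_cst //.
apply: ge0_le_integral => //.
- by move=> w _; rewrite lee_fin inJ_ge0.
- by apply/measurable_EFinP; exact: (measurable_inJ XJ_meas).
- by move=> w _; rewrite lee_fin inJ_le1.
Qed.

Lemma expmx_deriv b l j : 0 <= b ->
  (fun m => (expmx (dyad m *: F b) l j - (l == j)%:R) / dyad m) @ \oo --> F b l j.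
Proof.
move=> b0; have [C [C0 HC]] := expmx_first_order (F b).
have H m : `|(expmx (dyad m *: F b) l j - (l == j)%:R) / dyad m - F b l j| <= C * dyad m.
  have d0 := dyad_gt0 m : 0 < dyad m :> R.
  have := HC (dyad m); rewrite dyad_ge0 dyad_le1 => /(_ isT l j).
  have -> : expmx (dyad m *: F b) l j - ((l == j)%:R + dyad m * F b l j) =
     ((expmx (dyad m *: F b) l j - (l == j)%:R) / dyad m - F b l j) * dyad m.
    by field; rewrite gt_eqF.
  by rewrite normrM (gtr0_norm d0) expr2 mulrA ler_pM2r.
have z : (fun m => C * dyad m) @ \oo --> 0.
  by rewrite -[X in _ --> X](mulr0 C); apply: cvgMr; exact: dyad_cvg0.
apply/cvgrPdist_le => e e0.
have : \forall m \near \oo, C * dyad m < e by apply: (cvgr_lt (0 : R) z).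
apply: filterS => m Cm; rewrite distrC; exact: le_trans (H m) (ltW Cm).
Qed.

Lemma F_offdiag_ge0 b l j : 0 <= b -> l != j -> 0 <= F b l j.
Proof.
move=> b0 lj; apply: (cvgr_to_ge (@expmx_deriv b l j b0)); apply: nearW => m.
rewrite (negbTE lj) subr0 divr_ge0 ?dyad_ge0 //.
by rewrite (expmx_ge0 XJ_meas XJ_start F_exponent) // dyad_ge0.
Qed.

(** With [G] the diagonal entry of the one-step kernel, [G <= exp (G - 1)], so [expmx_pow_ge] gives
    [ln p + b delta <= r (G - 1)]. Here [r] is [T] divided by the mesh, hence the right side tends
    to [T * F b i i]. *)
Lemma F_diag_growth i : exists c0 c1 : R, 0 < c1 /\
  forall b : R, 0 <= b -> c0 + c1 * b <= F b i i.
Proof.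
have [m [k [l [delta [kl d0 P0]]]]] := rise_gt0 i.
pose p := fine (P 0 i (rise i m k l delta)).
have pE : P 0 i (rise i m k l delta) = p%:E by rewrite fineK // fin_num_measure //; exact: measurable_rise.
have p0 : 0 < p by rewrite -lte_fin -pE.
pose T : R := (l - k)%:R * dyad m.
have T0 : 0 < T by rewrite mulr_gt0 ?dyad_gt0 // ltr0n subn_gt0.
exists (ln p / T), (delta / T); split; first by rewrite divr_gt0.
move=> b b0.
have key m' : (m <= m')%N -> (ln p + delta * b) / T <=
    (expmx (dyad m' *: F b) i i - (i == i)%:R) / dyad m'.
  move=> mm'; have := @expmx_pow_ge i m k l delta p b m' kl d0 _ b0 mm'.
  rewrite pE lexx => /(_ isT).
  set G := expmx _ i i; set r := ((l - k) * _)%N => H.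
  have G0 : 0 <= G by rewrite (expmx_ge0 XJ_meas XJ_start F_exponent) // dyad_ge0.
  have Ge : G <= expR (G - 1) by apply: le_trans (expR_ge1Dx _); rewrite addrC subrK.
  have : p * expR (b * delta) <= expR (G - 1) ^+ r.
    by apply: (le_trans H); rewrite lerXn2r // nnegrE ?expR_ge0.
  rewrite -expRM_natl -{1}(lnK p0) -expRD ler_expR => H2.
  have TE : T = r%:R * dyad m'.
    by rewrite /T /r natrM -mulrA -(subnKC mm') addKn -dyadD.
  rewrite eqxx ler_pdivrMr // TE.
  have -> : (G - 1) / dyad m' * (r%:R * dyad m') = r%:R * (G - 1).
    by field; rewrite gt_eqF ?dyad_gt0.
  by rewrite [delta * b]mulrC.
have -> : ln p / T + delta / T * b = (ln p + delta * b) / T by field; rewrite gt_eqF.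
apply: (cvgr_to_ge (@expmx_deriv b i i b0)).
by exists m => // m' /= mm'; exact: key.
Qed.

(** Rises of size [delta] can be concatenated by the Markov additive property, because each block
    begins and ends in state [i]. *)
Lemma rise_iter i (a : R) : exists m N : nat,
  (0 < P 0 i [set w | (a < X (grid (dyad m) N) w - X 0 w)%R /\
                      J (grid (dyad m) N) w = Some i])%E.
Proof.
have [m [k [l [delta [kl d0 P0]]]]] := rise_gt0 i.
have h0 : 0 <= dyad m :> R by exact: dyad_ge0.
pose N := (l - k)%N; pose g := grid (dyad m : R).
pose A r := [set w | r%:R * delta < X (g (r * N)%N) w - X 0 w /\
                     J (g (r * N)%N) w = Some i].
have mX u v c : measurable [set w | c < X u w - X v w].
  rewrite (_ : [set _ | _] = (fun w => X u w - X v w) @^-1` `]c, +oo[); last first.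
    by apply/seteqP; split => w /=; rewrite in_itv /= andbT.
  rewrite -[X in measurable X]setTI.
  by apply: measurable_funB => //; exact: XJ_meas.1.
have mJ u j : measurable [set w | J u w = Some j] by exact: XJ_meas.2.
have mA r : measurable (A r) by apply: measurableI; [exact: mX|exact: mJ].
have gl : g l = g k + g N by rewrite /g -gridD subnKC // ltnW.
have itvA : [set w | `]delta, +oo[%classic (X (grid (dyad m) N) w - X 0 w) /\
    J (grid (dyad m) N) w = Some i] = A 1%N.
  by rewrite /A mul1r mul1n; apply/seteqP; split => w /=; rewrite in_itv /= andbT.
(* The rise takes place between the indices [k] and [l]; the Markov property at [g k] moves its
   start to time 0. *)
have A1 : (0 < P 0 i (A 1%N))%E.
  have fT : natF X J (g k) setT.
    by rewrite -(setD0 setT); apply: sigma_algebraCD; exact: sigma_algebra0.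
  have mB : measurable (`]delta, +oo[%classic : set R) by [].
  have := XJ_markov 0 i i i (grid_ge0 h0 k) (grid_ge0 h0 N) fT mB.
  set U := (_ `&` _ `&` _) => E.
  have US : rise i m k l delta `<=` U.
    move=> w [Ew dw]; split; first split => //=.
      by apply: (Ew m Logic.I k) => /=; rewrite grid_le // ltnW.
    split; first by rewrite /= in_itv /= andbT -/g -gl.
    by rewrite -/g -gl; apply: (Ew m Logic.I l) => /=; rewrite lexx.
  have mU : measurable U.
    apply: measurableI; first by apply: measurableI => //; exact: mJ.
    rewrite (_ : [set _ | _] = [set w | delta < X (g k + g N) w - X (g k) w] `&`
      [set w | J (g k + g N) w = Some i]); first by apply: measurableI; [exact: mX|exact: mJ].
    by apply/seteqP; split => w /=; rewrite in_itv /= andbT.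
  have : (0 < P 0 i U)%E.
    apply: (lt_le_trans P0); apply: le_measure => //; rewrite inE //.
    exact: measurable_rise.
  rewrite E => H; rewrite lt0e measure_ge0 andbT; apply/eqP => Z.
  move: H; rewrite itvA Z mule0 ltxx //.
have Ar r : (0 < P 0 i (A r.+1))%E.
  elim: r => [|r IH]; first exact: A1.
  have aA : natF X J (g (r.+1 * N)%N) [set w | r.+1%:R * delta < X (g (r.+1 * N)%N) w - X 0 w].
    have := adapted_X (X := X) (J := J) (t := g (r.+1 * N)%N) (u := g (r.+1 * N)%N).
    have := adapted_X (X := X) (J := J) (t := g (r.+1 * N)%N) (u := 0).
    rewrite !lexx grid_ge0 //= => /(_ isT) a0 /(_ isT) a1.
    have := measurable_funB a1 a0.
    move=> /(_ measurableT `]r.+1%:R * delta, +oo[%classic (measurable_itv _)).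
    rewrite setTI; congr (natF X J _ _).
    by apply/seteqP; split => w /=; rewrite in_itv /= andbT.
  have mB : measurable (`]delta, +oo[%classic : set R) by [].
  have := XJ_markov 0 i i i (grid_ge0 h0 (r.+1 * N)%N) (grid_ge0 h0 N) aA mB.
  rewrite -/g -/(g (r.+1 * N)%N) -gridD.
  rewrite (_ : (r.+1 * N + N = r.+2 * N)%N); last by rewrite [in RHS]mulSn addnC.
  set U := (_ `&` _ `&` _) => E.
  have mU : measurable U.
    apply: measurableI; first by apply: measurableI; [exact: mX|exact: mJ].
    rewrite (_ : [set _ | _] = [set w | delta < X (g (r.+2 * N)%N) w - X (g (r.+1 * N)%N) w] `&`
      [set w | J (g (r.+2 * N)%N) w = Some i]); first by apply: measurableI; [exact: mX|exact: mJ].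
    by apply/seteqP; split => w /=; rewrite in_itv /= andbT.
  apply: (@lt_le_trans _ _ (P 0 i U)); last first.
    apply: le_measure => //; rewrite ?inE //.
    move=> w [[/= h1 h2] []]; rewrite /= in_itv /= andbT => h3 h4; split => //.
    rewrite (_ : r.+2%:R * delta = r.+1%:R * delta + delta); last first.
      by rewrite -[r.+2%:R]natr1 mulrDl mul1r.
    have h3' : delta < X (g (r.+2 * N)%N) w - X (g (r.+1 * N)%N) w by [].
    by move: h1 h3'; set x2 := X (g (r.+2 * N)%N) w; set x1 := X (g (r.+1 * N)%N) w; lra.
  by rewrite E itvA mule_gt0.
pose r := Num.truncn (`|a| / delta).
exists m, (r.+1 * N)%N.
apply: (lt_le_trans (Ar r)); apply: le_measure; rewrite ?inE //.
  by apply: measurableI; [exact: mX|exact: mJ].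
move=> w [/= h1 h2]; split => //; apply: le_lt_trans h1.
apply: (le_trans (ler_norm a)).
by rewrite -ler_pdivrMr // ltW // truncnS_gt.
Qed.

End Rising.

(** * Survival probabilities and exit moments of the skeleton *)

Lemma sum_shift_telescope (R : realType) (s : nat -> R) (K r : nat) :
  (forall k, 0 <= s k) -> \sum_(k < K) (s k - s (k + r)%N) <= \sum_(k < r) s k.
Proof.
move=> s0; elim: r => [|r IH].
  by rewrite big_ord0 big1 // => k _; rewrite addn0 subrr.
have -> : \sum_(k < K) (s k - s (k + r.+1)%N) =
    \sum_(k < K) (s k - s (k + r)%N) + (s r - s (K + r)%N).
  elim: K {IH} => [|K IHK]; first by rewrite !big_ord0 add0n subrr addr0.
  by rewrite !big_ord_recr /= IHK addnS; ring.
rewrite big_ord_recr /= lerD // gerBl //.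
Qed.

Lemma measurable_set_gt (R : realType) (d : measure_display) (T : measurableType d)
    (f : T -> R) (c : R) : measurable_fun setT f -> measurable [set w | c < f w].
Proof.
move=> mf; rewrite (_ : [set w | _] = f @^-1` `]c, +oo[).
  by rewrite -[X in measurable X]setTI; exact: mf.
by apply/seteqP; split => w /=; rewrite in_itv /= andbT.
Qed.

Section Survival.
Context {R : realType} {d : measure_display} {Om : measurableType d} {n : nat}.
Variables (P : R -> 'I_n -> probability Om R)
          (X : R -> Om -> R) (J : R -> Om -> option 'I_n).
Hypothesis XJ_meas : MAP_measurable X J.
Hypothesis XJ_start : MAP_start_paths P X J.
Hypothesis XJ_markov : markov_additive P X J.
Variables (x : R) (i : 'I_n) (h a : R).
Hypotheses (h_ge0 : 0 <= h) (a_ge0 : 0 <= a).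

Let t := grid h.
Let ik k w : R := (insk X h a k w)%:R.
Let jk k j : Om -> R := inJ J (t k) j.

Definition surv k l : R := \int[P x i]_w (ik k w * jk k l w).

Let ik_ge0 k w : 0 <= ik k w. Proof. exact: ler0n. Qed.
Let ik_le1 k w : ik k w <= 1. Proof. by rewrite /ik; case: (insk _ _ _ _ _). Qed.
Let jk_le1 k j w : jk k j w <= 1. Proof. exact: inJ_le1. Qed.
Let t_ge0 k : 0 <= t k. Proof. exact: grid_ge0. Qed.

Let m_ik k : measurable_fun setT (ik k).
Proof. apply: (adapted_measurable XJ_meas (t := t k)); exact: adapted_insk. Qed.

Let m_jk k j : measurable_fun setT (jk k j).
Proof. exact: (measurable_inJ XJ_meas). Qed.

Lemma integrable_surv k l : (P x i).-integrable setT (EFin \o (fun w => ik k w * jk k l w)).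
Proof.
apply: (@integrable_bounded _ _ _ _ _ 1); first exact: measurable_funM.
by move=> w; rewrite ger0_norm ?mulr_ge0 // -[leRHS]mulr1 ler_pM.
Qed.

Lemma surv_ge0 k l : 0 <= surv k l.
Proof. by apply: Rintegral_ge0 => w _; rewrite mulr_ge0. Qed.

Lemma sum_inJ_le1 s w : \sum_l inJ J s l w <= 1.
Proof.
rewrite /inJ; case: (J s w) => [l|]; last by rewrite big1.
rewrite (bigD1 l) //= eqxx big1 ?addr0 // => l' ll'.
by rewrite (_ : (Some l == Some l') = false) // eqE /= eq_sym (negbTE ll').
Qed.

Lemma sum_inJ_alive s l w : J s w = Some l -> \sum_l' inJ J s l' w = 1.
Proof.
move=> E; rewrite /inJ E (bigD1 l) //= eqxx big1 ?addr0 // => l' ll'.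
by rewrite (_ : (Some l == Some l') = false) // eqE /= eq_sym (negbTE ll').
Qed.

Lemma sum_surv k : \sum_l surv k l = \int[P x i]_w (\sum_l ik k w * jk k l w).
Proof. by rewrite Rintegral_sum // => l; exact: integrable_surv. Qed.

Let int_sum k : (P x i).-integrable setT (EFin \o (fun w => \sum_l ik k w * jk k l w)).
Proof. by apply: integrable_sum_EFin => l; exact: integrable_surv. Qed.

Lemma sum_surv_le1 k : \sum_l surv k l <= 1.
Proof.
rewrite sum_surv -[leRHS](Rintegral_prob_cst (P x i)); apply: le_Rintegral => //.
  exact: (finite_measure_integrable_cst (P x i) 1 measurableT).
move=> w _; rewrite -mulr_sumr -[leRHS]mulr1 ler_pM ?sum_inJ_le1 //.
by apply: sumr_ge0.
Qed.

Let alive_sum (k q : nat) w : good_path X J w -> \sum_l jk (k + q) l w <= \sum_l jk k l w.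
Proof.
move=> gw; case E : (J (t (k + q)) w) => [l|]; last first.
  by rewrite big1 ?sumr_ge0 // => l _; rewrite /jk /inJ E.
have [l' E'] : exists l', J (t k) w = Some l'.
  apply: (@alive_before _ _ _ _ X J (t k) (t (k + q)) w gw); last by rewrite E.
  by rewrite t_ge0 grid_le // leq_addr.
by rewrite [leRHS](sum_inJ_alive E') sum_inJ_le1.
Qed.

Lemma sum_surv_le k q : \sum_l surv (k + q) l <= \sum_l surv k l.
Proof.
rewrite !sum_surv; apply: ae_le_Rintegral => //.
apply: filterS (good_ae XJ_start x i) => w gw.
rewrite -!mulr_sumr ler_pM ?sumr_ge0 ?alive_sum //.
rewrite /ik; case E : (insk X h a (k + q) w); last exact: ler0n.
by rewrite (@insk_le _ _ X h a k q w E).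
Qed.

(** From state [l] the path rises by more than [a] over the next [r l <= rmax] steps with
    probability at least [p]; by [Ysk_increment] such a path does not survive to [k + rmax]. *)
Lemma surv_decay (p : R) (r : 'I_n -> nat) (rmax : nat) : 0 <= p ->
  (forall l, (r l <= rmax)%N) ->
  (forall l, (p%:E <= P 0 l [set w | (a < X (grid h (r l)) w - X 0 w)%R /\
                       J (grid h (r l)) w = Some l])%E) ->
  forall k, p * \sum_l surv k l <= \sum_l surv k l - \sum_l surv (k + rmax) l.
Proof.
move=> p0 rr Hp k.
pose psi (y : R) : R := (a < y)%R%:R.
have psi0 y : 0 <= psi y by exact: ler0n.
have psi1 y : psi y <= 1 by rewrite /psi; case: (a < y)%R.
have mpsi : measurable_fun setT psi by exact: measurable_gt_natr.
pose G l w := ik k w * jk k l w *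
  (psi (X (t k + t (r l)) w - X (t k) w) * inJ J (t k + t (r l)) l w).
have mG l : measurable_fun setT (G l).
  apply: measurable_funM; first exact: measurable_funM.
  apply: measurable_funM; last exact: (measurable_inJ XJ_meas).
  by apply: measurableT_comp => //; apply: measurable_funB; exact: XJ_meas.1.
have G0 l w : 0 <= G l w by rewrite !mulr_ge0 ?inJ_ge0.
have Gle l w : G l w <= ik k w * jk k l w.
  rewrite -[leRHS]mulr1 ler_wpM2l ?mulr_ge0 // -[leRHS]mulr1 ler_pM ?inJ_ge0 //.
  exact: inJ_le1.
have iG l : (P x i).-integrable setT (EFin \o G l).
  apply: (@integrable_bounded _ _ _ _ _ 1) => // w; rewrite ger0_norm //.
  by apply: (le_trans (Gle l w)); rewrite -[leRHS]mulr1 ler_pM.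
have EG l : p * surv k l <= \int[P x i]_w G l w.
  rewrite -lee_fin -EFin_Rintegral //.
  rewrite (@markov_ge0 _ _ _ _ P X J XJ_meas XJ_markov x i (t k) (t (r l)) l l (ik k) psi) //;
    last by exact: adapted_insk.
  rewrite EFin_Rintegral; last exact: integrable_surv.
  rewrite EFinM muleC lee_wpmul2l //; first by rewrite lee_fin surv_ge0.
  apply: (le_trans (Hp l)).
  set S := [set w | _].
  have mS : measurable S.
    apply: measurableI; last exact: XJ_meas.2.
    apply: (measurable_set_gt (f := fun w => X (grid h (r l)) w - X 0 w)).
    by apply: measurable_funB; exact: XJ_meas.1.
  rewrite -[X in (X <= _)%E]mul1e -integral_cst // integral_mkcond.
  apply: ge0_le_integral => //.
  - by move=> w _; rewrite patchE; case: ifP => // _; rewrite lee_fin.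
  - by apply/(measurable_restrict _ mS) => //; exact: measurable_cst.
  - apply/measurable_EFinP; apply: measurable_funM; last exact: (measurable_inJ XJ_meas).
    by apply: measurableT_comp => //; apply: measurable_funB; exact: XJ_meas.1.
  - move=> w _; rewrite patchE; case: ifPn => [|_]; last first.
      by rewrite lee_fin mulr_ge0 ?inJ_ge0.
    by rewrite inE => -[aX Jl]; rewrite lee_fin /psi aX /inJ Jl eqxx mulr1.
rewrite mulr_sumr lerBrDr.
apply: (@le_trans _ _ (\sum_l \int[P x i]_w G l w + \sum_l surv (k + rmax) l)).
  by rewrite lerD2r; apply: ler_sum => l _; exact: EG.
rewrite -Rintegral_sum // !sum_surv -RintegralD //; last exact: integrable_sum_EFin.
apply: ae_le_Rintegral => //.
  by apply: integrable_add => //; exact: integrable_sum_EFin.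
apply: filterS (good_ae XJ_start x i) => w gw.
have Gs : \sum_l G l w <= \sum_l ik k w * jk k l w by apply: ler_sum => l _.
case: (boolP (insk X h a (k + rmax) w)) => insr; last first.
  rewrite -[leRHS]addr0 lerD // big1 // => l _.
  by rewrite /ik (negbTE insr) mul0r.
have insk' := @insk_le _ _ X h a k rmax w insr.
rewrite [X in X + _]big1 ?add0r.
  by rewrite -!mulr_sumr /ik insr insk' !mul1r alive_sum.
move=> l _; rewrite /G; case: (ltP a (X (t k + t (r l)) w - X (t k) w)) => aX; last first.
  by rewrite /psi ltNge aX /= mul0r mulr0.
exfalso; move: aX; apply/negP; rewrite -leNgt -gridD.
apply: (le_trans (Ysk_increment _ _ _ _ _)); apply: (insk_Ysk (a := a)).
apply: (@insk_le _ _ _ _ _ (k + r l) (rmax - r l)).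
by rewrite -addnA subnKC.
Qed.

Lemma sum_surv_total (p : R) (r : 'I_n -> nat) (rmax : nat) : 0 <= p ->
  (forall l, (r l <= rmax)%N) ->
  (forall l, (p%:E <= P 0 l [set w | (a < X (grid h (r l)) w - X 0 w)%R /\
                       J (grid h (r l)) w = Some l])%E) ->
  forall K, p * \sum_(k < K) \sum_l surv k l <= rmax%:R.
Proof.
move=> p0 rr Hp K; rewrite mulr_sumr.
apply: (@le_trans _ _ (\sum_(k < K) (\sum_l surv k l - \sum_l surv (k + rmax) l))).
  by apply: ler_sum => k _; apply: (surv_decay p0 rr Hp).
have s0 k : 0 <= \sum_l surv k l by apply: sumr_ge0 => l _; exact: surv_ge0.
apply: (le_trans (sum_shift_telescope K rmax s0)).
rewrite -[leRHS](_ : \sum_(k < rmax) 1 = _); last first.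
  by rewrite sumr_const card_ord.
by apply: ler_sum => k _; exact: sum_surv_le1.
Qed.

Lemma surv_last K : K%:R * \sum_l surv K l <= \sum_(k < K) \sum_l surv k l.
Proof.
rewrite -[X in X * _](_ : \sum_(k < K) 1 = _); last by rewrite sumr_const card_ord.
rewrite mulr_suml; apply: ler_sum => k _; rewrite mul1r.
have := sum_surv_le k (K - k); rewrite subnKC //; exact: ltnW.
Qed.

Variable F : R -> 'M[R]_n.
Hypothesis F_exponent : is_matrix_exponent P X J F.

(** Let [y] be the increment of the exit step. If [y <= 1] the new level is at most [a + 1], and
    there is at most one exit. If [y > 1] then [(exp y - 1) ^ 2 >= 1], so [exp (c y)] may be
    multiplied by this square. The expectation of the product is a second difference in the
    exponent, in which the identity matrix cancels, so it is of the order of the mesh. *)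
Lemma exit_moment c K j : 0 <= c ->
  \sum_(k < K) sk_E P X J x i h a 0 c k j <= expR (c * (a + 1)) +
  expR (c * a) * \sum_(k < K) \sum_l surv k l * (expmx (h *: F (c + 2)) l j -
    2 * expmx (h *: F (c + 1)) l j + expmx (h *: F c) l j).
Proof.
move=> c0.
pose D k b w := ik k w * (expR (b * (X (t k + h) w - X (t k) w)) * inJ J (t k + h) j w).
have mk b k : 0 <= b -> (P x i).-integrable setT (EFin \o D k b) /\
    \int[P x i]_w D k b w = \sum_l surv k l * expmx (h *: F b) l j.
  move=> b0.
  apply: (@markov_exp_sum _ _ _ _ P X J XJ_meas XJ_start XJ_markov F
    F_exponent x i (t k) h b 1 j (ik k) (t_ge0 k) h_ge0 b0 (@adapted_insk _ _ _ _ X J h a h_ge0 k)).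
  by move=> w; rewrite ik_ge0 ik_le1.
have c1 : 0 <= c + 1 by rewrite addr_ge0.
have c2 : 0 <= c + 2 by rewrite addr_ge0.
pose H k w := expR (c * a) * (D k (c + 2) w + (-2 * D k (c + 1) w + D k c w)).
have iH0 k : (P x i).-integrable setT (EFin \o (fun w => -2 * D k (c + 1) w + D k c w)).
  apply: integrable_add; last exact: (mk c k c0).1.
  by apply: integrable_mull => //; exact: (mk _ k c1).1.
have iH1 k : (P x i).-integrable setT
    (EFin \o (fun w => D k (c + 2) w + (-2 * D k (c + 1) w + D k c w))).
  by apply: integrable_add => //; exact: (mk _ k c2).1.
have iH k : (P x i).-integrable setT (EFin \o H k) by apply: integrable_mull.
have EH k : \int[P x i]_w H k w = expR (c * a) * \sum_l surv k l *
    (expmx (h *: F (c + 2)) l j - 2 * expmx (h *: F (c + 1)) l j + expmx (h *: F c) l j).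
  rewrite RintegralZl // RintegralD //; last exact: (mk _ k c2).1.
  rewrite RintegralD //; [|by apply: integrable_mull => //; exact: (mk _ k c1).1
                         |exact: (mk c k c0).1].
  rewrite RintegralZl //; last exact: (mk _ k c1).1.
  rewrite (mk _ k c2).2 (mk _ k c1).2 (mk _ k c0).2.
  congr (_ * _); rewrite mulr_sumr -!big_split /=; apply: eq_bigr => l _; ring.
pose ex k w : R := (exitk X h a k w)%:R.
have mex k : measurable_fun setT (ex k).
  rewrite (_ : ex k = fun w => ik k w * (a < Ysk X h k.+1 w)%R%:R); last first.
    by apply/funext => w; rewrite /ex /exitk /ik -natrM mulnb.
  apply: measurable_funM => //.
  apply: (measurableT_comp (measurable_gt_natr a)).
  by apply: (adapted_measurable XJ_meas (t := t k.+1)); exact: adapted_Ysk.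
have iex k : (P x i).-integrable setT (EFin \o (fun w => expR (c * (a + 1)) * ex k w)).
  apply: integrable_mull => //; apply: (@integrable_bounded _ _ _ _ _ 1) => //.
  by move=> w; rewrite ger0_norm ?ler0n // /ex; case: (exitk _ _ _ _ _).
have point k w : sk_exit X J h a 0 c k j w <= expR (c * (a + 1)) * ex k w + H k w.
  have D_sq : D k (c + 2) w + (-2 * D k (c + 1) w + D k c w) =
     ik k w * (expR (c * (X (t k + h) w - X (t k) w)) *
       (expR (X (t k + h) w - X (t k) w) - 1) ^+ 2) * inJ J (t k + h) j w.
    rewrite /D; set y := X (t k + h) w - X (t k) w.
    have -> : (c + 2) * y = c * y + (y + y) by ring.
    have -> : (c + 1) * y = c * y + y by ring.
    by rewrite !expRD; ring.
  rewrite /H D_sq /sk_exit /ex /exitk /ik.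
  case: (boolP (insk X h a k w)) => [ins|_]; last first.
    by rewrite /= !mul0r !mulr0 addr0.
  have Yk := insk_Ysk ins; have Y0 := Ysk_ge0 X h k w.
  rewrite /= mul1r /damp oppr0 mul0r expR0.
  rewrite -/(Ysk X h k w) gridS; set u := inJ J _ j w.
  have u0 : 0 <= u by exact: inJ_ge0.
  have u1 : u <= 1 by exact: inJ_le1.
  have -> : Ysk X h k.+1 w = Num.max (Ysk X h k w + (X (t k + h) w - X (t k) w)) 0.
    by rewrite YskS gridS.
  set y := X (t k + h) w - X (t k) w.
  have Q0 : 0 <= expR (c * y) * (expR y - 1) ^+ 2 by rewrite mulr_ge0 ?expR_ge0 ?sqr_ge0.
  have rhs0 : 0 <= expR (c * a) * (expR (c * y) * (expR y - 1) ^+ 2 * u).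
    by rewrite mulr_ge0 ?expR_ge0 // mulr_ge0.
  case: (ltP a (Num.max (Ysk X h k w + y) 0)) => aY; last first.
    by rewrite !mul0r mulr0 add0r.
  have aY' : a < Ysk X h k w + y.
    by move: aY; rewrite lt_max => /orP[//|a0]; move: (lt_le_trans a0 a_ge0); rewrite ltxx.
  have -> : Num.max (Ysk X h k w + y) 0 = Ysk X h k w + y.
    by apply/max_idPl; apply: le_trans (ltW aY').
  rewrite mul1r mul1r mulr1.
  have [y1|y1] := leP y 1.
    rewrite -[leLHS]addr0 lerD //.
    apply: (@le_trans _ _ (expR (c * (Ysk X h k w + y)))).
      by rewrite -[leRHS]mulr1 ler_wpM2l ?expR_ge0.
    by rewrite ler_expR ler_wpM2l // lerD.
  rewrite -[leLHS]add0r lerD ?expR_ge0 //.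
  rewrite mulrA ler_wpM2r // mulrA -expRD.
  have e1 : 1 <= (expR y - 1) ^+ 2.
    rewrite -[leLHS](expr1n _ 2) lerXn2r ?nnegrE //.
      by rewrite subr_ge0 -expR0 ler_expR; lra.
    by have := expR_ge1Dx y; lra.
  apply: (@le_trans _ _ (expR (c * a + c * y))); last by rewrite ler_peMr ?expR_ge0.
  by rewrite ler_expR -mulrDr ler_wpM2l // lerD2r.
apply: (@le_trans _ _ (\sum_(k < K) \int[P x i]_w (expR (c * (a + 1)) * ex k w + H k w))).
  apply: ler_sum => k _.
  have iR : (P x i).-integrable setT
      (EFin \o (fun w => expR (c * (a + 1)) * ex k w + H k w)) by exact: integrable_add.
  have pos w : 0 <= sk_exit X J h a 0 c k j w.
    by rewrite /sk_exit !mulr_ge0 ?expR_ge0 ?inJ_ge0.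
  apply: le_Rintegral => //.
  apply: (le_integrable measurableT _ _ iR).
    by apply/measurable_EFinP; exact: m_sk_exit.
  by move=> w _ /=; rewrite lee_fin ger0_norm // (le_trans (point k w)) // ler_norm.
under eq_bigr => k _ do rewrite (RintegralD measurableT (iex k) (iH k)) EH.
rewrite big_split /= -mulr_sumr lerD2r.
have iex' k : (P x i).-integrable setT (EFin \o ex k).
  apply: (@integrable_bounded _ _ _ _ _ 1) => //.
  by move=> w; rewrite ger0_norm ?ler0n // /ex; case: (exitk _ _ _ _ _).
under eq_bigr => k _ do rewrite (RintegralZl _ measurableT (iex' k)).
rewrite -mulr_sumr -[leRHS]mulr1 ler_wpM2l ?expR_ge0 //.
rewrite -(Rintegral_sum (index_enum 'I_K) (F := fun k : 'I_K => ex k)) //.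
rewrite -[leRHS](Rintegral_prob_cst (P x i)).
apply: le_Rintegral => //; first exact: integrable_sum_EFin.
  exact: (finite_measure_integrable_cst (P x i) 1 measurableT).
by move=> w _; exact: sum_exitk_le1.
Qed.

End Survival.

(** * Regularity of paths and convergence of grid exits *)

Lemma ball_rightP (R : realType) (u v e : R) : u < v < u + e -> ball u e v.
Proof. by move=> /andP[uv ve]; rewrite -ball_normE /= ltr0_norm ?subr_lt0 //; lra. Qed.

Lemma ball_leftP (R : realType) (u v e : R) : u - e < v < u -> ball u e v.
Proof. by move=> /andP[uv ve]; rewrite -ball_normE /= gtr0_norm ?subr_gt0 //; lra. Qed.

Section GoodPath.
Context {R : realType} {d : measure_display} {Om : measurableType d} {n : nat}.
Variables (X : R -> Om -> R) (J : R -> Om -> option 'I_n) (w : Om).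
Hypothesis w_good : good_path X J w.

Lemma good_alive (s t : R) : 0 <= s <= t -> J t w <> None -> J s w <> None.
Proof. by move=> st Jt Js; apply: Jt; case: w_good => h _ _ _ _; exact: h st Js. Qed.

Lemma good_J_right (t : R) : 0 <= t -> exists2 e, 0 < e &
  forall s, t <= s < t + e -> J s w = J t w.
Proof.
case: w_good => _ h _ _ _ t0; have [e /= e0 H] := h t t0.
exists e => // s /andP[]; rewrite le_eqVlt => /orP[/eqP -> //|ts] se.
by apply: H => //; apply: ball_rightP; rewrite ts.
Qed.

Lemma good_X_right (t eps : R) : 0 <= t -> J t w <> None -> 0 < eps ->
  exists2 e, 0 < e & forall s, t <= s < t + e -> `|X s w - X t w| < eps.
Proof.
case: w_good => _ _ h _ _ t0 Jt eps0.
have [e /= e0 H] : \forall s \near t^'+, `|X s w - X t w| < eps.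
  have /cvgrPdist_lt /(_ eps eps0) := h t t0 Jt.
  by apply: filterS => s; rewrite distrC.
exists e => // s /andP[]; rewrite le_eqVlt => /orP[/eqP <-|ts] se.
  by rewrite subrr normr0.
by apply: H => //; apply: ball_rightP; rewrite ts.
Qed.

(** Without positive jumps the left limit at [t] is at least [X t w], so a strict lower bound at [t]
    already holds just before [t]. *)
Lemma good_X_left (t c : R) : 0 < t -> J t w <> None -> c < X t w ->
  exists2 e, 0 < e & forall s, t - e < s < t -> c < X s w.
Proof.
case: w_good => _ _ _ h1 h2 t0 Jt cX.
have cl : c < lim (X s w @[s --> t^'-]) by apply: lt_le_trans cX (h2 t t0 Jt).
have [e /= e0 H] : \forall s \near t^'-, c < X s w.
  by apply: (cvgr_gt _ (h1 t t0 Jt)).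
exists e => // s /andP[es st]; apply: H => //.
by apply: ball_leftP; rewrite es.
Qed.

Let path_img (t : R) : set R := [set X s w | s in [set s | 0 <= s <= t]].

(** Needed because [inf] has its meaning only on sets bounded below. Near each [u] the path stays
    above [X u w - 1], to the right by right-continuity and to the left by [good_X_left];
    compactness of [[0, t]] makes the bound uniform. *)
Lemma good_has_lbound (t : R) : J t w <> None -> has_lbound (path_img t).
Proof.
move=> Jt.
have /compact_near_coveringP cov := @segment_compact R 0 t.
have [N _ HN] : \forall N \near \oo, `[0, t]%classic `<=`
    (fun s => 0 <= s -> - N%:R <= X s w).
  apply: cov => u /=; rewrite in_itv /= => /andP[u0 ut].
  have Ju : J u w <> None by apply: good_alive Jt; rewrite u0.
  have [e1 e10 H1] := good_X_right u0 Ju ltr01.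
  have [e2 e20 H2] : exists2 e, 0 < e &
      forall s, 0 <= s -> u - e < s < u -> X u w - 1 < X s w.
    have [->|u0'] := eqVneq u 0.
      by exists 1 => // s s0 /andP[_]; rewrite ltNge s0.
    have up : 0 < u by rewrite lt_neqAle eq_sym u0'.
    have XX : X u w - 1 < X u w by rewrite gtrBl.
    by have [e e0 H] := good_X_left up Ju XX; exists e => // s _; exact: H.
  pose M := (Num.truncn `|X u w - 1|).+1.
  exists (ball u (Num.min e1 e2), [set N | M <= N]%N).
    split => /=; last exact: nbhs_infty_ge.
    by apply: nbhsx_ballx; rewrite lt_min e10.
  move=> [s N] /= [bs NM] s0.
  have Nlow : - N%:R <= X u w - 1.
    have : `|X u w - 1| <= N%:R.
      by apply: ltW; apply: (lt_le_trans (truncnS_gt _)); rewrite ler_nat.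
    by rewrite ler_norml => /andP[].
  move: bs; rewrite -ball_normE /= lt_min => /andP[b1 b2].
  have [us|su] := leP u s.
    have : `|X s w - X u w| < 1.
      by apply: H1; rewrite us /=; move: b1; rewrite ltr_norml => /andP[]; lra.
    by rewrite ltr_norml => /andP[]; lra.
  have : X u w - 1 < X s w.
    by apply: H2 => //; rewrite su andbT; move: b2; rewrite ltr_norml => /andP[]; lra.
  lra.
exists (- N%:R) => _ [s /= st <-].
by have /andP[s0 _] := st; apply: (HN N (leqnn N)); rewrite /= ?in_itv.
Qed.

Lemma Rreg_ge0 (t : R) : 0 <= Rreg X t w.
Proof. by rewrite /Rreg oppr_ge0 ge_min lexx. Qed.

Lemma Rreg_geN (s t : R) : 0 <= s <= t -> J t w <> None -> - X s w <= Rreg X t w.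
Proof.
move=> st Jt; rewrite /Rreg lerN2 ge_min; apply/orP; right.
by apply: ge_inf; [exact: good_has_lbound|exists s].
Qed.

Lemma Rreg_le (t r : R) : 0 <= t -> 0 <= r ->
  (forall s, 0 <= s <= t -> - X s w <= r) -> Rreg X t w <= r.
Proof.
move=> t0 r0 H; rewrite /Rreg lerNl le_min oppr_le0 r0 /=.
apply: lb_le_inf; first by exists (X 0 w), 0 => //=; rewrite lexx.
by move=> _ [s /= st <-]; rewrite lerNl H.
Qed.

Lemma Rreg_approx (t eps : R) : 0 <= t -> J t w <> None -> 0 < eps ->
  Rreg X t w <= 0 \/ exists2 s, 0 <= s <= t & Rreg X t w < - X s w + eps.
Proof.
move=> t0 Jt eps0; have [|R0] := leP (Rreg X t w) 0; first by left.
right; apply: contrapT => H.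
have : Rreg X t w <= Num.max 0 (Rreg X t w - eps).
  apply: Rreg_le => //; first by rewrite le_max lexx.
  move=> s st; rewrite le_max; apply/orP; right; rewrite leNgt; apply/negP => h.
  by apply: H; exists s => //; lra.
by rewrite le_max => /orP[|]; lra.
Qed.

Lemma Rsk_le_bound h k (r : R) : 0 <= r ->
  (forall l, (l <= k)%N -> - X (grid h l) w <= r) -> Rsk X h k w <= r.
Proof.
move=> r0; elim: k => [|k IH] H; rewrite /= ge_max; first by rewrite r0 H.
by rewrite H // IH // => l lk; rewrite H // leqW.
Qed.

Lemma Rsk_le_Rreg (h : R) k : 0 <= h -> J (grid h k) w <> None ->
  Rsk X h k w <= Rreg X (grid h k) w.
Proof.
move=> h0 Jk; apply: Rsk_le_bound; first exact: Rreg_ge0.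
by move=> l lk; apply: Rreg_geN => //; rewrite grid_ge0 // grid_le.
Qed.

Lemma Rsk_ge_grid (h : R) k l : (l <= k)%N -> - X (grid h l) w <= Rsk X h k w.
Proof.
move=> lk; apply: (le_trans (Rsk_geN X h l w)).
by rewrite -(subnKC lk) Rsk_le.
Qed.

Variable a : R.
Hypothesis a_gt0 : 0 < a.
Hypothesis X0_itv : 0 <= X 0 w <= a.

Lemma Ta_le (t : R) : 0 <= t -> a < Yrefl X t w -> (Ta X a w <= t%:E)%E.
Proof. by move=> t0 aY; apply: ereal_inf_lbound; exists t. Qed.

Lemma Ta_ge0 : (0 <= Ta X a w)%E.
Proof. by apply: le_ereal_inf_tmp => _ [t /= [t0 _] <-]; rewrite lee_fin. Qed.

Lemma Ta_adherent (tau eta : R) : Ta X a w = tau%:E -> 0 < eta ->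
  exists2 t, 0 <= t /\ tau <= t < tau + eta & a < Yrefl X t w.
Proof.
move=> E eta0; apply: contrapT => H.
have : ((tau + eta)%:E <= Ta X a w)%E.
  apply: le_ereal_inf_tmp => _ [t /= [t0 aY] <-]; rewrite lee_fin leNgt.
  apply/negP => lt; apply: H; exists t => //; split => //.
  by rewrite lt andbT -lee_fin -E; exact: Ta_le.
by rewrite E lee_fin; lra.
Qed.

(** The grid sees fewer times, so its regulator is at most the true one, and a grid exit of a live
    path never precedes [Ta]. *)
Lemma exitk_Ta (h : R) k : 0 <= h -> exitk X h a k w -> J (grid h k.+1) w <> None ->
  (Ta X a w <= (grid h k.+1)%:E)%E.
Proof.
move=> h0 /andP[_ aY] Jk; apply: Ta_le; first exact: grid_ge0.
by apply: (lt_le_trans aY); rewrite /Ysk /Yrefl lerD2l Rsk_le_Rreg.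
Qed.

(* Absence of positive jumps enters here: [Y] cannot jump over the level [a]. *)
Lemma Yrefl_Ta_le (tau : R) : Ta X a w = tau%:E -> J tau w <> None ->
  Yrefl X tau w <= a.
Proof.
move=> E Jt; have tau0 : 0 <= tau by rewrite -lee_fin -E Ta_ge0.
rewrite leNgt; apply/negP => aY.
have /andP[x0 xa] := X0_itv.
have before t : 0 <= t < tau -> Yrefl X t w <= a.
  move=> /andP[t0 tt]; rewrite leNgt; apply/negP => aYt.
  by have := Ta_le t0 aYt; rewrite E lee_fin leNgt tt.
have [tau00|tau0'] := eqVneq tau 0.
  have : Rreg X tau w <= 0.
    rewrite tau00; apply: Rreg_le => // s; rewrite -eq_le => /eqP <-.
    by rewrite oppr_le0.
  by move: aY; rewrite /Yrefl tau00; lra.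
have taup : 0 < tau by rewrite lt_neqAle eq_sym tau0'.
have left_close s0 c : 0 <= s0 < tau -> c < X tau w -> exists2 t, s0 < t < tau & c < X t w.
  move=> /andP[s00 s0t] cX; have [e e0 H] := good_X_left taup Jt cX.
  pose t := Num.max ((s0 + tau) / 2) (tau - e / 2).
  have t1 : t < tau by rewrite gt_max; apply/andP; split; lra.
  have t2 : s0 < t by rewrite lt_max; apply/orP; left; lra.
  have t3 : tau - e < t by rewrite lt_max; apply/orP; right; lra.
  by exists t; [rewrite t2|apply: H; rewrite t3].
pose eps := (Yrefl X tau w - a) / 2.
have eps0 : 0 < eps by rewrite divr_gt0 // subr_gt0.
have epsE : Yrefl X tau w = a + 2 * eps by rewrite /eps; field.
(* Either the regulator vanishes at [tau] and [X] itself passes [a], or [X] has risen by more than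
   [a] since some [s0]. Both inequalities already hold just before [tau]. *)
have [R0|[s0 /andP[s00 s0t] Rs]] := Rreg_approx tau0 Jt eps0.
  have aX : a < X tau w by move: aY; rewrite /Yrefl; lra.
  have [|t /andP[t0 tt] aXt] := left_close 0 a _ aX; first by rewrite lexx.
  have := before t; rewrite tt (ltW t0) => /(_ isT); rewrite /Yrefl.
  by have := Rreg_ge0 t; lra.
have Xs : X s0 w + a < X tau w by move: epsE; rewrite /Yrefl; lra.
have s0t' : s0 < tau.
  rewrite lt_neqAle s0t andbT; apply/eqP => s0E; move: Xs; rewrite s0E.
  by have := a_gt0; lra.
have [|t /andP[t0 tt] Xt] := left_close s0 _ _ Xs; first by rewrite s00.
have t00 : 0 <= t by rewrite ltW // (le_lt_trans s00).
have := before t; rewrite tt t00 => /(_ isT); rewrite /Yrefl.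
have : - X s0 w <= Rreg X t w.
  apply: Rreg_geN; first by rewrite s00 ltW.
  by apply: good_alive Jt; rewrite t00 ltW.
lra.
Qed.

Let first_exit (h : R) k : a < Ysk X h k w ->
  exists2 k', (k'.+1 <= k)%N & exitk X h a k' w.
Proof.
have ninskP m : ~~ insk X h a m w -> exists2 k', (k'.+1 <= m)%N & exitk X h a k' w.
  elim: m => [|m IH].
    have /andP[x0 xa] := X0_itv.
    have R0 : Rsk X h 0 w = 0 by rewrite /= grid0; apply/max_idPl; rewrite oppr_le0.
    by rewrite /insk /Ysk R0 grid0 addr0 xa.
  rewrite inskS negb_and; case: (boolP (insk X h a m w)) => [ins|/IH[k' k'm ek] _].
    by rewrite -ltNge => /= aY; exists m => //; rewrite /exitk ins.
  by exists k' => //; rewrite leqW.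
move=> aY; apply: ninskP; apply/negP => ins; have := insk_Ysk ins.
by rewrite leNgt aY.
Qed.

(** Some [t] close to [tau] has [Y t > a]. A fine grid has one point just after [t] and one just
    after a time [s1] where the regulator at [t] is nearly attained, and these two suffice to put
    the grid value above [a]. *)
Let grid_exit (tau eta : R) (j : 'I_n) : Ta X a w = tau%:E -> J tau w = Some j ->
  0 < eta -> exists m0, forall m, (m0 <= m)%N -> exists k,
    [/\ exitk X (dyad m) a k w, tau <= grid (dyad m) k.+1 < tau + eta &
        J (grid (dyad m) k.+1) w = Some j].
Proof.
move=> E Jt eta0; have tau0 : 0 <= tau by rewrite -lee_fin -E Ta_ge0.
have [e0 e00 He0] := good_J_right tau0; rewrite Jt in He0.
have eta1 : 0 < Num.min eta e0 by rewrite lt_min eta0.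
have [t [t0 /andP[tt tte]] aY] := Ta_adherent E eta1.
have Jtt : J t w = Some j.
  by apply: He0; rewrite tt (lt_le_trans tte) // lerD2l ge_min lexx orbT.
have Jtn : J t w <> None by rewrite Jtt.
pose eps := (Yrefl X t w - a) / 3.
have eps0 : 0 < eps by rewrite divr_gt0 // subr_gt0.
have epsE : Yrefl X t w = a + 3 * eps by rewrite /eps; field.
have [e1 e10 He1] := good_X_right t0 Jtn eps0.
have [s1 [s10 s1t Xs1]] : exists s1, [/\ 0 <= s1, s1 <= t & Rreg X t w <= Num.max 0 (- X s1 w + eps)].
  have [R0|[s /andP[s0 st] Rs]] := Rreg_approx t0 Jtn eps0.
    by exists 0; rewrite lexx t0; split => //; rewrite le_max R0.
  by exists s; split => //; rewrite le_max (ltW Rs) orbT.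
have Js1 : J s1 w <> None by apply: good_alive Jtn; rewrite s10.
have [e2 e20 He2] := good_X_right s10 Js1 eps0.
pose v := Num.min (t + e1) (tau + Num.min eta e0).
have tv : t < v by rewrite lt_min tte ltrDl e10.
have [m1 Hm1] := dyad_between t0 tv.
pose v1 := s1 + e2.
have s1v1 : s1 < v1 by rewrite ltrDl.
have [m2 Hm2] := dyad_between s10 s1v1.
exists (maxn m1 m2) => m mm.
have [k1 /andP[tk1 k1v]] := Hm1 m (leq_trans (leq_maxl _ _) mm).
have [k2' /andP[sk2' k2v']] := Hm2 m (leq_trans (leq_maxr _ _) mm).
(* The minimum puts the two indices in order; the grid point still lies after [s1] since
   [s1 <= t]. *)
pose k2 := minn k1 k2'.
have k2k1 : (k2 <= k1)%N by exact: geq_minl.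
have sk2 : s1 < grid (dyad m) k2.
  by rewrite /k2 /minn; case: ifP => // _; apply: le_lt_trans tk1.
have k2v : grid (dyad m) k2 < s1 + e2.
  apply: le_lt_trans k2v'; apply: grid_le; [exact: dyad_ge0|exact: geq_minr].
have [k1e k1t] : grid (dyad m) k1 < t + e1 /\ grid (dyad m) k1 < tau + Num.min eta e0.
  by move: k1v; rewrite lt_min => /andP[].
have aYk : a < Ysk X (dyad m) k1 w.
  have h1 : `|X (grid (dyad m) k1) w - X t w| < eps by apply: He1; rewrite (ltW tk1).
  have h2 : `|X (grid (dyad m) k2) w - X s1 w| < eps by apply: He2; rewrite (ltW sk2).
  have h3 := Rsk_ge_grid (dyad m) k2k1; have h4 := Rsk_ge0 X (dyad m) k1 w.
  move: h1 h2 Xs1 epsE; rewrite /Yrefl /Ysk !ltr_norml le_max.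
  move=> /andP[h1 _] /andP[_ h2] /orP[] h5 h6; lra.
have [k k1k ek] := first_exit aYk.
have kk1 : grid (dyad m : R) k.+1 <= grid (dyad m) k1 := grid_le (dyad_ge0 m) k1k.
have Jk1 : J (grid (dyad m) k1) w = Some j.
  apply: He0; rewrite (le_trans tt (ltW tk1)) (lt_le_trans k1t) // lerD2l.
  by rewrite ge_min lexx orbT.
have tk : tau <= grid (dyad m) k.+1.
  rewrite -lee_fin -E; apply: exitk_Ta => //; first exact: dyad_ge0.
  apply: (@good_alive _ (grid (dyad m) k1)); last by rewrite Jk1.
  by rewrite (grid_ge0 (dyad_ge0 m)) kk1.
exists k; split => //.
  rewrite tk (le_lt_trans kk1) // (lt_le_trans k1t) // lerD2l ge_min lexx //.
apply: He0; rewrite tk (le_lt_trans kk1) // (lt_le_trans k1t) // lerD2l.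
by rewrite ge_min lexx orbT.
Qed.

Let grid_exit_close (tau eps : R) (j : 'I_n) : Ta X a w = tau%:E -> J tau w = Some j ->
  0 < eps -> exists m0, forall m, (m0 <= m)%N -> exists k,
    [/\ exitk X (dyad m) a k w, (k < m * 2 ^ m)%N, J (grid (dyad m) k.+1) w = Some j,
        `|Ysk X (dyad m) k.+1 w - a| < eps & `|Rsk X (dyad m) k.+1 w - Rreg X tau w| < eps].
Proof.
move=> E Jt eps0; have tau0 : 0 <= tau by rewrite -lee_fin -E Ta_ge0.
have Jtn : J tau w <> None by rewrite Jt.
have Ya := Yrefl_Ta_le E Jtn.
have core e : 0 < e -> exists m0, forall m, (m0 <= m)%N -> exists k,
    [/\ exitk X (dyad m) a k w, (k < m * 2 ^ m)%N, J (grid (dyad m) k.+1) w = Some j,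
        a < Ysk X (dyad m) k.+1 w <= Yrefl X tau w + 2 * e
      & `|X (grid (dyad m) k.+1) w - X tau w| < e].
  move=> e_gt0; have [e1 e10 He1] := good_X_right tau0 Jtn e_gt0.
  have [m0 Hm0] := grid_exit E Jt e10.
  (* The second bound gives [m > tau + e1], so that the exit falls within the horizon [m] of the
     sums. *)
  exists (maxn m0 (Num.truncn (tau + e1)).+1) => m mm.
  have [k [ek /andP[tk kt] Jk]] := Hm0 m (leq_trans (leq_maxl _ _) mm).
  have Xk : `|X (grid (dyad m) k.+1) w - X tau w| < e by apply: He1; rewrite tk.
  exists k; split => //.
    have : grid (dyad m : R) k.+1 < m%:R.
      apply: (lt_trans kt); apply: (lt_le_trans (truncnS_gt _)); rewrite ler_nat.
      exact: leq_trans (leq_maxr _ _) mm.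
    rewrite /grid /dyad ltr_pdivrMr ?exprn_gt0 // -natrX -natrM ltr_nat.
    exact: ltnW.
  have /andP[_ ->] := ek; rewrite /=.
  have Jkn : J (grid (dyad m) k.+1) w <> None by rewrite Jk.
  have RR : Rreg X (grid (dyad m) k.+1) w <= Rreg X tau w + e.
    apply: Rreg_le; first exact: le_trans tk.
      by rewrite addr_ge0 ?Rreg_ge0 // ltW.
    move=> s /andP[s0 sk]; have [st|ts] := leP s tau.
      by apply: (le_trans (Rreg_geN _ Jtn)); rewrite ?s0 // lerDl ltW.
    have : `|X s w - X tau w| < e.
      by apply: He1; rewrite (ltW ts) (le_lt_trans sk).
    have : - X tau w <= Rreg X tau w by apply: Rreg_geN => //; rewrite tau0 lexx.
    by rewrite ltr_norml => ? /andP[]; lra.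
  have := Rsk_le_Rreg (dyad_ge0 m) Jkn.
  by move: Xk RR; rewrite ltr_norml /Ysk /Yrefl => /andP[_]; lra.
(* The grid level at exit exceeds [a] and is at most [Y tau + 2 e] for every [e > 0]; hence
   [Y tau >= a], and [Yrefl_Ta_le] is the other half. *)
have aY : Yrefl X tau w = a.
  apply/eqP; rewrite eq_le Ya /= leNgt; apply/negP => Yla.
  have e_gt0 : 0 < (a - Yrefl X tau w) / 4 by rewrite divr_gt0 // subr_gt0.
  have [m0 Hm0] := core _ e_gt0.
  have [k [_ _ _ /andP[h1 h2] _]] := Hm0 m0 (leqnn _).
  suff : a < a by rewrite ltxx.
  lra.
have eps4 : 0 < eps / 4 by rewrite divr_gt0.
have [m0 Hm0] := core _ eps4.
exists m0 => m mm; have [k [ek kK Jk /andP[Y1 Y2] Xk]] := Hm0 m mm.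
exists k; split => //; first by rewrite ger0_norm; lra.
have -> : Rsk X (dyad m) k.+1 w - Rreg X tau w =
    (Ysk X (dyad m) k.+1 w - a) - (X (grid (dyad m) k.+1) w - X tau w).
  by rewrite -aY /Ysk /Yrefl; ring.
by move: Xk; rewrite !ltr_norml => /andP[h1 h2]; apply/andP; split; lra.
Qed.

Variables (alpha b : R) (j : 'I_n).
Hypothesis alpha_ge0 : 0 <= alpha.

Lemma exit_integrand_fin : exit_integrand X J alpha a j w \is a fin_num.
Proof. by rewrite /exit_integrand; case: (Ta X a w) => [t||] //; case: ifP. Qed.

Lemma sk_exit_cvg :
  (fun m => \sum_(k < m * 2 ^ m) sk_exit X J (dyad m) a alpha b k j w) @ \oo -->
  expR (b * a) * fine (exit_integrand X J alpha a j w).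
Proof.
have nul : (forall m k, exitk X (dyad m) a k w -> J (grid (dyad m) k.+1) w <> Some j) ->
    (fun m => \sum_(k < m * 2 ^ m) sk_exit X J (dyad m) a alpha b k j w) = (fun=> 0).
  move=> H; apply/funext => m; rewrite big1 // => k _; rewrite /sk_exit /inJ.
  case: (boolP (exitk X (dyad m) a k w)) => [/H/eqP/negbTE -> |_]; last by rewrite !mul0r.
  by rewrite mulr0.
rewrite /exit_integrand; case E : (Ta X a w) => [tau| |]; last first.
- by have := Ta_ge0; rewrite E.
- rewrite /= mulr0 nul; first exact: cvg_cst.
  move=> m k ek Jk; have Jkn : J (grid (dyad m) k.+1) w <> None by rewrite Jk.
  by have := exitk_Ta (dyad_ge0 m) ek Jkn; rewrite E.
have tau0 : 0 <= tau by rewrite -lee_fin -E Ta_ge0.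
have [Jt|Jt] := eqVneq (J tau w) (Some j); last first.
  rewrite /= mulr0.
  case Jt' : (J tau w) => [j'|]; last first.
    rewrite nul; first exact: cvg_cst.
    (* Here the path is dead at [tau]. A grid exit at a live time would come no earlier than [tau],
       contradicting absorption. *)
    move=> m k ek Jk; have Jkn : J (grid (dyad m) k.+1) w <> None by rewrite Jk.
    have := exitk_Ta (dyad_ge0 m) ek Jkn; rewrite E lee_fin => tk.
    by apply: (@good_alive tau _ _ Jkn) => //; rewrite tau0.
  have [m0 Hm0] := grid_exit_close E Jt' ltr01.
  apply: cvg_near_cst; exists m0 => // m /= mm.
  have [k [ek kK Jk _ _]] := Hm0 m mm.
  rewrite big1 // => l _; rewrite /sk_exit.
  case: (boolP (exitk X (dyad m) a l w)) => [el|_]; last by rewrite !mul0r.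
  rewrite -(exitk_uniq ek el) /inJ Jk (_ : (Some j' == Some j) = false) ?mulr0 //.
  by apply/negbTE; rewrite -Jt'.
(* The index of the unique grid exit, with default 0 on meshes without one. *)
have /choice[kf Hkf] : forall m, exists k, forall k',
    exitk X (dyad m) a k' w -> k' = k.
  move=> m; have [[k ek]|nex] := pselect (exists k, exitk X (dyad m) a k w).
    by exists k => k' ek'; exact: exitk_uniq ek' ek.
  by exists 0%N => k' ek'; case: nex; exists k'.
pose y m := Ysk X (dyad m) (kf m).+1 w; pose r m := Rsk X (dyad m) (kf m).+1 w.
have close eps : 0 < eps -> exists m0, forall m, (m0 <= m)%N ->
    [/\ exitk X (dyad m) a (kf m) w, (kf m < m * 2 ^ m)%N,
        J (grid (dyad m) (kf m).+1) w = Some j,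
        `|y m - a| < eps & `|r m - Rreg X tau w| < eps].
  move=> eps0; have [m0 Hm0] := grid_exit_close E Jt eps0; exists m0 => m mm.
  by have [k [ek]] := Hm0 m mm; rewrite /y /r -(Hkf m k ek).
have cy : y @ \oo --> a.
  apply/cvgrPdist_lt => e e0; have [m0 Hm0] := close e e0.
  by exists m0 => // m /= /Hm0[_ _ _ + _]; rewrite distrC.
have cr : r @ \oo --> Rreg X tau w.
  apply/cvgrPdist_lt => e e0; have [m0 Hm0] := close e e0.
  by exists m0 => // m /= /Hm0[_ _ _ _ +]; rewrite distrC.
have lim : (fun m => expR (b * y m) * expR (- alpha * r m)) @ \oo -->
    expR (b * a) * expR (- alpha * Rreg X tau w).
  by apply: cvgM; apply: continuous_cvg; try (exact: continuous_expR); apply: cvgMr.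
apply: cvg_trans lim; apply: near_eq_cvg.
have [m0 Hm0] := close 1 ltr01; exists m0 => // m /= /Hm0[ek kK Jk _ _].
rewrite (bigD1 (Ordinal kK)) //= big1 ?addr0; last first.
  move=> l lk; rewrite /sk_exit; case: (boolP (exitk X (dyad m) a l w)) => [el|_].
    by case/eqP: lk; apply: val_inj; rewrite /= (Hkf m _ el).
  by rewrite !mul0r.
rewrite /sk_exit /= ek /inJ Jk eqxx mul1r mulr1 mulrC.
by rewrite /damp /y /r.
Qed.

End GoodPath.

(** * Ultrafilter limits and convergence of integrals *)

Section UltraLimit.
Context {R : realType} (Om : set_system nat).
Hypothesis ultra : UltraFilter Om.
Hypothesis finer : \oo `<=` Om.

(** The image filter on a compact interval has a cluster point. It converges there, since a
    neighbourhood outside the filter would have its complement inside. *)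
Lemma ultra_bounded_cvg (s : nat -> R) (B : R) :
  (\forall m \near \oo, `|s m| <= B) -> cvg (s @ Om).
Proof.
move=> sB; have PF : ProperFilter Om by exact: ultra_proper.
have := @segment_compact R (- B) B.
move=> /(_ (s @ Om) _) [|p [_ cp]].
  change (Om (s @^-1` `[- B, B]%classic)).
  have OB : Om [set m | `|s m| <= B] by exact: finer.
  by apply: filterS OB => m sm; rewrite /= in_itv /= -ler_norml.
apply/cvg_ex; exists p => V pV.
have [//|nV] := in_ultra_setVsetC (s @^-1` V) ultra.
by have [y [/= nVy Vy]] := cp (~` V) V nV pV.
Qed.

End UltraLimit.

Section ConvergenceLemmas.
Context {d : measure_display} {T : measurableType d} {R : realType}.
Variable Pr : probability T R.

Lemma bounded_cvg_Rintegral (g : nat -> T -> R) (G : T -> R) (M : R) :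
  (forall m, measurable_fun setT (g m)) -> measurable_fun setT G ->
  (forall m w, `|g m w| <= M) -> {ae Pr, forall w, g ^~ w @ \oo --> G w} ->
  (fun m => \int[Pr]_w g m w) @ \oo --> \int[Pr]_w G w.
Proof.
move=> mg mG gM gG.
have iM := finite_measure_integrable_cst Pr M measurableT.
have [|||||iG _ cv] := @dominated_convergence _ T R Pr setT measurableT
  (fun m => EFin \o g m) (EFin \o G) (EFin \o cst M).
- by move=> m; exact/measurable_EFinP.
- exact/measurable_EFinP.
- apply: filterS gG => w gw _; apply: cvg_EFin; first exact: nearW.
  exact: gw.
- exact: iM.
- by apply: aeW => w m _; rewrite /= lee_fin.
rewrite /Rintegral; apply: fine_cvg; rewrite fineK; last exact: integrable_fin_num.
exact: cv.
Qed.

(** A nonnegative integral is a supremum over simple functions below the integrand, so monotonicity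
    holds for arbitrary functions. *)
Lemma ge0_integral_mono (f g : T -> \bar R) : (forall w, 0 <= f w)%E ->
  (forall w, f w <= g w)%E -> (\int[Pr]_w f w <= \int[Pr]_w g w)%E.
Proof.
move=> f0 fg; have g0 w : (0 <= g w)%E := le_trans (f0 w) (fg w).
rewrite !ge0_integralTE //.
apply: ge_ereal_sup => _ [h hf <-]; apply: ereal_sup_ubound; exists h => // w.
exact: le_trans (hf w) (fg w).
Qed.

(** Meant for [exit_integrand], which involves an infimum over uncountably many times. The function
    [f] lies between the versions of [g] set to 0 and to [+oo] on the null set; both are measurable
    and have the integral of [g]. *)
Lemma ge0_ae_eq_integral_nonmeas (f g : T -> \bar R) : (forall w, 0 <= f w)%E ->
  measurable_fun setT g -> (forall w, 0 <= g w)%E ->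
  {ae Pr, forall w, f w = g w} -> (\int[Pr]_w f w = \int[Pr]_w g w)%E.
Proof.
move=> f0 mg g0 [N [mN N0 NP]].
have off w : ~ N w -> f w = g w by move=> nN; apply: contrapT => h; apply: nN; exact: NP.
pose patched c w := ((g \_ (~` N)) w + (cst c \_ N) w)%E.
have patchedE c w : patched c w = if w \in N then c else g w.
  by rewrite /patched !patchE in_setC; case: (w \in N); rewrite /= ?add0e ?adde0.
have key c : (0 <= c)%E -> (\int[Pr]_w (if w \in N then c else g w) = \int[Pr]_w g w)%E.
  move=> c0.
  have mc : measurable_fun setT (patched c).
    apply: emeasurable_funD.
      apply/(measurable_restrict _ (measurableC mN)) => //.
      exact: measurable_funTS.
    by apply/(measurable_restrict _ mN) => //; exact: measurable_cst.
  transitivity (\int[Pr]_w patched c w)%E.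
    by apply: eq_integral => w _; rewrite patchedE.
  apply: ae_eq_integral => //.
  exists N; split => // w /= h; apply: contrapT => nN; apply: h => _.
  by rewrite patchedE memNset.
apply/eqP; rewrite eq_le; apply/andP; split.
  rewrite -(key +oo%E) //; apply: ge0_integral_mono => // w.
  by case: ifPn => [_|/negP]; [exact: leey|rewrite inE => /off ->].
rewrite -(key 0%E) //; apply: ge0_integral_mono => w.
  by case: ifP.
by case: ifPn => [_|/negP]; [exact: f0|rewrite inE => /off ->].
Qed.

End ConvergenceLemmas.

Lemma continuous_minr_cst (R : realType) (M : R) : continuous (fun y : R => Num.min y M).
Proof.
move=> y; apply/cvgrPdist_lt => e e0; near=> z.
have : `|y - z| < e by near: z; exact: cvgr_dist_lt cvg_id _ e0.
rewrite !ltr_norml; case: (leP y M) => yM; case: (leP z M) => zM => /andP[h1 h2];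
  by apply/andP; split; lra.
Unshelve. all: by end_near.
Qed.

(** * The exit expectation as a limit of skeleton expectations *)

Section ExitLimit.
Context {R : realType} {d : measure_display} {Om : measurableType d} {n : nat}.
Variables (P : R -> 'I_n -> probability Om R)
          (X : R -> Om -> R) (J : R -> Om -> option 'I_n).
Hypothesis XJ_meas : MAP_measurable X J.
Hypothesis XJ_start : MAP_start_paths P X J.
Hypothesis XJ_markov : markov_additive P X J.
Hypothesis not_nonincr : forall i, ~ {ae P 0 i, forall w, nonincr_in_state X J i w}.
Variable F : R -> 'M[R]_n.
Hypothesis F_exponent : is_matrix_exponent P X J F.

(** The expected survival time is bounded uniformly in the mesh: the rises found on coarse grids are
    read again on finer ones, and [rmax] steps of length [dyad m] always last the same time [T]. *)
Lemma surv_total_bounded (a : R) : 0 <= a -> exists2 C : R, 0 <= C &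
  exists m0, forall m, (m0 <= m)%N -> forall x i K,
    dyad m * \sum_(k < K) \sum_l surv P X J x i (dyad m) a k l <= C.
Proof.
move=> a0.
have /choice[mN HmN] : forall l, exists mN : nat * nat,
    (0 < P 0 l [set w | (a < X (grid (dyad mN.1) mN.2) w - X 0 w)%R /\
                      J (grid (dyad mN.1) mN.2) w = Some l])%E.
  move=> l; have [m [N H]] := rise_iter XJ_meas XJ_start XJ_markov not_nonincr l a.
  by exists (m, N).
pose S l := [set w | (a < X (grid (dyad (mN l).1) (mN l).2) w - X 0 w)%R /\
                     J (grid (dyad (mN l).1) (mN l).2) w = Some l].
have mS l : measurable (S l).
  apply: measurableI; last exact: XJ_meas.2.
  apply: (measurable_set_gt (f := fun w => X (grid (dyad (mN l).1) (mN l).2) w - X 0 w)).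
  by apply: measurable_funB; exact: XJ_meas.1.
pose pl l := fine (P 0 l (S l)).
have plE l : P 0 l (S l) = (pl l)%:E by rewrite fineK // fin_num_measure.
have pl0 l : 0 < pl l by rewrite -lte_fin -plE; exact: HmN.
(* The inverse of [q] lies below every [pl l]; adding 1 keeps [q] positive even for an empty state
   space. *)
pose q := \sum_l (pl l)^-1 + 1.
have q0 : 0 < q by rewrite ltr_wpDl // sumr_ge0 // => l _; rewrite invr_ge0 ltW.
pose p := q^-1.
have p0 : 0 < p by rewrite invr_gt0.
have ppl l : p <= pl l.
  rewrite -[pl l]invrK lef_pV2 ?posrE ?invr_gt0 // /q (bigD1 l) //= -addrA lerDl.
  by rewrite addr_ge0 // sumr_ge0 // => l' _; rewrite invr_ge0 ltW.
pose T : R := \sum_l grid (dyad (mN l).1) (mN l).2.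
have T0 : 0 <= T by rewrite sumr_ge0 // => l _; rewrite grid_ge0 // dyad_ge0.
exists (T / p); first by rewrite divr_ge0 // ltW.
exists (\max_l (mN l).1) => m mm x i K.
pose r l := ((mN l).2 * 2 ^ (m - (mN l).1))%N.
have ml l : ((mN l).1 <= m)%N by apply: leq_trans mm; exact: leq_bigmax.
have gr l : grid (dyad m : R) (r l) = grid (dyad (mN l).1) (mN l).2.
  by rewrite (grid_dyad_le _ (ml l)).
pose rmax := (\sum_l r l)%N.
have rr l : (r l <= rmax)%N by rewrite /rmax (bigD1 l) //= leq_addr.
have Tr : T = dyad m * rmax%:R.
  rewrite /T /rmax natr_sum mulr_sumr; apply: eq_bigr => l _.
  by rewrite -gr /grid mulrC.
have := @sum_surv_total _ _ _ _ P X J XJ_meas XJ_start XJ_markov x i (dyad m) a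
  (dyad_ge0 m) p r rmax (ltW p0) rr _ K.
move=> H; rewrite ler_pdivlMr // Tr -mulrA ler_wpM2l ?dyad_ge0 // mulrC.
apply: H => l; rewrite gr; apply: (@le_trans _ _ (pl l)%:E); first by rewrite lee_fin.
by rewrite -plE.
Qed.

Variables (x : R) (i : 'I_n) (a alpha : R).
Hypotheses (a_gt0 : 0 < a) (alpha_ge0 : 0 <= alpha) (x_itv : 0 <= x <= a).

Let a_ge0 : 0 <= a := ltW a_gt0.

Lemma sk_V_le_surv h (phi : R -> R) M k j : 0 <= h -> measurable_fun setT phi -> 0 <= M ->
  (forall y, 0 <= y <= a -> `|phi y| <= M) ->
  `|sk_V P X J x i h a alpha phi k j| <= M * surv P X J x i h a k j.
Proof.
move=> h0 mphi M0 HM.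
have ist := @integrable_state _ _ _ _ P X J XJ_meas x i h a alpha h0 alpha_ge0 phi M k j mphi M0 HM.
have iu := integrable_surv P XJ_meas x i a h0 k j.
apply: (le_trans (le_normr_Rintegral measurableT ist)).
rewrite /surv -RintegralZl //; apply: le_Rintegral => //.
- exact: (integrable_norm ist).
- exact: integrable_mull.
move=> w _; rewrite /sk_state; case: (boolP (insk X h a k w)) => [ins|_]; last first.
  by rewrite !mul0r normr0 mulr0.
rewrite !mul1r !normrM (ger0_norm (inJ_ge0 _ _ _ _)) ler_wpM2r ?inJ_ge0 //.
rewrite -[leRHS]mul1r ler_pM //.
  rewrite /damp ger0_norm ?expR_ge0 // -expR0 ler_expR mulNr oppr_le0.
  by rewrite mulr_ge0 // Rsk_ge0.
by rewrite HM // Ysk_ge0 insk_Ysk.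
Qed.

Let g (b : R) (j : 'I_n) m w : R :=
  \sum_(k < m * 2 ^ m) sk_exit X J (dyad m) a alpha b k j w.

Let g_meas b j m : measurable_fun setT (g b j m).
Proof. by apply: measurable_sum => k; apply: m_sk_exit => //; exact: dyad_ge0. Qed.

Let g_ge0 b j m w : 0 <= g b j m w.
Proof.
by apply: sumr_ge0 => k _; rewrite /sk_exit !mulr_ge0 ?expR_ge0 ?inJ_ge0.
Qed.

(** With at most one exit [g] is a single term [u], and its square is at most the undamped exit term
    with exponent [2 b]. If [u > M] then [u - M <= u ^ 2 / M]. *)
Let g_excess b j m w M : 0 < M ->
  g b j m w - Num.min (g b j m w) M <=
  M^-1 * \sum_(k < m * 2 ^ m) sk_exit X J (dyad m) a 0 (2 * b) k j w.
Proof.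
move=> M0; have M0' := ltW M0.
have s0 k : 0 <= sk_exit X J (dyad m) a 0 (2 * b) k j w.
  by rewrite /sk_exit !mulr_ge0 ?expR_ge0 ?inJ_ge0.
have [/existsP[k ek]|/existsPn nek] :=
    boolP [exists k : 'I_(m * 2 ^ m), exitk X (dyad m) a k w]; last first.
  rewrite [X in X - _](_ : g b j m w = 0); last first.
    by rewrite /g big1 // => k _; rewrite /sk_exit (negbTE (nek k)) !mul0r.
  have -> : Num.min (g b j m w) M = 0.
    rewrite (_ : g b j m w = 0) ?(min_idPl _) //.
    by rewrite /g big1 // => k _; rewrite /sk_exit (negbTE (nek k)) !mul0r.
  by rewrite subrr mulr_ge0 ?invr_ge0 // sumr_ge0.
have gE : g b j m w = sk_exit X J (dyad m) a alpha b k j w.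
  rewrite /g (bigD1 k) //= big1 ?addr0 // => l lk; rewrite /sk_exit.
  case: (boolP (exitk X (dyad m) a l w)) => [el|_]; last by rewrite !mul0r.
  by case/eqP: lk; apply: val_inj; exact: exitk_uniq el ek.
apply: (@le_trans _ _ (M^-1 * sk_exit X J (dyad m) a 0 (2 * b) k j w)); last first.
  by rewrite ler_wpM2l ?invr_ge0 // (bigD1 k) //= lerDl sumr_ge0.
rewrite gE; set u := sk_exit _ _ _ _ alpha b _ _ _; set v := sk_exit _ _ _ _ 0 _ _ _ _.
have uv : u ^+ 2 <= v.
  rewrite /u /v /sk_exit ek !mul1r; set jj := inJ J _ j w.
  have jj0 : 0 <= jj by exact: inJ_ge0.
  have jj2 : jj ^+ 2 = jj by rewrite /jj /inJ; case: eqP; rewrite ?expr1n ?expr0n.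
  rewrite !exprMn jj2 ler_wpM2r // /damp.
  have -> : - 0 * Rsk X (dyad m) k.+1 w = 0 by rewrite oppr0 mul0r.
  rewrite expR0 ler_pM ?sqr_ge0 //.
    rewrite expr_le1 ?expR_ge0 // -expR0 ler_expR mulNr oppr_le0.
    by rewrite mulr_ge0 // Rsk_ge0.
  by rewrite -expRM_natl mulrA.
have [uM|Mu] := leP u M.
  by rewrite subrr mulr_ge0 ?invr_ge0 //; apply: s0.
apply: (@le_trans _ _ (M^-1 * u ^+ 2)); last by rewrite ler_wpM2l ?invr_ge0.
rewrite mulrC ler_pdivlMr // expr2.
have : 0 <= (u - M) ^+ 2 by exact: sqr_ge0.
have : 0 <= M * u by rewrite mulr_ge0 // ltW // (lt_trans M0).
by rewrite expr2; nra.
Qed.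

(** In the second difference of [exit_moment] the identity parts cancel, as [1 - 2 + 1 = 0]. Each
    step therefore costs at most a multiple of [dyad m] times the survival probability, and
    [surv_total_bounded] sums these. *)
Lemma sk_exit_square_bounded b j : 0 <= b -> exists2 C : R, 0 <= C &
  exists m0, forall m, (m0 <= m)%N -> forall K,
  \sum_(k < K) sk_E P X J x i (dyad m) a 0 b k j <= C.
Proof.
move=> b0.
have [C1 C10 [m0 HC1]] := surv_total_bounded a_ge0.
have b1 : 0 <= b + 1 by rewrite addr_ge0.
have b2 : 0 <= b + 2 by rewrite addr_ge0.
have [D0 [D00 HD0]] := expmx_first_order (F b).
have [D1 [D10 HD1]] := expmx_first_order (F (b + 1)).
have [D2 [D20 HD2]] := expmx_first_order (F (b + 2)).
pose Fm := \sum_l `|F (b + 2) l j - 2 * F (b + 1) l j + F b l j|.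
have Fm0 : 0 <= Fm by exact: sumr_ge0.
pose D := Fm + (D2 + 2 * D1 + D0).
have D_ge0 : 0 <= D by rewrite !addr_ge0 // mulr_ge0.
exists (expR (b * (a + 1)) + expR (b * a) * (D * C1)).
  by rewrite addr_ge0 ?mulr_ge0 ?expR_ge0.
exists m0 => m mm K.
have d0 := dyad_ge0 m : 0 <= dyad m :> R; have d1 := dyad_le1 m : dyad m <= 1 :> R.
have d01 : 0 <= (dyad m : R) <= 1 by rewrite d0.
have := @exit_moment _ _ _ _ P X J XJ_meas XJ_start XJ_markov x i (dyad m) a d0 a_ge0 F
  F_exponent b K j b0.
move=> H; apply: (le_trans H); rewrite lerD2l ler_wpM2l ?expR_ge0 //.
apply: (@le_trans _ _ (D * (dyad m * \sum_(k < K) \sum_l surv P X J x i (dyad m) a k l)));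
  last by rewrite ler_wpM2l // HC1.
rewrite mulrA mulr_sumr; apply: ler_sum => k _.
rewrite mulr_sumr; apply: ler_sum => l _.
rewrite mulrC ler_wpM2r ?surv_ge0 //.
have h0 := HD0 _ d01 l j; have h1 := HD1 _ d01 l j; have h2 := HD2 _ d01 l j.
have sq (c : R) : 0 <= c -> c * dyad m ^+ 2 <= c * dyad m.
  by move=> c0; apply: ler_wpM2l => //; rewrite expr2 ler_piMr.
have s0 := sq _ D00; have s1 := sq _ D10; have s2 := sq _ D20.
have fl : dyad m * (F (b + 2) l j - 2 * F (b + 1) l j + F b l j) <= dyad m * Fm.
  rewrite ler_wpM2l // (le_trans (ler_norm _)) // /Fm (bigD1 l) //= lerDl.
  exact: sumr_ge0.
move: h0 h1 h2 fl; rewrite !ler_norml /D.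
set e0 := expmx _ l j; set e1 := expmx _ l j; set e2 := expmx _ l j.
set dl := (l == j)%:R.
move=> /andP[_ h0] /andP[h1 _] /andP[_ h2].
rewrite mulrDl mulrDr [dyad m * (_ - _)]mulrBr.
rewrite !mulrDl; lra.
Qed.

Let f j : R := fine (\int[P x i]_w exit_integrand X J alpha a j w)%E.

Lemma exit_integrand_bounds j w : (0 <= exit_integrand X J alpha a j w <= 1)%E.
Proof.
rewrite /exit_integrand; case: (Ta X a w) => [t||]; rewrite ?lexx ?lee_fin ?ler01 //.
case: ifP => _; rewrite !lee_fin ?lexx ?ler01 // expR_ge0 /=.
rewrite -expR0 ler_expR mulNr oppr_le0 mulr_ge0 //; exact: Rreg_ge0.
Qed.

Let path_ok : {ae P x i, forall w, good_path X J w /\ 0 <= X 0 w <= a}.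
Proof.
apply: filterS2 (good_ae XJ_start x i) (X0_ae XJ_start x i) => w gw [-> _].
by split => //; exact: x_itv.
Qed.

(** The upper limit of the skeleton sums at [b = 0] is measurable and equals the integrand on good
    paths; clipping makes the bounds hold everywhere. *)
Let v_exists j : exists v : Om -> R, [/\ measurable_fun setT v,
  (forall w, 0 <= v w <= 1) &
  {ae P x i, forall w, exit_integrand X J alpha a j w = (v w)%:E}].
Proof.
pose s m w : \bar R := (g 0 j m w)%:E.
pose v0 w : \bar R := limn_esup (s ^~ w).
have mv0 : measurable_fun setT v0.
  by apply: measurable_fun_limn_esup => m; exact/measurable_EFinP.
pose v w : R := Num.min (Num.max (fine (v0 w)) 0) 1.
exists v; split.
- apply: measurable_minr; last exact: measurable_cst.
  apply: measurable_maxr; last exact: measurable_cst.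
  exact: measurableT_comp.
- move=> w; rewrite /v le_min ler01 le_max lexx orbT /= ge_min lexx orbT //.
- apply: filterS path_ok => w [gw X0].
  have cv := @sk_exit_cvg _ _ _ _ X J w gw a a_gt0 X0 alpha 0 j.
  rewrite mul0r expR0 mul1r in cv.
  have fE : exit_integrand X J alpha a j w = (fine (exit_integrand X J alpha a j w))%:E.
    by rewrite fineK // exit_integrand_fin.
  have v0E : v0 w = exit_integrand X J alpha a j w.
    rewrite fE; have cs : s ^~ w @ \oo --> (fine (exit_integrand X J alpha a j w))%:E.
      by apply: cvg_EFin => //; exact: nearW.
    rewrite /v0 is_cvg_limn_esupE; last by apply: cvgP cs.
    exact: cvg_lim cs.
  rewrite /v v0E fE /=; congr EFin.
  have := exit_integrand_bounds j w; rewrite fE !lee_fin => /andP[e0 e1].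
  by rewrite (max_idPl e0) (min_idPl e1).
Qed.

Lemma exit_value j : [/\
  (\int[P x i]_w exit_integrand X J alpha a j w = (f j)%:E)%E & 0 <= f j <= 1].
Proof.
have [v [mv v01 vE]] := v_exists j.
have iv : (P x i).-integrable setT (EFin \o v).
  apply: (@integrable_bounded _ _ _ _ _ 1) => // w; have /andP[v0 v1] := v01 w.
  by rewrite ger0_norm.
have E : (\int[P x i]_w exit_integrand X J alpha a j w = (\int[P x i]_w v w)%R%:E)%E.
  rewrite -EFin_Rintegral //; apply: ge0_ae_eq_integral_nonmeas => //.
  - by move=> w; have /andP[] := exit_integrand_bounds j w.
  - exact/measurable_EFinP.
  - by move=> w; rewrite lee_fin; have /andP[] := v01 w.
split; first by rewrite /f E.
rewrite /f E /=; apply/andP; split.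
  by apply: Rintegral_ge0 => w _; have /andP[] := v01 w.
rewrite -[leRHS](Rintegral_prob_cst (P x i)); apply: le_Rintegral => //.
  exact: (finite_measure_integrable_cst (P x i) 1 measurableT).
by move=> w _; have /andP[] := v01 w.
Qed.

Let int_sk_exit b k j m : 0 <= b ->
  (P x i).-integrable setT (EFin \o sk_exit X J (dyad m) a alpha b k j).
Proof.
move=> b0.
by have [_] := sk_step XJ_meas XJ_start XJ_markov F_exponent x i a (dyad_ge0 m)
  alpha_ge0 k j b0.
Qed.

(** The skeleton may overshoot [a] by any amount, so bounded convergence is applied to the sums
    truncated at [M]; the second moments control the excess uniformly in the mesh. *)
Lemma exit_cvg b j : 0 <= b ->
  (fun m => \sum_(k < m * 2 ^ m) sk_E P X J x i (dyad m) a alpha b k j) @ \oo -->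
  expR (b * a) * f j.
Proof.
move=> b0; have [v [mv v01 vE]] := v_exists j.
have fE : f j = \int[P x i]_w v w.
  rewrite /f (ge0_ae_eq_integral_nonmeas (g := EFin \o v)) //.
  - by move=> w; have /andP[] := exit_integrand_bounds j w.
  - exact/measurable_EFinP.
  - by move=> w; rewrite lee_fin; have /andP[] := v01 w.
have iv : (P x i).-integrable setT (EFin \o v).
  apply: (@integrable_bounded _ _ _ _ _ 1) => // w; have /andP[v0 v1] := v01 w.
  by rewrite ger0_norm.
have ig m : (P x i).-integrable setT (EFin \o g b j m).
  by apply: integrable_sum_EFin => k; exact: int_sk_exit.
have EE m : \sum_(k < m * 2 ^ m) sk_E P X J x i (dyad m) a alpha b k j =
    \int[P x i]_w g b j m w.
  by rewrite /g Rintegral_sum // => k; exact: int_sk_exit.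
rewrite (_ : (fun _ => _) = fun m => \int[P x i]_w g b j m w); last first.
  by apply/funext => m; rewrite EE.
pose e := expR (b * a); have e0 : 0 < e by exact: expR_gt0.
rewrite fE -RintegralZl // -/e.
have b20 : 0 <= 2 * b by rewrite mulr_ge0.
have [C C0 [m0 HC]] := sk_exit_square_bounded j b20.
apply/cvgrPdist_lt => eps eps0.
(* [M >= e] leaves the limit [e * v w] untouched, and [M > 2 C / eps] makes the excess smaller than
   [eps / 2]. *)
pose M := Num.max e (2 * C / eps + 1).
have M0 : 0 < M by rewrite lt_max e0.
have Me : e <= M by rewrite le_max lexx.
have MC : M^-1 * C < eps / 2.
  have MM : 2 * C / eps + 1 <= M by rewrite le_max lexx orbT.
  rewrite mulrC ltr_pdivrMr //.
  apply: (@lt_le_trans _ _ (eps / 2 * (2 * C / eps + 1))).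
    have -> : eps / 2 * (2 * C / eps + 1) = C + eps / 2 by field; rewrite gt_eqF.
    by rewrite ltrDl divr_gt0.
  by rewrite ler_wpM2l // divr_ge0 // ltW.
have cvM : (fun m => \int[P x i]_w Num.min (g b j m w) M) @ \oo -->
    \int[P x i]_w (e * v w).
  apply: (@bounded_cvg_Rintegral _ _ _ _ _ _ M).
  - by move=> m; apply: measurable_minr.
  - exact: measurable_funM.
  - move=> m w; rewrite ger0_norm; first by rewrite ge_min lexx orbT.
    by rewrite le_min g_ge0 ltW.
  - apply: filterS2 path_ok vE => w [gw X0] vw.
    have cv := @sk_exit_cvg _ _ _ _ X J w gw a a_gt0 X0 alpha b j.
    rewrite vw /= -/e in cv.
    have -> : e * v w = Num.min (e * v w) M.
      apply/esym/min_idPl; apply: le_trans Me; rewrite ler_piMr ?(ltW e0) //.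
      by have /andP[] := v01 w.
    exact: (@continuous_cvg _ _ _ _ _ _ (fun y => Num.min y M) _ (@continuous_minr_cst _ M _) cv).
have : \forall m \near \oo, `|\int[P x i]_w (e * v w) -
    \int[P x i]_w Num.min (g b j m w) M| < eps / 2.
  by move/cvgrPdist_lt : cvM; apply; rewrite divr_gt0.
move=> [m1 _ Hm1]; exists (maxn m0 m1) => // m /= mm.
have h1 := Hm1 m (leq_trans (leq_maxr _ _) mm).
have imin : (P x i).-integrable setT (EFin \o (fun w => Num.min (g b j m w) M)).
  apply: (@integrable_bounded _ _ _ _ _ M); first by apply: measurable_minr.
  move=> w; rewrite ger0_norm; first by rewrite ge_min lexx orbT.
  by rewrite le_min g_ge0 ltW.
have h2 : \int[P x i]_w g b j m w - \int[P x i]_w Num.min (g b j m w) M <= M^-1 * C.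
  rewrite -RintegralB //.
  have i0 k : (P x i).-integrable setT (EFin \o sk_exit X J (dyad m) a 0 (2 * b) k j).
    by have [_] := sk_step XJ_meas XJ_start XJ_markov F_exponent x i a (dyad_ge0 m)
      (lexx 0) k j b20.
  apply: (@le_trans _ _ (\int[P x i]_w (M^-1 *
     \sum_(k < m * 2 ^ m) sk_exit X J (dyad m) a 0 (2 * b) k j w))).
    apply: le_Rintegral => //.
    - apply: eq_integrable (integrableB measurableT (ig m) imin) => //.
    - by apply: integrable_mull => //; apply: integrable_sum_EFin => k.
    - by move=> w _; exact: g_excess.
  rewrite RintegralZl //; last by apply: integrable_sum_EFin => k.
  rewrite ler_wpM2l ?invr_ge0 ?(ltW M0) // Rintegral_sum //.
  exact: HC (leq_trans (leq_maxl _ _) mm) _.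
have h3 : 0 <= \int[P x i]_w g b j m w - \int[P x i]_w Num.min (g b j m w) M.
  rewrite subr_ge0; apply: le_Rintegral => // w _.
  by rewrite ge_min lexx.
move: h1 h2 h3 MC; rewrite !ltr_norml.
set I1 := \int[_]_w (e * v w); set I2 := \int[_]_w Num.min _ _; set I3 := \int[_]_w g _ _ _ _.
by move=> /andP[] *; apply/andP; split; lra.
Qed.

End ExitLimit.

(** * The limiting system along an ultrafilter *)

Section LimitSystem.
Context {R : realType} {d : measure_display} {Om : measurableType d} {n : nat}.
Variables (P : R -> 'I_n -> probability Om R)
          (X : R -> Om -> R) (J : R -> Om -> option 'I_n).
Hypothesis XJ_meas : MAP_measurable X J.
Hypothesis XJ_start : MAP_start_paths P X J.
Hypothesis XJ_markov : markov_additive P X J.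
Hypothesis not_nonincr : forall i, ~ {ae P 0 i, forall w, nonincr_in_state X J i w}.
Variable F : R -> 'M[R]_n.
Hypothesis F_exponent : is_matrix_exponent P X J F.
Variables (x : R) (i : 'I_n) (a alpha : R).
Hypotheses (a_gt0 : 0 < a) (alpha_ge0 : 0 <= alpha) (x_itv : 0 <= x <= a).

Let a_ge0 : 0 <= a := ltW a_gt0.
Let e_ (b : R) : R -> R := fun y => expR (b * y).
Let f j : R := fine (\int[P x i]_w exit_integrand X J alpha a j w)%E.

(** A Riemann sum, up to time [m], for the expected integral of [exp (- alpha R) phi (Y)] over the
    time spent in state [j] before the exit. *)
Definition occ m j (phi : R -> R) : R := dyad m *
  \sum_(k < m * 2 ^ m) sk_V P X J x i (dyad m) a alpha phi k j.

Let bdA m b j : R := \sum_(k < m * 2 ^ m) sk_A P X J x i (dyad m) a alpha b k j.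

Let cont_meas (phi : R -> R) : continuous phi -> measurable_fun setT phi.
Proof. exact: continuous_measurable_fun. Qed.

Let cont_bounded (phi : R -> R) : continuous phi ->
  exists2 M, 0 <= M & forall y, 0 <= y <= a -> `|phi y| <= M.
Proof.
move=> cphi; apply: bounded_on_itv => //; exact: continuous_subspaceT.
Qed.

Lemma occ_bounded (phi : R -> R) j : continuous phi -> exists B : R,
  \forall m \near \oo, `|occ m j phi| <= B.
Proof.
move=> cphi; have [M M0 HM] := cont_bounded cphi.
have [C C0 [m0 HC]] := surv_total_bounded XJ_meas XJ_start XJ_markov not_nonincr a_ge0.
exists (M * C); exists m0 => // m /= mm.
rewrite /occ normrM ger0_norm ?dyad_ge0 //.
apply: (@le_trans _ _ (dyad m * (M * \sum_(k < m * 2 ^ m) \sum_l surv P X J x i (dyad m) a k l))).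
  rewrite ler_wpM2l ?dyad_ge0 //; apply: (le_trans (ler_norm_sum _ _ _)).
  rewrite mulr_sumr; apply: ler_sum => k _.
  apply: (@le_trans _ _ (M * surv P X J x i (dyad m) a k j)).
    by apply: sk_V_le_surv => //; [exact: dyad_ge0|exact: cont_meas].
  rewrite ler_wpM2l // (bigD1 j) //= lerDl sumr_ge0 // => l _; exact: surv_ge0.
by rewrite mulrCA ler_wpM2l // HC.
Qed.

Lemma occ_lin m j (c : R) (phi psi : R -> R) : continuous phi -> continuous psi ->
  occ m j (fun y => c * phi y + psi y) = c * occ m j phi + occ m j psi.
Proof.
move=> cphi cpsi.
have [M M0 HM] := cont_bounded cphi; have [N N0 HN] := cont_bounded cpsi.
have i1 k := integrable_state P XJ_meas x i (dyad_ge0 m) alpha_ge0 k j (cont_meas cphi) M0 HM.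
have i2 k := integrable_state P XJ_meas x i (dyad_ge0 m) alpha_ge0 k j (cont_meas cpsi) N0 HN.
rewrite /occ mulrCA -mulrDr; congr (_ * _); rewrite mulr_sumr -big_split /=.
apply: eq_bigr => k _; rewrite /sk_V -(RintegralZl _ measurableT (i1 k)).
rewrite -(RintegralD measurableT (integrable_mull c measurableT (i1 k)) (i2 k)).
by apply: eq_Rintegral => w _; rewrite /sk_state; ring.
Qed.

Lemma occ_ge0 m j (phi : R -> R) :
  (forall y, 0 <= y <= a -> 0 <= phi y) -> 0 <= occ m j phi.
Proof.
move=> phi0; rewrite /occ mulr_ge0 ?dyad_ge0 // sumr_ge0 // => k _.
apply: Rintegral_ge0 => w _; rewrite /sk_state.
case: (boolP (insk X (dyad m) a k w)) => [ins|_]; last by rewrite !mul0r.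
by rewrite !mulr_ge0 ?inJ_ge0 ?expR_ge0 // phi0 // Ysk_ge0 insk_Ysk.
Qed.

Let last_V m b j : R := sk_V P X J x i (dyad m) a alpha (e_ b) (m * 2 ^ m) j.

Let e_le b : 0 <= b -> forall y, 0 <= y <= a -> `|e_ b y| <= expR (b * a).
Proof.
move=> b0 y /andP[y0 ya]; rewrite ger0_norm ?expR_ge0 // ler_expR.
by rewrite ler_wpM2l.
Qed.

(** Survival decreases, so at the index [K = m 2^m] it is at most its average over the first [K]
    indices, hence at most [C / (K dyad m) = C / m]. *)
Let last_V_cvg0 b j : 0 <= b -> (fun m => last_V m b j) @ \oo --> 0.
Proof.
move=> b0.
have [C C0 [m0 HC]] := surv_total_bounded XJ_meas XJ_start XJ_markov not_nonincr a_ge0.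
have inv0 : (fun m : nat => expR (b * a) * C * m.-1.+1%:R^-1) @ \oo --> 0.
  rewrite -[X in _ --> X](mulr0 (expR (b * a) * C)); apply: cvgMr.
  by rewrite -(cvg_shiftS); exact: cvg_harmonic.
apply/cvgr0Pnorm_le => eps eps0.
have /cvgr0Pnorm_le /(_ eps eps0) [m1 _ Hm1] := inv0.
exists (maxn (maxn m0 m1) 1) => // m /=; rewrite !geq_max => /andP[/andP[mm0 mm1] m1'].
apply: le_trans (Hm1 m mm1).
apply: (@le_trans _ _ (expR (b * a) * surv P X J x i (dyad m) a (m * 2 ^ m) j)).
  apply: sk_V_le_surv => //; rewrite ?dyad_ge0 ?expR_ge0 //; last exact: e_le.
  by apply: cont_meas; exact: continuous_expRM.
rewrite prednK // ger0_norm; last by rewrite !mulr_ge0 ?expR_ge0 ?invr_ge0.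
rewrite -mulrA ler_wpM2l ?expR_ge0 // ler_pdivlMr ?ltr0n //.
have := surv_last XJ_meas XJ_start x i a (dyad_ge0 m) (m * 2 ^ m).
have H := HC m mm0 x i (m * 2 ^ m)%N.
move=> H2; apply: le_trans H.
apply: (@le_trans _ _ (dyad m * ((m * 2 ^ m)%:R *
    \sum_l surv P X J x i (dyad m) a (m * 2 ^ m) l))); last by rewrite ler_wpM2l ?dyad_ge0.
set S := \sum_l _.
have -> : dyad m * ((m * 2 ^ m)%:R * S) = m%:R * S.
  by rewrite natrM natrX /dyad; field; rewrite expf_neq0.
rewrite mulrC ler_wpM2l // /S (bigD1 j) //= lerDl sumr_ge0 // => l _.
exact: surv_ge0.
Qed.

Let discrete_identity m b j : 0 <= b ->
  expR (b * x) * (i == j)%:R +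
  \sum_l occ m l (e_ b) * ((expmx (dyad m *: F b) l j - (l == j)%:R) / dyad m) +
  bdA m b j = last_V m b j +
  \sum_(k < m * 2 ^ m) sk_E P X J x i (dyad m) a alpha b k j.
Proof.
move=> b0; rewrite /last_V.
rewrite -(sk_identity XJ_meas XJ_start XJ_markov F_exponent i (dyad_ge0 m) alpha_ge0 x_itv
  (m * 2 ^ m) j b0) -addrA; congr (_ + _).
rewrite big_split /= /bdA; congr (_ + _).
rewrite exchange_big /=; apply: eq_bigr => l _.
rewrite /occ -mulr_suml; set V := \sum_(k < _) _; set D := _ - _.
by field; rewrite gt_eqF ?dyad_gt0.
Qed.

Section Ultra.
Variable O : set_system nat.
Hypothesis ultra : UltraFilter O.
Hypothesis finer : \oo `<=` O.

Let PO : ProperFilter O. Proof. exact: ultra_proper. Qed.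

Definition occ_lim j (phi : R -> R) : R := lim (occ ^~ j ^~ phi @ O).

Let to_O (s : nat -> R) (l : R) : s @ \oo --> l -> s @ O --> l.
Proof. by move=> sl V /sl; exact: finer. Qed.

Lemma occ_lim_cvg j (phi : R -> R) : continuous phi ->
  (fun m => occ m j phi) @ O --> occ_lim j phi.
Proof.
move=> cphi; have [B HB] := occ_bounded j cphi.
exact: (ultra_bounded_cvg ultra finer HB).
Qed.

(** Defined by the identity it has to satisfy, which makes the exit identity immediate. Its sign and
    growth come from [bd_lim_cvg], where it appears as the limit of the boundary sums. *)
Definition bd_lim b j : R := expR (b * a) * f j - expR (b * x) * (i == j)%:R -
  \sum_l occ_lim l (e_ b) * F b l j.

Lemma bd_lim_cvg b j : 0 <= b -> (fun m => bdA m b j) @ O --> bd_lim b j.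
Proof.
move=> b0.
have E : (fun m => bdA m b j) = (fun m => last_V m b j +
  \sum_(k < m * 2 ^ m) sk_E P X J x i (dyad m) a alpha b k j -
  expR (b * x) * (i == j)%:R -
  \sum_l occ m l (e_ b) * ((expmx (dyad m *: F b) l j - (l == j)%:R) / dyad m)).
  by apply/funext => m; rewrite -discrete_identity //; ring.
rewrite E /bd_lim -[expR (b * a) * f j]add0r.
apply: cvgB.
  apply: cvgB; last exact: cvg_cst.
  apply: cvgD; first by apply: to_O; exact: last_V_cvg0.
  apply: to_O.
  exact: (exit_cvg XJ_meas XJ_start XJ_markov not_nonincr F_exponent a_gt0 alpha_ge0 x_itv).
apply: cvg_sumr => l; apply: cvgM.
  by apply: occ_lim_cvg; exact: continuous_expRM.
apply: to_O; exact: (@expmx_deriv _ _ F b l j b0).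
Qed.

Lemma occ_lim_identity b j :
  expR (b * x) * (i == j)%:R + \sum_l occ_lim l (e_ b) * F b l j + bd_lim b j =
  expR (b * a) * f j.
Proof. by rewrite /bd_lim; ring. Qed.

Lemma occ_lim_lin j (c : R) (phi psi : R -> R) : continuous phi -> continuous psi ->
  occ_lim j (fun y => c * phi y + psi y) = c * occ_lim j phi + occ_lim j psi.
Proof.
move=> cphi cpsi; apply: cvg_lim => //.
rewrite (_ : occ ^~ j ^~ _ = fun m => c * occ m j phi + occ m j psi); last first.
  by apply/funext => m; rewrite occ_lin.
by apply: cvgD; [apply: cvgMr|]; exact: occ_lim_cvg.
Qed.

Lemma occ_lim_ge0 j (phi : R -> R) : continuous phi ->
  (forall y, 0 <= y <= a -> 0 <= phi y) -> 0 <= occ_lim j phi.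
Proof.
move=> cphi phi0; apply: (cvgr_to_ge (occ_lim_cvg cphi)); apply: nearW => m.
exact: occ_ge0.
Qed.

Lemma bd_lim_same j : bd_lim alpha j = 0.
Proof.
have := @bd_lim_cvg alpha j alpha_ge0.
rewrite (_ : (fun m => _) = fun=> 0); last first.
  by apply/funext => m; rewrite /bdA big1 // => k _; exact: sk_A_same.
move=> h; have h0 : (fun _ : nat => 0 : R) @ O --> (0 : R) by exact: cvg_cst.
exact: (cvg_unique (@norm_hausdorff _ _) h h0).
Qed.

Lemma bd_lim_ge0 b j : alpha <= b -> 0 <= bd_lim b j.
Proof.
move=> ab; have b0 := le_trans alpha_ge0 ab.
apply: (cvgr_to_ge (@bd_lim_cvg b j b0)); apply: nearW => m.
by apply: sumr_ge0 => k _; exact: sk_A_ge0.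
Qed.

Lemma bd_lim_growth b0 b j : alpha < b0 -> b0 <= b ->
  bd_lim b j <= (b - alpha) / (b0 - alpha) * bd_lim b0 j.
Proof.
move=> ab b0b; have b0_ge0 := ltW (le_lt_trans alpha_ge0 ab).
have b_ge0 := le_trans b0_ge0 b0b.
have h : (fun m => (b - alpha) / (b0 - alpha) * bdA m b0 j) @ O -->
    (b - alpha) / (b0 - alpha) * bd_lim b0 j.
  by apply: cvgMr; exact: bd_lim_cvg.
apply: (ler_cvg_to (@bd_lim_cvg b j b_ge0) h); apply: nearW => m.
rewrite /bdA mulr_sumr; apply: ler_sum => k _.
by apply: sk_A_growth => //; exact: dyad_ge0.
Qed.

End Ultra.

End LimitSystem.

(** * Bounds on the off-diagonal entries of [F], and the exit formula *)

Section Conclusion.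
Context {R : realType} {d : measure_display} {Om : measurableType d} {n : nat}.
Variables (P : R -> 'I_n -> probability Om R)
          (X : R -> Om -> R) (J : R -> Om -> option 'I_n).
Hypothesis XJ_meas : MAP_measurable X J.
Hypothesis XJ_start : MAP_start_paths P X J.
Hypothesis XJ_markov : markov_additive P X J.
Hypothesis not_nonincr : forall i, ~ {ae P 0 i, forall w, nonincr_in_state X J i w}.
Variable F : R -> 'M[R]_n.
Hypothesis F_exponent : is_matrix_exponent P X J F.

(** The bound [a / 2] on the modulus of [X] keeps both the regulator below [a / 2] and the reflected
    skeleton below [a]. *)
Let stay (i : 'I_n) (a : R) (q : nat) : set Om :=
  \bigcap_m \bigcap_(r in [set r | grid (dyad m : R) r <= q.+1%:R^-1])
     [set w | J (grid (dyad m) r) w = Some i /\ `|X (grid (dyad m) r) w| < a / 2].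

Let measurable_stay i a q : measurable (stay i a q).
Proof.
apply: bigcap_measurable; first by exists 0%N.
move=> m _; apply: bigcap_measurable.
  by exists 0%N => /=; rewrite grid0 invr_ge0.
move=> r _; apply: measurableI; first exact: XJ_meas.2.
have mX : measurable_fun setT (fun w => `|X (grid (dyad m) r) w|).
  by apply: measurableT_comp => //; exact: XJ_meas.1.
have := mX measurableT _ (measurable_itv `]-oo, a / 2[).
by rewrite setTI (_ : _ @^-1` _ = [set w | `|X (grid (dyad m) r) w| < a / 2]).
Qed.

Let stay_good i a w : 0 < a -> good_path X J w -> X 0 w = 0 -> J 0 w = Some i ->
  exists q, stay i a q w.
Proof.
move=> a0 gw X0 J0; have J0n : J 0 w <> None by rewrite J0.
have [e1 e10 H1] := good_J_right gw (lexx 0).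
have a2 : 0 < a / 2 by rewrite divr_gt0.
have [e2 e20 H2] := good_X_right gw (lexx 0) J0n a2.
pose e := Num.min e1 e2.
have e0 : 0 < e by rewrite lt_min e10.
exists (Num.truncn e^-1) => m _ r /= rq.
have re : grid (dyad m) r < e.
  apply: (le_lt_trans rq); rewrite invf_plt ?posrE //.
  exact: truncnS_gt.
have /andP[re1 re2] : (grid (dyad m) r < e1) && (grid (dyad m) r < e2).
  by rewrite -lt_min.
have g0 : 0 <= grid (dyad m : R) r by rewrite grid_ge0 // dyad_ge0.
split; first by rewrite H1 ?J0 // g0 add0r.
by have := H2 (grid (dyad m) r); rewrite g0 add0r X0 subr0; apply.
Qed.

Let stay_gt0 i a : 0 < a -> exists q, (0 < P 0 i (stay i a q))%E.
Proof.
move=> a0; apply: contrapT => H.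
have Z q : P 0 i (stay i a q) = 0%E.
  apply/eqP; rewrite eq_le measure_ge0 andbT leNgt; apply/negP => p.
  by apply: H; exists q.
have A : {ae P 0 i, forall w, forall q, ~ stay i a q w}.
  apply: ae_foralln => q; exists (stay i a q); split; [exact: measurable_stay|exact: Z|].
  by move=> w /= /contrapT.
have B : {ae P 0 i, forall w, False}.
  apply: filterS3 (good_ae XJ_start 0 i) (X0_ae XJ_start 0 i) A => w gw [X0 J0] nst.
  by have [q] := stay_good a0 gw X0 J0; exact: nst.
have [N [mN N0 NT]] := B.
have : P 0 i setT = 0%E.
  apply/eqP; rewrite eq_le measure_ge0 andbT -N0.
  by apply: le_measure; rewrite ?inE // => w _; apply: NT => /=.
by rewrite (@probability_setT _ _ _ (P 0 i)) => /eqP; rewrite onee_eq0.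
Qed.

(** On [stay] each of the roughly [c / dyad m] steps up to time [c] contributes 1, so the occupation
    of state [i] is at least [c] times the probability of [stay]. *)
Let occ_lower i a : 0 < a -> exists2 c : R, 0 < c &
  \forall m \near \oo, c <= occ P X J 0 i a 0 m i (fun=> 1).
Proof.
move=> a0; have [q Pq] := stay_gt0 i a0.
pose p := fine (P 0 i (stay i a q)).
have pE : P 0 i (stay i a q) = p%:E by rewrite fineK // fin_num_measure.
have p0 : 0 < p by rewrite -lte_fin -pE.
pose c : R := q.+1%:R^-1.
have c0 : 0 < c by rewrite invr_gt0.
have c1 : c <= 1 by rewrite invf_le1 // ler1n.
exists (c * p); first by rewrite mulr_gt0.
exists 2%N => // m /= m2.
have h0 := dyad_gt0 m : 0 < dyad m :> R.
have Vp k : grid (dyad m) k <= c ->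
    p <= sk_V P X J 0 i (dyad m) a 0 (fun=> 1) k i.
  move=> kc.
  have pE' : p = \int[P 0 i]_w \1_(stay i a q) w.
    by rewrite /Rintegral integral_indic // setIT.
  rewrite pE'; apply: le_Rintegral => //.
  - apply: (@integrable_bounded _ _ _ _ _ 1); first exact: measurable_indic.
    by move=> w; rewrite indicE ger0_norm // lern1 leq_b1.
  - apply: (integrable_state P XJ_meas 0 i (dyad_ge0 m) (lexx 0) (M := 1)) => //.
    by move=> y _; rewrite normr1.
  - move=> w _; rewrite indicE; case: (boolP (w \in _)) => [|_]; last first.
      by rewrite /sk_state !mulr_ge0 ?inJ_ge0 ?expR_ge0.
    rewrite inE => sw; rewrite /sk_state /damp oppr0 mul0r expR0 !mulr1.
    have Xl l : (l <= k)%N -> J (grid (dyad m) l) w = Some i /\ `|X (grid (dyad m) l) w| < a / 2.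
      move=> lk; apply: (sw m Logic.I l) => /=; apply: le_trans kc.
      by apply: grid_le => //; exact: ltW.
    have ins : insk X (dyad m) a k w.
      have Yl l : (l <= k)%N -> Ysk X (dyad m) l w <= a.
        move=> lk.
        have Rl : Rsk X (dyad m) l w <= a / 2.
          apply: Rsk_le_bound; first by rewrite divr_ge0 // ltW.
          move=> l' l'l; have [_] := Xl l' (leq_trans l'l lk).
          by rewrite ltr_norml => /andP[h _]; lra.
        have [_] := Xl l lk; rewrite ltr_norml /Ysk => /andP[_ h]; lra.
      elim: k Yl {kc Xl} => [|k IH] Yl; first by rewrite /= andbT Yl.
      by rewrite inskS Yl // andbT IH // => l lk; apply: Yl; rewrite leqW.
    by rewrite ins /inJ (Xl k (leqnn k)).1 eqxx mulr1.
(* These [K] steps cover the time [c <= 1]; as [K <= 2 ^ m + 1], they fit among the [m 2 ^ m]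
   indices once [m >= 2]. *)
pose K := (Num.truncn (c / dyad m)).+1.
have cK : c <= K%:R * dyad m by rewrite -ler_pdivrMr // ltW // truncnS_gt.
have KK : (K <= m * 2 ^ m)%N.
  have : (Num.truncn (c / dyad m) <= 2 ^ m)%N.
    rewrite -(ler_nat R); apply: (@le_trans _ _ (c / dyad m)).
      by rewrite truncn_le // divr_ge0 ?ltW.
    by rewrite /dyad invrK natrX ler_piMl // exprn_ge0.
  rewrite /K => h; apply: (@leq_trans (2 ^ m).+1) => //.
  apply: (@leq_trans (2 * 2 ^ m)); last by rewrite leq_mul2r m2 orbT.
  by rewrite mul2n -addnn -addn1 leq_add2l expn_gt0.
have Vge0 k : 0 <= sk_V P X J 0 i (dyad m) a 0 (fun=> 1) k i.
  by apply: Rintegral_ge0 => w _; rewrite /sk_state !mulr_ge0 ?inJ_ge0 ?expR_ge0.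
have sumge : \sum_(k < K) p <=
    \sum_(k < m * 2 ^ m) sk_V P X J 0 i (dyad m) a 0 (fun=> 1) k i.
  apply: (@le_trans _ _ (\sum_(k < K) sk_V P X J 0 i (dyad m) a 0 (fun=> 1) k i)).
    apply: ler_sum => k _; apply: Vp.
    apply: (@le_trans _ _ (grid (dyad m) (Num.truncn (c / dyad m)))).
      by apply: (grid_le (ltW h0)); rewrite -ltnS.
    by rewrite /grid -ler_pdivlMr // truncn_le // divr_ge0 // ltW.
  rewrite (big_ord_widen _ (fun k => sk_V P X J 0 i (dyad m) a 0 (fun=> 1) k i) KK).
  by rewrite big_mkcond; apply: ler_sum => k _; case: ifP.
rewrite /occ; apply: (@le_trans _ _ (dyad m * \sum_(k < K) p)); last first.
  by rewrite ler_wpM2l // ltW.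
rewrite sumr_const card_ord -mulr_natl mulrA ler_wpM2r ?(ltW p0) //.
by rewrite mulrC.
Qed.

Let free_ultra : exists O : set_system nat, UltraFilter O /\ \oo `<=` O.
Proof. exact: ultraFilterLemma. Qed.

(** For large [b] every term of the exit identity started at level 0 in state [i] with [alpha = 0]
    is nonnegative. One of them is [L i (exp (b .)) F b i j], and the right side is at most
    [exp (b a)] because the level is crossed without a jump. *)
Let F_offdiag_subexp i j (a : R) : 0 < a -> i != j -> exists2 c : R, 0 < c &
  exists b0 : R, forall b, b0 <= b -> 0 <= b -> c * F b i j <= expR (b * a).
Proof.
move=> a0 ij; have [OO [uO fO]] := free_ultra.
have PO : ProperFilter OO by exact: ultra_proper.
have x0 : 0 <= (0 : R) <= a by rewrite lexx ltW.
have [c c_gt0 Hc] := occ_lower i a0.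
have c1 : continuous (fun _ : R => 1 : R) by move=> ?; exact: cvg_cst.
pose L := occ_lim P X J 0 i a 0 OO.
have L1 : c <= L i (fun=> 1).
  have cv := occ_lim_cvg XJ_meas XJ_start XJ_markov not_nonincr a0 (lexx 0) uO fO c1.
  exact: (cvgr_to_ge (cv 0 i i) (fO _ Hc)).
have Lge l (phi : R -> R) : continuous phi ->
    (forall y, 0 <= y <= a -> 0 <= phi y) -> 0 <= L l phi.
  exact: (occ_lim_ge0 XJ_meas XJ_start XJ_markov not_nonincr).
have [c0 [c2 [c2_gt0 Hd]]] := F_diag_growth XJ_meas XJ_start XJ_markov not_nonincr F_exponent j.
(* From this exponent on the linear lower bound makes the diagonal entry nonnegative. *)
exists c => //; exists (- c0 / c2) => b bb b0.
have ce : continuous (fun y : R => expR (b * y)) by exact: continuous_expRM.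
have Fj : 0 <= F b j j.
  apply: le_trans (Hd b b0); move: bb; rewrite ler_pdivrMr // => bb.
  by rewrite mulrC; lra.
have Li : c <= L i (fun y => expR (b * y)).
  apply: (le_trans L1); rewrite -subr_ge0.
  have -> : L i (fun y => expR (b * y)) - L i (fun=> 1) =
      L i (fun y => -1 * 1 + expR (b * y)).
    have := occ_lim_lin XJ_meas XJ_start XJ_markov not_nonincr 0 i a0 (lexx 0) uO fO i (-1) c1 ce.
    by rewrite -/L => ->; ring.
  apply: Lge.
    by move=> y; apply: cvgD; [exact: cvg_cst|exact: ce].
  move=> y /andP[y0 _]; rewrite mulr1 addrC subr_ge0 -expR0 ler_expR.
  by rewrite mulr_ge0.
have := occ_lim_identity P X J F 0 i a 0 OO b j.
rewrite (negbTE ij) mulr0 add0r -/L.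
have A0 : 0 <= bd_lim P X J F 0 i a 0 OO b j.
  exact: (bd_lim_ge0 XJ_meas XJ_start XJ_markov not_nonincr F_exponent i a0 (lexx 0) x0 uO fO j b0).
have [_ /andP[f0 f1]] := exit_value XJ_meas XJ_start i a0 (lexx 0) x0 j.
set fj := fine _ in f0 f1 *; set Ab := bd_lim _ _ _ _ _ _ _ _ _ _ _ in A0 *.
have F0 l : 0 <= F b l j.
  by have [->//|lj] := eqVneq l j; exact: (F_offdiag_ge0 XJ_meas XJ_start F_exponent).
rewrite (bigD1 i) //= => E.
have S0 : 0 <= \sum_(l | l != i) L l (fun y => expR (b * y)) * F b l j.
  apply: sumr_ge0 => l _; rewrite mulr_ge0 //; apply: Lge => // y _; exact: expR_ge0.
have h1 : c * F b i j <= L i (fun y => expR (b * y)) * F b i j by rewrite ler_wpM2r.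
have h2 : expR (b * a) * fj <= expR (b * a) by rewrite ler_piMr ?expR_ge0.
lra.
Qed.

(** For an increment [y] one has [exp (b (y - c)) <= 1 + exp (th (y - c))], by the first term if
    [y <= c] and by the second otherwise. Taking expectations over one step and dividing by the mesh
    gives the inequality for [F] off the diagonal. *)
Let F_chernoff i j (b th c : R) : 0 <= b -> b <= th -> 0 <= c -> i != j ->
  F b i j <= expR (b * c) * (F 0 i j + expR (- (th * c)) * F th i j).
Proof.
move=> b0 bth c0 ij; have th0 := le_trans b0 bth.
have h0 : (fun m => expR (b * c) * ((expmx (dyad m *: F 0) i j - (i == j)%:R) / dyad m +
    expR (- (th * c)) * ((expmx (dyad m *: F th) i j - (i == j)%:R) / dyad m))) @ \oo -->
    expR (b * c) * (F 0 i j + expR (- (th * c)) * F th i j).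
  apply: cvgMr; apply: cvgD; first exact: (@expmx_deriv _ _ F 0 i j (lexx 0)).
  by apply: cvgMr; exact: (@expmx_deriv _ _ F th i j th0).
apply: (ler_cvg_to (@expmx_deriv _ _ F b i j b0) h0); apply: nearW => m.
have d0 := dyad_gt0 m : 0 < dyad m :> R.
rewrite (negbTE ij) !subr0.
set G0 := expmx _ i j; set G1 := expmx _ i j; set G2 := expmx _ i j.
have -> : expR (b * c) * (G1 / dyad m + expR (- (th * c)) * (G2 / dyad m)) =
    (expR (b * c) * (G1 + expR (- (th * c)) * G2)) / dyad m by ring.
rewrite ler_pM2r ?invr_gt0 //.
pose D (e : R) w := expR (e * (X (dyad m) w - X 0 w)) * inJ J (dyad m) j w.
have mD e : measurable_fun setT (D e).
  apply: measurable_funM; last exact: (measurable_inJ XJ_meas).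
  apply: measurableT_comp => //; apply: measurable_funM => //.
  by apply: measurable_funB; exact: XJ_meas.1.
have iD e : 0 <= e -> (P 0 i).-integrable setT (EFin \o D e) /\
    \int[P 0 i]_w D e w = expmx (dyad m *: F e) i j.
  move=> e0; apply: integrable_ge0_fin => //.
    by move=> w; rewrite mulr_ge0 ?expR_ge0 ?inJ_ge0.
  exact: (expX_inJ XJ_meas XJ_start F_exponent _ _ e0 (ltW d0)).
rewrite /G0 /G1 /G2 -(iD b b0).2 -(iD 0 (lexx 0)).2 -(iD th th0).2.
have i1 := integrable_mull (expR (- (th * c))) measurableT (iD th th0).1.
have i2 := integrable_add (iD 0 (lexx 0)).1 i1.
rewrite -(RintegralZl _ measurableT (iD th th0).1).
rewrite -(RintegralD measurableT (iD 0 (lexx 0)).1 i1).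
rewrite -(RintegralZl _ measurableT i2).
apply: le_Rintegral => //; [exact: (iD b b0).1|exact: integrable_mull|].
move=> w _; rewrite /D mul0r expR0 mul1r; set y := X _ w - X 0 w; set u := inJ _ _ _ _.
have -> : expR (b * c) * (u + expR (- (th * c)) * (expR (th * y) * u)) =
    expR (b * c) * (1 + expR (th * (y - c))) * u.
  have -> : expR (th * (y - c)) = expR (- (th * c)) * expR (th * y).
    by rewrite -expRD; congr expR; ring.
  ring.
rewrite ler_wpM2r ?inJ_ge0 //.
have -> : expR (b * y) = expR (b * c) * expR (b * (y - c)).
  by rewrite -expRD; congr expR; ring.
rewrite ler_wpM2l ?expR_ge0 //.
have [yc|yc] := leP y c.
  apply: (@le_trans _ _ 1); last by rewrite lerDl expR_ge0.
  by rewrite -expR0 ler_expR mulr_ge0_le0 // subr_le0.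
apply: (@le_trans _ _ (expR (th * (y - c)))); last by rewrite lerDr.
by rewrite ler_expR ler_wpM2r // subr_ge0 ltW.
Qed.

(** In [F_chernoff] let [th] grow: by [F_offdiag_subexp] at level [c / 2] the entry [F th i j] is of
    order [exp (th c / 2)] at most and loses to [exp (- th c)]. Then let [c] tend to 0. *)
Lemma F_offdiag_le0 b i j : 0 <= b -> i != j -> F b i j <= F 0 i j.
Proof.
move=> b0 ij.
have key c : 0 < c -> F b i j <= expR (b * c) * F 0 i j.
  move=> c0; have c2 : 0 < c / 2 by rewrite divr_gt0.
  have [k k0 [b1 Hk]] := F_offdiag_subexp c2 ij.
  have B0 : 0 <= Num.max b b1 by rewrite le_max b0.
  pose th (m : nat) : R := Num.max b b1 + m%:R.
  have thb m : b <= th m by rewrite (@le_trans _ _ (Num.max b b1)) ?le_max ?lexx // lerDl.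
  have thb1 m : b1 <= th m.
    by rewrite (@le_trans _ _ (Num.max b b1)) ?le_max ?lexx ?orbT // lerDl.
  have H m : F b i j <= expR (b * c) * (F 0 i j +
      k^-1 * ((1 + m%:R) * expR (- (m%:R * (c / 2))))).
    apply: (le_trans (F_chernoff b0 (thb m) (ltW c0) ij)).
    rewrite ler_wpM2l ?expR_ge0 // lerD2l.
    have th0 := le_trans b0 (thb m).
    have h := Hk (th m) (thb1 m) th0.
    have h1 : F (th m) i j <= k^-1 * expR (th m * (c / 2)).
      by rewrite mulrC ler_pdivlMr // mulrC.
    apply: (@le_trans _ _ (expR (- (th m * c)) * (k^-1 * expR (th m * (c / 2))))).
      by rewrite ler_wpM2l ?expR_ge0.
    rewrite mulrCA ler_wpM2l ?invr_ge0 ?(ltW k0) // -expRD.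
    have -> : - (th m * c) + th m * (c / 2) = - (th m * (c / 2)) by field.
    apply: (@le_trans _ _ (expR (- (m%:R * (c / 2))))).
      by rewrite ler_expR lerN2 ler_wpM2r ?(ltW c2) // lerDr.
    by rewrite ler_peMl ?expR_ge0 // lerDl.
  have lim : (fun m : nat => expR (b * c) * (F 0 i j +
      k^-1 * ((1 + m%:R) * expR (- (m%:R * (c / 2)))))) @ \oo --> expR (b * c) * F 0 i j.
    rewrite -[X in _ --> X](_ : expR (b * c) * (F 0 i j + k^-1 * 0) = _); last first.
      by rewrite mulr0 addr0.
    apply: cvgMr; apply: cvgD; first exact: cvg_cst.
    by apply: cvgMr; exact: cvg_mul_expRN.
  by apply: (cvgr_to_ge lim); exact: nearW.
have lim0 : (fun c => expR (b * c) * F 0 i j) @ 0^'+ --> F 0 i j.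
  apply: cvg_at_right_filter.
  rewrite -[X in _ --> X](_ : expR (b * 0) * F 0 i j = _); last first.
    by rewrite mulr0 expR0 mul1r.
  apply: cvgMl; apply: continuous_cvg; first exact: continuous_expR.
  by apply: cvgMr; exact: cvg_id.
apply: (cvgr_to_ge lim0); near=> c; apply: key; near: c; exact: nbhs_right_gt.
Unshelve. all: by end_near.
Qed.

Variable W : R -> 'M[R]_n.
Hypothesis W_scale : is_scale_matrix F W.

Lemma exit_value_Zmat (x : R) i (a alpha : R) : 0 < a -> 0 <= alpha -> 0 <= x <= a ->
  forall j, Zmat F W alpha x i j =
    \sum_r fine (\int[P x i]_w exit_integrand X J alpha a r w)%E * Zmat F W alpha a r j.
Proof.
move=> a0 al0 xa; have [OO [uO fO]] := free_ultra.
apply: (exit_Zmat W_scale _ _ _ al0 a0 xa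
  (L := occ_lim P X J x i a alpha OO) (A := bd_lim P X J F x i a alpha OO)).
- by move=> b l r b0 lr; exact: (F_offdiag_ge0 XJ_meas XJ_start F_exponent).
- exists (\sum_l \sum_r `|F 0 l r|) => b l r b0 lr.
  apply: (le_trans (F_offdiag_le0 b0 lr)); apply: (le_trans (ler_norm _)).
  rewrite (bigD1 l) //= (bigD1 r) //= -addrA lerDl addr_ge0 ?sumr_ge0 // => *.
  exact: sumr_ge0.
- exact: (F_diag_growth XJ_meas XJ_start XJ_markov not_nonincr F_exponent).
- by move=> *; apply: (occ_lim_lin XJ_meas XJ_start XJ_markov not_nonincr).
- by move=> *; apply: (occ_lim_ge0 XJ_meas XJ_start XJ_markov not_nonincr).
- by move=> b b0 j; exact: occ_lim_identity.
- by move=> j; apply: (bd_lim_same XJ_meas XJ_start XJ_markov not_nonincr F_exponent).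
- by move=> *; apply: (bd_lim_ge0 XJ_meas XJ_start XJ_markov not_nonincr F_exponent).
- by move=> *; apply: (bd_lim_growth XJ_meas XJ_start XJ_markov not_nonincr F_exponent).
Qed.

End Conclusion.

Theorem theorem2 (R : realType) (d : measure_display) (Om : measurableType d)
  (n : nat) (P : R -> 'I_n -> probability Om R)
  (X : R -> Om -> R) (J : R -> Om -> option 'I_n)
  (F W : R -> 'M[R]_n) :
  is_spec_neg_MAP P X J ->
  is_matrix_exponent P X J F ->
  is_scale_matrix F W ->
  forall alpha a : R, 0 <= alpha -> 0 < a ->
    Zmat F W alpha a \in unitmx /\
    forall x : R, 0 <= x <= a -> forall i j : 'I_n,
      (\int[P x i]_w exit_integrand X J alpha a j w)%E
        = ((Zmat F W alpha x *m invmx (Zmat F W alpha a)) i j)%:E.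
Proof.
move=> [XJ_meas XJ_start XJ_markov _ [not_nonincr _]] F_exponent W_scale alpha a al0 a0.
pose E x : 'M[R]_n := \matrix_(i, j) fine (\int[P x i]_w exit_integrand X J alpha a j w)%E.
have ZE x : 0 <= x <= a -> Zmat F W alpha x = E x *m Zmat F W alpha a.
  move=> xa; apply/matrixP => i j; rewrite [RHS]mxE.
  rewrite (exit_value_Zmat XJ_meas XJ_start XJ_markov not_nonincr F_exponent W_scale i a0 al0 xa).
  by apply: eq_bigr => r _; rewrite [E x i r]mxE.
have Z0 : Zmat F W alpha 0 = 1%:M.
  apply/matrixP => i j; rewrite /Zmat mulr0 expR0 scale1r.
  rewrite (_ : \matrix_(i, j) _ = 0) ?mul0mx ?subr0 //.
  by apply/matrixP => k l; rewrite !mxE set_itv1 Rintegral_set1.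
have /mulmx1_unit[_ Zu] : E 0 *m Zmat F W alpha a = 1%:M.
  by rewrite -ZE // lexx ltW.
split=> // x xa i j; rewrite (ZE x xa) mulmxK // mxE.
(* The integral is finite, so the [fine] in the definition of [E] loses nothing. *)
by have [->] := exit_value XJ_meas XJ_start i a0 al0 xa j.
Qed.
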